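(* Let $(M,\mathcal{F},\omega)$ be a transversely symplectic foliation of co-dimension $2n$ on a connected manifold $M$, and let $0\leq s\leq n-1$. Then the following statements are equivalent: 1) $(M,\mathcal{F},\omega)$ has the transverse $s$-Lefschetz property. 2) $(M,\mathcal{F},\omega)$ satisfies the symplectic $d\delta$-lemma up to degree $s$, i.e. $\operatorname{Im} d\cap\ker\delta=\operatorname{Im} d\delta=\operatorname{Im}\delta\cap\ker d$ on $\Omega^k_{bas}(M)$ for every $k\leq s$, and $\operatorname{Im} d\cap\ker\delta=\operatorname{Im} d\delta$ on $\Omega^{s+1}_{bas}(M)$. 3) $\operatorname{Im} d\cap\ker\delta=\operatorname{Im} d\delta=\operatorname{Im}\delta\cap\ker d$ on $\Omega^{k}_{bas}(M)$ for every $k\geq 2n-s$, and $\operatorname{Im}\delta\cap\ker d=\operatorname{Im} d\delta$ on $\Omega^{2n-s-1}_{bas}(M)$.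
   Context: Let $\mathcal{F}$ be a foliation on a smooth manifold $M$ with integrable subbundle $P\subset TM$. A transversely symplectic foliation is a triple $(M,\mathcal{F},\omega)$ where $\omega$ is a closed 2-form on $M$ such that for every $p\in M$ the kernel of $\omega_p$ equals $P_p$; let $2n$ be the co-dimension of $\mathcal{F}$. Horizontal forms: $\Omega_{hor}(M)=\{\alpha\in\Omega(M): \iota_X\alpha=0\ \forall X\in\Gamma(P)\}$. Basic forms: $\Omega_{bas}(M)=\{\alpha\in\Omega(M):\iota_X\alpha=0,\ \mathcal{L}_X\alpha=0\ \forall X\in\Gamma(P)\}$. The exterior derivative $d$ preserves basic forms, and the cohomology of $(\Omega^*_{bas}(M),d)$ is the basic cohomology $H^*_B(M,\mathbb{R})$; the class of a closed basic form $\alpha$ is written $[\alpha]_B$. Symplectic star: at each $x\in M$, horizontal forms at $x$ are identified with exterior forms on $T_xM/P_x$, and $\omega_x$ with a symplectic form $\sigma$ on this $2n$-dimensional space $V$. The inverse of $V\to V^*$, $X\mapsto\iota_X\sigma$, extends to $\sharp:\wedge^kV^*\to\wedge^kV$; put $B(\alpha,\beta)=\langle\sharp(\alpha),\beta\rangle$ for $\alpha,\beta\in\wedge^kV^*$, using the natural pairing of $k$-vectors and $k$-forms. The star is determined by $\beta\wedge\star\alpha=B(\beta,\alpha)\frac{\sigma^n}{n!}$ for all $\beta\in\wedge^kV^*$. This gives $\star:\Omega^k_{hor}(M)\to\Omega^{2n-k}_{hor}(M)$, which satisfies $\star^2=\mathrm{id}$ and maps basic forms to basic forms. Define $\delta\alpha=(-1)^{k+1}\star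 d\star\alpha$ for $\alpha\in\Omega^k_{bas}(M)$. Images and kernels of $d$, $\delta$, $d\delta$ are taken within the space of basic forms $\Omega_{bas}(M)$; an identity ''on $\Omega^k_{bas}(M)$'' is an equality of the corresponding subspaces of $\Omega^k_{bas}(M)$. For $0\leq s\leq n-1$, $(M,\mathcal{F},\omega)$ has the transverse $s$-Lefschetz property if for every $0\leq k\leq s$ the map $L^{n-k}:H^k_B(M,\mathbb{R})\to H^{2n-k}_B(M,\mathbb{R})$, $[\alpha]_B\mapsto[\omega^{n-k}\wedge\alpha]_B$, is an isomorphism. *)

(* Defs.v *)
From mathcomp Require Import all_boot all_order all_algebra.
From mathcomp Require Import all_classical all_reals all_analysis.

Set Implicit Arguments.
Unset Strict Implicit.
Unset Printing Implicit Defensive.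

Import Order.TTheory GRing.Theory Num.Theory.
Import numFieldNormedType.Exports.

Local Open Scope classical_set_scope.
Local Open Scope ring_scope.

(* [U] is meant to be open; [Cn k U f] says that [f] is of class C^k on [U].
   Since the source is finite-dimensional, [x |-> 'd f x] is C^k iff every
   [x |-> 'D_v f x] is. *)
Fixpoint Cn (R : realType) (m : nat) (W : normedModType R) (k : nat)
    (U : set 'rV[R]_m) (f : 'rV[R]_m -> W) : Prop :=
  match k with
  | 0%N => forall x, U x -> {for x, continuous f}
  | k'.+1 => (forall x, U x -> differentiable f x) /\
             (forall v, Cn k' U (fun x => 'D_v f x))
  end.

Definition smooth_on (R : realType) (m : nat) (W : normedModType R)
    (U : set 'rV[R]_m) (f : 'rV[R]_m -> W) : Prop :=
  forall k, Cn k U f.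

(* A homeomorphism from the open set [cdom] onto an open subset of R^m, given
   by total functions; only the values of [cfun] on [cdom] and of [cinv] on
   [cimg] matter. *)
Record chart (R : realType) (m : nat) (T : topologicalType) := Chart {
  cdom : set T;
  cfun :> T -> 'rV[R]_m;
  cinv : 'rV[R]_m -> T;
  cdom_open : open cdom;
  cimg_open : open (cfun @` cdom);
  cfunK : forall q, cdom q -> cinv (cfun q) = q;
  cfun_continuous : forall q, cdom q -> {for q, continuous cfun};
  cinv_continuous : forall y, (cfun @` cdom) y -> {for y, continuous cinv} }.

Definition cimg (R : realType) (m : nat) (T : topologicalType)
    (c : chart R m T) : set 'rV[R]_m := c @` cdom c.

Definition smooth_transition (R : realType) (m : nat) (T : topologicalType)
    (c c' : chart R m T) : Prop :=
  smooth_on (c @` (cdom c `&` cdom c')) (c' \o cinv c).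

(* The smooth structure is given by an atlas together with a preferred chart
   [chart_at p] around each point; discarding the other charts of the atlas
   does not change the smooth structure, so the atlas is [range chart_at]. *)
Record manifold (R : realType) (m : nat) := Manifold {
  points :> topologicalType;
  points_hausdorff : hausdorff_space points;
  points_second_countable : @second_countable points;
  chart_at : points -> chart R m points;
  chart_at_dom : forall p, cdom (chart_at p) p;
  chart_at_smooth : forall p q, smooth_transition (chart_at p) (chart_at q) }.

(* The charts of the maximal atlas. *)
Definition admissible (R : realType) (m : nat) (M : manifold R m)
    (c : chart R m M) : Prop :=
  forall p, smooth_transition c (chart_at p) /\ smooth_transition (chart_at p) c.

(* The tangent space T_qM is 'rV[R]_m, a tangent vector being represented by its
   coordinates in the preferred chart at [q].  [dchart c q] : T_qM -> R^m is the
   differential of the chart [c] at [q], and [dcinv c y] : R^m -> T_qM is that of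
   its inverse at [y], where q = cinv c y. *)
Definition dchart (R : realType) (m : nat) (M : manifold R m)
    (c : chart R m M) (q : M) (v : 'rV[R]_m) : 'rV[R]_m :=
  'D_v (c \o cinv (chart_at q)) (chart_at q q).

Definition dcinv (R : realType) (m : nat) (M : manifold R m)
    (c : chart R m M) (y : 'rV[R]_m) (u : 'rV[R]_m) : 'rV[R]_m :=
  'D_u (chart_at (cinv c y) \o cinv c) y.

(* A possibly inhomogeneous exterior form on R^m, as a function of the list of
   its arguments: the component of degree [k] is the restriction to the lists of
   length [k]. *)
Definition covec (R : realType) (m : nat) : Type := seq 'rV[R]_m -> R.

Definition altform (R : realType) (m : nat) (k : nat) (a : covec R m) : Prop :=
  [/\ forall s, size s <> k -> a s = 0,
      forall s t (c : R) u v,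
        a (s ++ (c *: u + v) :: t) = c * a (s ++ u :: t) + a (s ++ v :: t)
    & forall s t r u, a (s ++ u :: t ++ u :: r) = 0].

(* The shuffle formula: [A] is the set of positions of the arguments fed to [a],
   and the sign is that of the corresponding shuffle. *)
Definition wedge (R : realType) (m : nat) (a b : covec R m) : covec R m :=
  fun s => \sum_(A : {set 'I_(size s)})
    (-1) ^+ #|[pred ij : 'I_(size s) * 'I_(size s) |
                [&& ij.1 \notin A, ij.2 \in A & (ij.1 < ij.2)%N]]|
    * a [seq s`_(nat_of_ord i) | i <- enum A]
    * b [seq s`_(nat_of_ord i) | i <- enum (~: A)%SET].

Definition covec1 (R : realType) (m : nat) : covec R m :=
  fun s => (s == [::])%:R.

Definition wedges (R : realType) (m : nat) (fs : seq (covec R m)) : covec R m :=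
  foldr (@wedge R m) (@covec1 R m) fs.

Definition wpow (R : realType) (m : nat) (a : covec R m) (j : nat) : covec R m :=
  iter j (wedge a) (@covec1 R m).

(* Here E = R^m is the tangent space, [P] the fibre of the foliation and [sg]
   the 2-form with kernel [P], inducing a symplectic form on V = E / P.
   Exterior k-forms on V are the k-forms on E that satisfy [hcovec P k], and
   vectors of V are represented by vectors of E. *)
Definition hcovec (R : realType) (m : nat) (P : {vspace 'rV[R]_m}) (k : nat)
    (a : covec R m) : Prop :=
  altform k a /\ forall v s, v \in P -> a (v :: s) = 0.

(* A representative of the image of the 1-form [f] under V^* -> V. *)
Definition sharp1 (R : realType) (m : nat) (sg f : covec R m) : 'rV[R]_m :=
  xget 0 [set X | forall w, sg [:: X; w] = f [:: w]].

(* A k-vector on V is represented by the linear functional it induces on k-forms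
   through the natural pairing; X_1 ^ ... ^ X_k is b |-> b (X_1, ..., X_k).
   [is_sharp P sg S] says that [S] is linear in each degree and that it sends
   f_1 ^ ... ^ f_k to f_1^# ^ ... ^ f_k^#. *)
Definition is_sharp (R : realType) (m : nat) (P : {vspace 'rV[R]_m})
    (sg : covec R m) (S : covec R m -> covec R m -> R) : Prop :=
  (forall k (c : R) a a' b, hcovec P k a -> hcovec P k a' -> hcovec P k b ->
     S (c *: a + a') b = c * S a b + S a' b) /\
  (forall (fs : seq (covec R m)) b,
     (forall f, f \in fs -> hcovec P 1 f) -> hcovec P (size fs) b ->
     S (wedges fs) b = b [seq sharp1 sg f | f <- fs]).

Definition sharp (R : realType) (m : nat) (P : {vspace 'rV[R]_m})
    (sg : covec R m) : covec R m -> covec R m -> R :=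
  xget (fun _ _ => 0) [set S | is_sharp P sg S].

(* B(a, b) = < #a, b > *)
Definition sform (R : realType) (m : nat) (P : {vspace 'rV[R]_m})
    (sg a b : covec R m) : R :=
  sharp P sg a b.

Definition liouville (R : realType) (m n : nat) (sg : covec R m) : covec R m :=
  (n`!%:R)^-1 *: wpow sg n.

(* The star of the k-form [a] on the 2n-dimensional space V; it is 0 when
   k > 2n, in which case all k-forms on V vanish. *)
Definition star_at (R : realType) (m n : nat) (P : {vspace 'rV[R]_m})
    (sg : covec R m) (k : nat) (a : covec R m) : covec R m :=
  xget 0 [set g | exists l : nat, [/\ (k + l)%N = n.*2, hcovec P l g
    & forall b, hcovec P k b -> wedge b g = sform P sg b a *: liouville n sg]].

(* [X p] is an element of T_pM. *)
Definition vector_field (R : realType) (m : nat) (M : manifold R m) : Type :=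
  M -> 'rV[R]_m.

Definition vloc (R : realType) (m : nat) (M : manifold R m) (c : chart R m M)
    (X : vector_field M) (y : 'rV[R]_m) : 'rV[R]_m :=
  dchart c (cinv c y) (X (cinv c y)).

Definition smooth_vector_field (R : realType) (m : nat) (M : manifold R m)
    (X : vector_field M) : Prop :=
  forall p, smooth_on (cimg (chart_at p)) (vloc (chart_at p) X).

(* [a p] is an exterior form on T_pM. *)
Definition dform (R : realType) (m : nat) (M : manifold R m) : Type :=
  M -> covec R m.

(* The pullback of [a] to [cimg c] by the inverse of the chart [c]. *)
Definition floc (R : realType) (m : nat) (M : manifold R m) (c : chart R m M)
    (a : dform M) (y : 'rV[R]_m) : covec R m :=
  fun s => a (cinv c y) [seq dcinv c y u | u <- s].

(* Omega^k(M); for constant [s], [fun y => floc c a y s] is a combination of the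
   coefficients of [a] in the chart [c]. *)
Definition Omega (R : realType) (m : nat) (M : manifold R m) (k : nat) :
    set (dform M) :=
  [set a | (forall p, altform k (a p)) /\
     (forall p s, smooth_on (cimg (chart_at p))
                    (fun y => floc (chart_at p) a y s : R))].

Definition wedge_form (R : realType) (m : nat) (M : manifold R m)
    (a b : dform M) : dform M :=
  fun p => wedge (a p) (b p).

(* In a chart, (da)(v_0, ..., v_k) =
   sum_i (-1)^i D_{v_i} (a (v_0, ..., omit v_i, ..., v_k)) for constant vectors. *)
Definition extd (R : realType) (m : nat) (M : manifold R m) (a : dform M) :
    dform M :=
  fun p s => \sum_(i < size s) (-1) ^+ i *
    'D_(s`_i) (fun y => floc (chart_at p) a y (take i s ++ drop i.+1 s) : R)
      (chart_at p p).

Definition iota_form (R : realType) (m : nat) (M : manifold R m)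
    (X : vector_field M) (a : dform M) : dform M :=
  fun p s => a p (X p :: s).

(* In a chart, (L_X a)(v_1, ..., v_k) =
   D_X (a (v_1, ..., v_k)) + sum_i a (v_1, ..., D_{v_i} X, ..., v_k) for constant
   vectors, that is X (a (v_1, ..., v_k)) - sum_i a (v_1, ..., [X, v_i], ..., v_k). *)
Definition lie_form (R : realType) (m : nat) (M : manifold R m)
    (X : vector_field M) (a : dform M) : dform M :=
  fun p s =>
    'D_(X p) (fun y => floc (chart_at p) a y s : R) (chart_at p p) +
    \sum_(i < size s)
      a p (set_nth 0 s i ('D_(s`_i) (vloc (chart_at p) X) (chart_at p p))).

(* A foliation of codimension [c], given by its tangent bundle P: around every
   point there is a foliated chart, i.e. an admissible chart (x_0, ..., x_{m-1})
   in which P is defined by dx_0 = ... = dx_{c-1} = 0. *)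
Record foliation (R : realType) (m : nat) (M : manifold R m) (c : nat) :=
  Foliation {
    tangent :> M -> {vspace 'rV[R]_m};
    codim_le : (c <= m)%N;
    foliated_chart : forall p, exists x : chart R m M,
      [/\ admissible x, cdom x p
        & forall q, cdom x q -> forall v, v \in tangent q <->
            (forall j : 'I_m, (j < c)%N -> dchart x q v ord0 j = 0)] }.

Definition sections (R : realType) (m : nat) (M : manifold R m) (c : nat)
    (F : foliation M c) : set (vector_field M) :=
  [set X | smooth_vector_field X /\ forall p, X p \in F p].

Definition transversely_symplectic (R : realType) (m : nat) (M : manifold R m)
    (n : nat) (F : foliation M n.*2) (omega : dform M) : Prop :=
  [/\ Omega 2 omega, extd omega = 0
    & forall p v, v \in F p <-> (forall w, omega p [:: v; w] = 0)].

Definition Omega_hor (R : realType) (m : nat) (M : manifold R m) (c : nat)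
    (F : foliation M c) (k : nat) : set (dform M) :=
  [set a | Omega k a /\ forall X, sections F X -> iota_form X a = 0].

Definition Omega_bas (R : realType) (m : nat) (M : manifold R m) (c : nat)
    (F : foliation M c) (k : nat) : set (dform M) :=
  [set a | Omega k a /\
     forall X, sections F X -> iota_form X a = 0 /\ lie_form X a = 0].

Definition star (R : realType) (m : nat) (M : manifold R m) (n : nat)
    (F : foliation M n.*2) (omega : dform M) (k : nat) (a : dform M) : dform M :=
  fun p => star_at n (F p) (omega p) k (a p).

(* delta on Omega_bas^k(M); the inner star takes values in degree 2n - k. *)
Definition delta (R : realType) (m : nat) (M : manifold R m) (n : nat)
    (F : foliation M n.*2) (omega : dform M) (k : nat) (a : dform M) : dform M :=
  (-1) ^+ k.+1 *: star F omega (n.*2 - k).+1 (extd (star F omega k a)).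

(* The following are the intersections with Omega_bas^k(M) of the kernels and
   images of d, delta and d delta on Omega_bas(M); as these operators are
   homogeneous, images of homogeneous elements suffice. *)
Definition ker_d (R : realType) (m : nat) (M : manifold R m) (n : nat)
    (F : foliation M n.*2) (k : nat) : set (dform M) :=
  Omega_bas F k `&` [set a | extd a = 0].

Definition im_d (R : realType) (m : nat) (M : manifold R m) (n : nat)
    (F : foliation M n.*2) (k : nat) : set (dform M) :=
  Omega_bas F k `&` \bigcup_j (@extd R m M @` Omega_bas F j).

Definition ker_delta (R : realType) (m : nat) (M : manifold R m) (n : nat)
    (F : foliation M n.*2) (omega : dform M) (k : nat) : set (dform M) :=
  Omega_bas F k `&` [set a | delta F omega k a = 0].

Definition im_delta (R : realType) (m : nat) (M : manifold R m) (n : nat)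
    (F : foliation M n.*2) (omega : dform M) (k : nat) : set (dform M) :=
  Omega_bas F k `&` \bigcup_j (delta F omega j @` Omega_bas F j).

Definition im_ddelta (R : realType) (m : nat) (M : manifold R m) (n : nat)
    (F : foliation M n.*2) (omega : dform M) (k : nat) : set (dform M) :=
  Omega_bas F k `&`
    \bigcup_j ((fun a => extd (delta F omega j a)) @` Omega_bas F j).

(* The class of [a] in degree [k], as a coset of the exact basic forms. *)
Definition basic_class (R : realType) (m : nat) (M : manifold R m) (n : nat)
    (F : foliation M n.*2) (k : nat) (a : dform M) : set (dform M) :=
  [set b | ker_d F k b /\ im_d F k (b - a)].

Definition basic_cohomology (R : realType) (m : nat) (M : manifold R m)
    (n : nat) (F : foliation M n.*2) (k : nat) : set (set (dform M)) :=
  basic_class F k @` ker_d F k.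

Definition lefschetz (R : realType) (m : nat) (M : manifold R m)
    (omega : dform M) (j : nat) (a : dform M) : dform M :=
  wedge_form (fun p => wpow (omega p) j) a.

(* [a] |-> [omega^(n-k) ^ a] on cosets.  All representatives have the same image
   because omega is closed and basic, so the union is a single coset. *)
Definition lefschetz_class (R : realType) (m : nat) (M : manifold R m) (n : nat)
    (F : foliation M n.*2) (omega : dform M) (k : nat) (C : set (dform M)) :
    set (dform M) :=
  \bigcup_(a in C) basic_class F (n.*2 - k) (lefschetz omega (n - k) a).

(* The map is induced by a linear map of forms, hence linear, so it is an
   isomorphism iff it is bijective. *)
Definition transverse_lefschetz (R : realType) (m : nat) (M : manifold R m)
    (n : nat) (F : foliation M n.*2) (omega : dform M) (s : nat) : Prop :=
  forall k, (k <= s)%N ->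
    set_bij (basic_cohomology F k) (basic_cohomology F (n.*2 - k))
      (lefschetz_class F omega k).

(* Main.v *)
Require Import Defs.
From HB Require Import structures.
From mathcomp Require Import all_boot all_order all_algebra.
From mathcomp Require Import all_classical all_reals all_analysis.
From mathcomp Require Import perm.
From mathcomp Require Import ring lra zify.

Set Implicit Arguments.
Unset Strict Implicit.
Unset Printing Implicit Defensive.

Import Order.TTheory GRing.Theory Num.Theory.
Import numFieldNormedType.Exports.

Local Open Scope classical_set_scope.
Local Open Scope ring_scope.

(** Let L be the exterior product with omega and Lam the contraction with the
    dual bivector.  On horizontal forms of degree k, [Lam, L] = n - k, and the
    star is, up to a sign depending on k, the operator
    S = sum_j (-1)^j / (j! (n-k+j)!) L^(n-k+j) Lam^j, which conjugates L to -Lam.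
    Since omega is closed, d and [d, Lam] span a two-dimensional representation
    of sl2, so S d = [d, Lam] S, and delta is a non-zero multiple of [d, Lam] in
    each degree.  Basic forms are stable under L, Lam and d, so everything takes
    place in a finitely graded sl2-module.  Conjugation by S exchanges d with
    delta and degree k with 2n - k, which gives 2) <=> 3).

    1) => 2): exact forms in the kernel of delta, and closed forms in the image
    of delta, are harmonic (d = delta = 0), and harmonic forms are sl2-stable.
    Write a harmonic exact form of degree k <= s+1 as a0 + L b with a0 primitive.
    Injectivity of the Lefschetz map in degree k-2 shows that b is exact, hence
    in the image of d delta by induction.  If a0 = d x, surjectivity in degree
    k-1 lets one modify x by a closed form so as to lie in Im delta + Im d.
    2) => 1): the d delta-lemma makes every class of degree k <= s harmonic, and
    the harmonic forms satisfy hard Lefschetz. *)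

(** * Exterior algebra of a vector space *)

(** The obstacle is to recognise delta in [d, Lam] without Darboux coordinates. Operators form a
    module under commutators with L and Lam. There d is an extremal vector: it commutes with L and
    raises the degree by one, so its weight has absolute value one. Degrees are bounded, so iterated
    commutators of d with Lam eventually vanish, and the sl2 coefficients then force the second one
    to vanish already. The only special input is d L = L d. The same two-dimensional representation
    occurs at each point: exterior product with [icov u sg] and contraction with u satisfy the
    relations of d and [d, Lam]. One formal computation, [weyl_intertwine], therefore serves twice.
    In the exterior algebra, where every form is built from 1 by exterior products, it yields the
    square of S, the relation between S L and Lam S, and the comparison of S with the star. On the
    manifold it yields S d = [d, Lam] S. *)

Lemma scaleRE (R : realType) (k x : R) : k *: x = k * x.
Proof. by []. Qed.

Definition icov (R : realType) (m : nat) (v : 'rV[R]_m) (a : covec R m) :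
  covec R m := fun s => a (v :: s).

(** The parity involution. It carries the sign of the graded Leibniz rules, so that identities on
    [wedge] hold for all functions on lists, homogeneous and alternating or not. *)
Definition sgcov (R : realType) (m : nat) (a : covec R m) : covec R m :=
  fun s => (-1) ^+ size s * a s.

(** * Shuffle products and their recursion on the first argument *)

Section ShuffleRecursion.
Variables (R : realType) (m : nat).
Implicit Types (a b c : covec R m) (v : 'rV[R]_m) (s : seq 'rV[R]_m).

Definition ninv n (A : {set 'I_n}) : nat :=
  #|[pred ij : 'I_n * 'I_n | [&& ij.1 \notin A, ij.2 \in A & (ij.1 < ij.2)%N]]|.

Lemma ninvE n (A : {set 'I_n}) :
  ninv A = (\sum_(i < n) \sum_(j < n)
             ((i \notin A) && (j \in A) && (i < j)%N : nat))%N.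
Proof.
rewrite /ninv -sum1_card big_mkcond /= pair_bigA /=.
apply: eq_bigr => -[i j] _; rewrite inE /=.
by case: (i \notin A); case: (j \in A); case: (i < j)%N.
Qed.

(** Position 0 precedes all others: outside A it forms an inversion with each element of A, inside A
    with none. *)
Lemma ninvS n (A : {set 'I_n.+1}) :
  ninv A = ((ord0 \notin A) * #|(lift ord0 @^-1: A)%SET|
            + ninv (lift ord0 @^-1: A)%SET)%N.
Proof.
rewrite !ninvE big_ord_recl; congr addn.
  rewrite big_ord_recl /= ltnn andbF add0n -sum1_card big_distrr /= [RHS]big_mkcond /=.
  apply: eq_bigr => i _; rewrite inE andbT.
  by case: (ord0 \in A); case: (lift ord0 i \in A).
apply: eq_bigr => i _; rewrite big_ord_recl ltn0 andbF add0n.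
by apply: eq_bigr => j _; rewrite !inE.
Qed.

Lemma enum_setS n (A : {set 'I_n.+1}) :
  enum A = (if ord0 \in A then [:: ord0] else [::])
    ++ [seq lift ord0 i | i <- enum (lift ord0 @^-1: A)%SET].
Proof.
have enE k (B : {set 'I_k}) : enum B = [seq x <- enum 'I_k | x \in B].
  by rewrite /enum_mem -filter_predI; apply: eq_filter => x; rewrite inE /= ?andbT.
rewrite !enE enum_ordSl /= filter_map.
have -> : [seq x <- enum 'I_n | preim (lift ord0) [in A] x] =
          [seq x <- enum 'I_n | x \in (lift ord0 @^-1: A)%SET].
  by apply: eq_filter => x; rewrite !inE.
by case: ifP.
Qed.

Lemma wedge_nil a b : wedge a b [::] = a [::] * b [::].
Proof.
rewrite /wedge (big_pred1 finset.set0) => [|A]; last first.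
  by apply/esym/eqP/finset.setP => -[].
rewrite -[X in (-1) ^+ X]/(ninv _) ninvE big_ord0 expr0 mul1r.
rewrite enum_set0 /= (_ : enum (~: finset.set0)%SET = [::]) //.
by apply: size0nil; rewrite -cardE cardsE; apply: eq_card0 => -[].
Qed.

(** Shuffles are sorted by whether the first argument goes to a or to b; in the second case it jumps
    over all arguments of a, whence [sgcov]. This contraction rule lets later identities go by
    induction on the list of arguments. *)
Lemma wedge_cons a b v s :
  wedge a b (v :: s) = wedge (icov v a) b s + wedge (sgcov a) (icov v b) s.
Proof.
pose h (A : {set 'I_(size s)}) := (lift ord0 @: A)%SET.
have hK A : (lift ord0 @^-1: h A)%SET = A.
  by apply/finset.setP => i; rewrite inE mem_imset //; exact: lift_inj.
have h0 A : ord0 \notin h A.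
  by apply/imsetP => -[i _] /eqP; rewrite (negPf (neq_lift _ _)).
have lU (A B : {set 'I_(size s).+1}) : (lift ord0 @^-1: (A :|: B))%SET =
    ((lift ord0 @^-1: A) :|: (lift ord0 @^-1: B))%SET by rewrite preimsetU.
have l0 : (lift ord0 @^-1: [set ord0 : 'I_(size s).+1])%SET = finset.set0.
  by apply/finset.setP => i; rewrite !inE eq_sym (negPf (neq_lift _ _)).
have lC (A : {set 'I_(size s).+1}) :
   (lift ord0 @^-1: (~: A))%SET = (~: (lift ord0 @^-1: A))%SET by rewrite preimsetC.
rewrite {1}/wedge (bigID (fun A : {set 'I_(size s).+1} => ord0 \in A)) /=.
congr (_ + _).
  rewrite (reindex_onto (fun B => ord0 |: h B) (fun A => lift ord0 @^-1: A))%SET.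
    apply: eq_big => [B|B _].
      by rewrite finset.setU11 lU l0 hK finset.set0U eqxx.
    rewrite -!/(ninv _) ninvS finset.setU11 mul0n add0n lU l0 hK finset.set0U; congr (_ * _ * _).
      by rewrite enum_setS finset.setU11 lU l0 hK finset.set0U /= -map_comp.
    by rewrite enum_setS !inE eqxx /= lC lU l0 hK finset.set0U -map_comp.
  move=> A A0; apply/finset.setP => i; rewrite !inE; case: (unliftP ord0 i) => [j|] ->.
    by rewrite eq_sym (negPf (neq_lift _ _)) /= mem_imset ?inE //; exact: lift_inj.
  by rewrite eqxx A0.
rewrite (reindex_onto h (fun A => lift ord0 @^-1: A))%SET.
  apply: eq_big => [B|B _]; first by rewrite h0 hK eqxx.
  rewrite -!/(ninv _) ninvS h0 mul1n hK exprD.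
  rewrite enum_setS (negPf (h0 B)) hK /= -map_comp.
  rewrite enum_setS inE h0 lC hK /= -map_comp /sgcov /icov size_map -cardE.
  by rewrite [X in _ = X * _]mulrCA mulrA.
move=> A A0; apply/finset.setP => i; case: (unliftP ord0 i) => [j|] ->.
  by rewrite mem_imset ?inE //; exact: lift_inj.
by rewrite (negPf A0) (negPf (h0 _)).
Qed.
End ShuffleRecursion.

(** * Algebra of the exterior product *)

Section CovectorAlgebra.
Variables (R : realType) (m : nat).
Implicit Types (a b c : covec R m) (u v : 'rV[R]_m) (s : seq 'rV[R]_m).

Lemma icov_wedge a b v :
  icov v (wedge a b) = wedge (icov v a) b + wedge (sgcov a) (icov v b).
Proof. by apply/funext => s; exact: wedge_cons. Qed.

Lemma icovD v a b : icov v (a + b) = icov v a + icov v b. Proof. by []. Qed.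
Lemma icovN v a : icov v (- a) = - icov v a. Proof. by []. Qed.
Lemma icovZ v k a : icov v (k *: a) = k *: icov v a. Proof. by []. Qed.

Lemma sgcovK : involutive (@sgcov R m).
Proof. by move=> a; apply/funext => s; rewrite /sgcov signrMK. Qed.

Lemma icov_sgcov v a : icov v (sgcov a) = - sgcov (icov v a).
Proof.
by apply/funext => s; rewrite /icov /sgcov /= exprS !mulN1r mulNr.
Qed.

Lemma wedge_is_linear a : linear (wedge a).
Proof.
move=> k b c; apply/funext => s; rewrite !fctE /wedge scaler_sumr -big_split /=.
by apply: eq_bigr => A _; rewrite !scaleRE mulrDr mulrCA.
Qed.

HB.instance Definition _ a :=
  GRing.isLinear.Build R (covec R m) (covec R m) _ (wedge a)
    (wedge_is_linear a).

Lemma wedgeDl a a' b : wedge (a + a') b = wedge a b + wedge a' b.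
Proof.
apply/funext => s; rewrite !fctE /wedge -big_split /=.
by apply: eq_bigr => A _; rewrite mulrDr mulrDl.
Qed.

Lemma wedgeZl k a b : wedge (k *: a) b = k *: wedge a b.
Proof.
apply/funext => s; rewrite !fctE /wedge scaler_sumr.
by apply: eq_bigr => A _; rewrite !scaleRE mulrCA -!mulrA.
Qed.

Lemma wedgeNl a b : wedge (- a) b = - wedge a b.
Proof. by rewrite -(scaleN1r a) wedgeZl scaleN1r. Qed.

Lemma wedge0l b : wedge 0 b = 0.
Proof. by rewrite -[in LHS](scale0r 0) wedgeZl scale0r. Qed.

Lemma wedgeZr k a b : wedge a (k *: b) = k *: wedge a b.
Proof. exact: linearZ. Qed.

Lemma wedge_sumr a (I : Type) (r : seq I) (F : I -> covec R m) :
  wedge a (\sum_(i <- r) F i) = \sum_(i <- r) wedge a (F i).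
Proof. exact: linear_sum. Qed.

Lemma icov1 v : icov v (@covec1 R m) = 0.
Proof. by []. Qed.

Lemma sgcov1 : sgcov (@covec1 R m) = @covec1 R m.
Proof.
by apply/funext => -[|v s]; rewrite /sgcov /covec1 ?expr0 ?mul1r ?mulr0.
Qed.

Lemma wedge1l a : wedge (@covec1 R m) a = a.
Proof.
apply/funext => s; elim: s a => [|v s IHs] a.
  by rewrite wedge_nil /covec1 mul1r.
by rewrite wedge_cons icov1 wedge0l sgcov1 IHs add0r.
Qed.

Lemma wedge1r a : wedge a (@covec1 R m) = a.
Proof.
apply/funext => s; elim: s a => [|v s IHs] a.
  by rewrite wedge_nil /covec1 mulr1.
by rewrite wedge_cons icov1 linear0 IHs addr0.
Qed.

Lemma sgcov_wedge a b : sgcov (wedge a b) = wedge (sgcov a) (sgcov b).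
Proof.
apply/funext => s; elim: s a b => [|v s IHs] a b.
  by rewrite /sgcov !wedge_nil /= !expr0 !mul1r.
rewrite wedge_cons {1}/sgcov /= exprS mulN1r mulNr wedge_cons mulrDr.
rewrite -!/(sgcov _ s) !IHs !icov_sgcov wedgeNl linearN /=.
by rewrite !fctE -opprD.
Qed.

Lemma wedgeA a b c : wedge a (wedge b c) = wedge (wedge a b) c.
Proof.
apply/funext => s; elim: s a b c => [|v s IHs] a b c.
  by rewrite !wedge_nil mulrA.
rewrite !wedge_cons !icov_wedge wedgeDl linearD !fctE /= !IHs addrA.
by rewrite sgcov_wedge.
Qed.

(** The two parities are proved together because contraction exchanges them. *)
Lemma wedgeC_parity s a b :
  (sgcov b = b -> wedge a b s = wedge b a s) /\
  (sgcov b = - b -> wedge a b s = wedge b (sgcov a) s).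
Proof.
elim: s a b => [|v s IHs] a b.
  by rewrite /sgcov !wedge_nil /= expr0 mul1r mulrC.
split=> eb; rewrite !wedge_cons.
  rewrite (IHs _ b).1 // (IHs _ (icov v b)).2; last first.
    by apply: oppr_inj; rewrite -icov_sgcov eb opprK.
  by rewrite sgcovK eb addrC.
rewrite (IHs _ b).2 // (IHs _ (icov v b)).1; last first.
  by apply: oppr_inj; rewrite -icov_sgcov eb.
by rewrite eb icov_sgcov wedgeNl linearN opprK addrC.
Qed.

Lemma wedgeC_even a b : sgcov b = b -> wedge a b = wedge b a.
Proof. by move=> eb; apply/funext => s; apply: (wedgeC_parity s a b).1. Qed.

End CovectorAlgebra.

(** * Alternating multilinear forms *)

Section AlternatingForms.
Variables (R : realType) (m : nat).
Implicit Types (a b c : covec R m) (u v : 'rV[R]_m) (s : seq 'rV[R]_m).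

Lemma altform_lin k (r : R) a b :
  altform k a -> altform k b -> altform k (r *: a + b).
Proof.
move=> [a0 al aa] [b0 bl ba]; split=> [s sk|s t x u v|s t p u]; rewrite !fctE.
- by rewrite a0 // b0 // scaler0 addr0.
- by rewrite al bl !scaleRE; ring.
- by rewrite aa ba scaler0 addr0.
Qed.

Lemma altform_zero k : altform k (0 : covec R m).
Proof. by split=> // *; rewrite mulr0 addr0. Qed.

Lemma altformZ k (r : R) a : altform k a -> altform k (r *: a).
Proof.
by move=> ha; rewrite -[_ *: _]addr0; apply/altform_lin/altform_zero.
Qed.

Lemma altformD k a b : altform k a -> altform k b -> altform k (a + b).
Proof. by move=> ha hb; rewrite -[a]scale1r; exact: altform_lin. Qed.

Lemma altform0P a : altform 0 a <-> a = a [::] *: @covec1 R m.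
Proof.
split=> [[a0 _ _]|->].
  apply/funext => -[|v s]; rewrite /covec1 !fctE; first by rewrite scaleRE mulr1.
  by rewrite a0 ?scaler0.
split=> [[|v s]|s t c u v|s t r u]; rewrite /covec1 !fctE ?scaler0 //.
- by case: s => [|x s]; rewrite /= !scaler0 mulr0 addr0.
- by case: s => [|x s]; rewrite scaler0.
Qed.

(** A recursive description by contractions in the first slot, which fits [wedge_cons] in inductions
    on the degree. *)
Lemma altformS k a : altform k.+1 a <->
  [/\ a [::] = 0, forall v, altform k (icov v a),
      forall r u v, icov (r *: u + v) a = r *: icov u a + icov v a
    & forall u, icov u (icov u a) = 0].
Proof.
split=> [[a0 al aa]|[a0 ia il ii]].
  split=> [|v|r u v|u]; first by rewrite a0.
  - split=> [s sk|s t x u w|s t p u]; rewrite /icov.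
    + by rewrite a0 //= => -[].
    + by rewrite -!cat_cons al.
    + by rewrite -!cat_cons aa.
  - by apply/funext => s; rewrite /icov (al [::]).
  - by apply/funext => s; rewrite /icov (aa [::] [::]).
(* Polarising the condition on repeated contractions gives antisymmetry in the first two slots,
   which moves a repeated argument inside a contraction. *)
have sw u v s : a [:: u, v & s] = - a [:: v, u & s].
  have hl x y t : icov (x + y) a t = icov x a t + icov y a t.
    by have := il 1 x y; rewrite !scale1r => ->.
  have hr w x y : icov w a (x + y :: s) = icov w a (x :: s) + icov w a (y :: s).
    by case: (ia w) => _ al _; have := al [::] s 1 x y; rewrite scale1r mul1r.
  have iis w : icov w a (w :: s) = 0 by have := congr1 (@^~ s) (ii w).
  have := iis (u + v); rewrite hl !hr !iis add0r addr0 => /eqP.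
  by rewrite addr_eq0 => /eqP.
split=> [[|v s] //= sk|[|w s] t r u v|[|w s] t r u].
- by case: (ia v) => av _ _; apply: (av s) => sk'; apply: sk; rewrite /= sk'.
- by have := congr1 (@^~ t) (il r u v); rewrite /= !fctE.
- by case: (ia w) => _ ail _; exact: (ail s).
- case: t => [|v t] /=; first by have := congr1 (@^~ r) (ii u).
  by rewrite sw; case: (ia v) => _ _ iaa; have := iaa [::] t r u; rewrite /icov /= => ->; rewrite oppr0.
- by case: (ia w) => _ _ iaa; apply: iaa.
Qed.

Lemma icov_altform k v a : altform k.+1 a -> altform k (icov v a).
Proof. by move/altformS => []. Qed.

Lemma sgcov_altform k a : altform k a -> sgcov a = (-1) ^+ k *: a.
Proof.
move=> [a0 _ _]; apply/funext => s; rewrite /sgcov !fctE.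
by have [->//|/eqP sk] := eqVneq (size s) k; rewrite a0 // scaler0 mulr0.
Qed.

Lemma icov_altform0 v a : altform 0 a -> icov v a = 0.
Proof. by move/altform0P ->; rewrite icovZ icov1 scaler0. Qed.

Lemma icov_lin k a r u v : altform k a ->
  icov (r *: u + v) a = r *: icov u a + icov v a.
Proof.
case: k => [|k]; first by move=> ha; rewrite !icov_altform0 // scaler0 addr0.
by move/altformS => [].
Qed.

Lemma icov0 k a : altform k a -> icov 0 a = 0.
Proof.
move=> ha; have := icov_lin 1 0 0 ha.
by rewrite scaler0 addr0 scale1r => /eqP; rewrite -subr_eq subrr => /eqP.
Qed.

Lemma icovZv k a r u : altform k a -> icov (r *: u) a = r *: icov u a.
Proof. by move=> ha; rewrite -[_ *: _]addr0 (icov_lin _ _ _ ha) (icov0 ha) addr0. Qed.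

Lemma icovDv k a u v : altform k a -> icov (u + v) a = icov u a + icov v a.
Proof. by move=> ha; rewrite -[u]scale1r (icov_lin _ _ _ ha) !scale1r. Qed.

Lemma icovNv k a u : altform k a -> icov (- u) a = - icov u a.
Proof. by move=> ha; rewrite -scaleN1r (icovZv _ _ ha) scaleN1r. Qed.

Lemma icov_sumv k a (I : Type) (r : seq I) (P : pred I) (F : I -> 'rV[R]_m) :
  altform k a -> icov (\sum_(i <- r | P i) F i) a = \sum_(i <- r | P i) icov (F i) a.
Proof.
move=> ha; apply: (big_morph (fun v => icov v a)) => [u v|]; last exact: icov0 ha.
exact: icovDv ha.
Qed.

Lemma icovv k a u : altform k a -> icov u (icov u a) = 0.
Proof.
case: k => [|k]; last by move/altformS => [].
by move=> ha; rewrite (icov_altform0 _ ha).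
Qed.

Lemma icovC k a u v : altform k a -> icov u (icov v a) = - icov v (icov u a).
Proof.
move=> ha; have := icovv (u + v) ha; rewrite (icovDv _ _ ha) !icovD.
case: k ha => [|k] ha; first by rewrite !(icov_altform0 _ ha) /icov oppr0.
rewrite !(icovDv _ _ (icov_altform _ ha)) !(icovv _ ha) add0r addr0.
by move/eqP; rewrite addr_eq0 => /eqP ->; rewrite opprK.
Qed.

Lemma altform_wedge i j a b :
  altform i a -> altform j b -> altform (i + j) (wedge a b).
Proof.
(* Induction on the total degree, since contracting a product lowers the degree of either factor. *)
move: {2}(i + j)%N (erefl (i + j)%N) => n; elim: n i j a b => [|n IHn] i j a b.
  move=> ij; have [-> ->] : i = 0%N /\ j = 0%N by lia.
  by move=> /altform0P -> hb; rewrite wedgeZl wedge1l; exact: altformZ.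
case: i => [_|i ij ha]; first by move=> /altform0P -> hb; rewrite wedgeZl wedge1l; exact: altformZ.
case: j ij => [_|j ij hb].
  by move=> /altform0P ->; rewrite linearZ /= wedge1r addn0; exact: altformZ.
have eps c k : altform k c -> altform k (sgcov c).
  by move=> hc; rewrite (sgcov_altform hc); exact: altformZ.
rewrite addSn; apply/altformS; split=> [|v|r u v|u].
- by rewrite wedge_nil; case: ha => ->; rewrite ?mul0r.
- rewrite icov_wedge; apply: altformD; first by apply: IHn (icov_altform _ ha) hb; lia.
  rewrite -addSnnS; apply: IHn (icov_altform _ hb); [lia|exact: eps].
- rewrite !icov_wedge (icov_lin _ _ _ ha) (icov_lin _ _ _ hb).
  by rewrite wedgeDl wedgeZl linearD linearZ /= scalerDr addrACA.
- rewrite icov_wedge icovD !icov_wedge (icovv _ ha) (icovv _ hb) wedge0l linear0.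
  by rewrite add0r addr0 icov_sgcov wedgeNl subrr.
Qed.

End AlternatingForms.

(** * Graded sl2-modules *)

Section GradedModule.
Variables (K : numFieldType) (V : lmodType K) (n : nat).

(** Pieces are predicates on one ambient space and degrees are integers, so that degree-lowering
    operators compose without case distinctions. The bound makes [Lam] nilpotent on homogeneous
    elements. *)
Record graded (A : int -> V -> Prop) : Prop := Graded {
  gr_lin : forall k c u v, A k u -> A k v -> A k (c *: u + v);
  gr_zero : forall k, A k 0;
  gr_bound : forall k a, A k a -> (k < 0) || (n.*2%:Z < k) -> a = 0 }.

Lemma gr_scale A k c u : graded A -> A k u -> A k (c *: u).
Proof. by move=> gA Au; rewrite -[_ *: _]addr0; apply: gr_lin => //; exact: gr_zero. Qed.

Lemma gr_add A k u v : graded A -> A k u -> A k v -> A k (u + v).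
Proof. by move=> gA Au Av; rewrite -[u]scale1r; exact: gr_lin. Qed.

Lemma gr_sub A k u v : graded A -> A k u -> A k v -> A k (u - v).
Proof. by move=> gA Au Av; rewrite addrC -scaleN1r; exact: gr_lin. Qed.

Lemma gr_sum A k (I : Type) (r : seq I) (P : pred I) (F : I -> V) : graded A ->
  (forall i, P i -> A k (F i)) -> A k (\sum_(i <- r | P i) F i).
Proof.
by move=> gA AF; apply: big_ind => //; [exact: gr_zero|move=> u v; exact: gr_add].
Qed.

(** Linearity within each degree only: [extd] is linear on smooth forms, not on arbitrary families
    of covectors. *)
Definition additive_on (A : int -> V -> Prop) (f : V -> V) :=
  forall k c u v, A k u -> A k v -> f (c *: u + v) = c *: f u + f v.

Lemma additive_on0 A f : graded A -> additive_on A f -> f 0 = 0.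
Proof.
move=> gA fl; have := fl 0 1 0 0 (gr_zero gA 0) (gr_zero gA 0).
by rewrite scaler0 addr0 scale1r => /eqP; rewrite -subr_eq subrr => /eqP.
Qed.

Lemma additive_onZ A f k c u : graded A -> additive_on A f -> A k u ->
  f (c *: u) = c *: f u.
Proof.
move=> gA fl Au; rewrite -[_ *: u]addr0 (fl _ _ _ _ Au (gr_zero gA k)).
by rewrite (additive_on0 gA fl) addr0.
Qed.

Lemma additive_onD A f k u v : additive_on A f -> A k u -> A k v ->
  f (u + v) = f u + f v.
Proof. by move=> fl Au Av; rewrite -[u]scale1r (fl _ _ _ _ Au Av) !scale1r. Qed.

Lemma additive_onB A f k u v : additive_on A f -> A k u -> A k v ->
  f (u - v) = f u - f v.
Proof. by move=> fl Au Av; rewrite addrC -scaleN1r (fl _ _ _ _ Av Au) scaleN1r addrC. Qed.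

Lemma additive_on_sum A f k (I : Type) (r : seq I) (F : I -> V) :
  graded A -> additive_on A f -> (forall i, A k (F i)) ->
  f (\sum_(i <- r) F i) = \sum_(i <- r) f (F i).
Proof.
move=> gA fl AF; elim: r => [|i r IHr]; first by rewrite !big_nil (additive_on0 gA fl).
by rewrite !big_cons (additive_onD fl (AF i) (gr_sum _ gA (fun i _ => AF i))) IHr.
Qed.

Variables (L Lam : {linear V -> V}).

(** The divided power L^z / z!, set to 0 for z < 0, so that the range of summation in [weyl] does
    not depend on the degree. *)
Definition Lpow (z : int) (u : V) : V :=
  if z is Posz p then (p`!%:R)^-1 *: iter p L u else 0.

(* On forms of degree [k], [weyl n k] is the symplectic star up to a sign. *)
Definition weyl (c k : int) (a : V) : V :=
  \sum_(j < n.+2) ((-1) ^+ j / j`!%:R) *: Lpow (c + j%:Z - k) (iter j Lam a).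

Lemma iter_lin (f : {linear V -> V}) p c u v :
  iter p f (c *: u + v) = c *: iter p f u + iter p f v.
Proof. by elim: p => //= p ->; rewrite linearP. Qed.

Lemma iter_linD (f : {linear V -> V}) p u v :
  iter p f (u + v) = iter p f u + iter p f v.
Proof. by rewrite -[u]scale1r iter_lin !scale1r. Qed.

Lemma iter_lin0 (f : {linear V -> V}) p : iter p f 0 = 0.
Proof. by elim: p => //= p ->; rewrite linear0. Qed.

Lemma iter_linZ (f : {linear V -> V}) p c u : iter p f (c *: u) = c *: iter p f u.
Proof. by rewrite -[_ *: u]addr0 iter_lin iter_lin0 addr0. Qed.

Lemma iter_linB (f : {linear V -> V}) p u v :
  iter p f (u - v) = iter p f u - iter p f v.
Proof. by rewrite addrC -scaleN1r iter_lin scaleN1r addrC. Qed.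

Lemma Lpow_lin z c u v : Lpow z (c *: u + v) = c *: Lpow z u + Lpow z v.
Proof.
case: z => p /=; last by rewrite scaler0 addr0.
by rewrite iter_lin scalerDr scalerA mulrC -scalerA.
Qed.

Lemma LpowZ z c u : Lpow z (c *: u) = c *: Lpow z u.
Proof.
by case: z => p /=; rewrite ?scaler0 // iter_linZ scalerA mulrC -scalerA.
Qed.

Lemma LpowB z u v : Lpow z (u - v) = Lpow z u - Lpow z v.
Proof. by rewrite addrC -scaleN1r Lpow_lin scaleN1r addrC. Qed.

Lemma Lpow0 z : Lpow z 0 = 0.
Proof. by rewrite -(scale0r 0) LpowZ !scale0r. Qed.

Lemma weyl_lin c k r u v : weyl c k (r *: u + v) = r *: weyl c k u + weyl c k v.
Proof.
rewrite /weyl scaler_sumr -big_split /=; apply: eq_bigr => j _.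
by rewrite iter_lin Lpow_lin scalerDr !scalerA mulrC.
Qed.

Lemma weylZ c k r u : weyl c k (r *: u) = r *: weyl c k u.
Proof.
rewrite /weyl scaler_sumr; apply: eq_bigr => j _.
by rewrite iter_linZ LpowZ !scalerA mulrC.
Qed.

Lemma weyl0 c k : weyl c k 0 = 0.
Proof. by rewrite -[in LHS](scale0r 0) weylZ scale0r. Qed.

Lemma weylD c k u v : weyl c k (u + v) = weyl c k u + weyl c k v.
Proof. by rewrite -[u]scale1r weyl_lin !scale1r. Qed.

Lemma weylB c k u v : weyl c k (u - v) = weyl c k u - weyl c k v.
Proof. by rewrite addrC -scaleN1r weyl_lin scaleN1r addrC. Qed.

(** The family [A] varies: it will be the exterior forms at a point, the basic forms, and the
    harmonic elements. *)
Record stable (A : int -> V -> Prop) : Prop := Stable {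
  st_graded :> graded A;
  st_L : forall k a, A k a -> A (k + 2) (L a);
  st_Lam : forall k a, A k a -> A (k - 2) (Lam a) }.

Section Stable.
Variables (A : int -> V -> Prop) (sA : stable A).
Let gA := st_graded sA.

Lemma st_iterL k p a : A k a -> A (k + p.*2%:Z) (iter p L a).
Proof.
elim: p => [|p IHp] Aa /=; first by rewrite addr0.
by have := st_L sA (IHp Aa); congr (A _ _); lia.
Qed.

Lemma st_iterLam k p a : A k a -> A (k - p.*2%:Z) (iter p Lam a).
Proof.
elim: p => [|p IHp] Aa /=; first by rewrite subr0.
by have := st_Lam sA (IHp Aa); congr (A _ _); lia.
Qed.

Lemma iterLam_bound k a : A k a -> iter n.+1 Lam a = 0.
Proof.
move=> Aa; have [/andP[k0 kn]|kb] := boolP ((0 <= k) && (k <= n.*2%:Z)).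
  by apply: (gr_bound gA (st_iterLam n.+1 Aa)); lia.
rewrite (gr_bound gA Aa _); first exact: iter_lin0.
by move: kb; rewrite negb_and -!ltNge.
Qed.

Lemma st_Lpow k z a : A k a -> A (k + z * 2) (Lpow z a).
Proof.
case: z => p Aa /=; last exact: gr_zero.
by apply: gr_scale => //; have := st_iterL p Aa; congr (A _ _); lia.
Qed.

Lemma st_weyl c k a : A k a -> A (2 * c - k) (weyl c k a).
Proof.
move=> Aa; apply: gr_sum => // j _; apply: gr_scale => //.
by have := st_Lpow (c + j%:Z - k) (st_iterLam j Aa); congr (A _ _); lia.
Qed.

(* For [k <= n] the powers of [L] in [weyl n k] are all at least [n - k]. *)
Lemma weyl_factor (k : nat) a : (k <= n)%N -> A k a ->
  exists2 b, A k b & weyl n k a = iter (n - k) L b.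
Proof.
move=> kn Aa.
exists (\sum_(j < n.+2) ((-1) ^+ j / j`!%:R) *:
          ((n - k + j)`!%:R^-1 *: iter j L (iter j Lam a))).
  apply: gr_sum => // j _; do 2 apply: gr_scale => //.
  by have := st_iterL j (st_iterLam j Aa); congr (A _ _); lia.
rewrite (big_morph (iter (n - k) L) (id1 := 0) (op1 := +%R)); last 2 first.
- by move=> u v; exact: iter_linD.
- exact: iter_lin0.
apply: eq_bigr => j _; rewrite !iter_linZ -iterD.
by have -> : n%:Z + j%:Z - k%:Z = (n - k + j)%N by lia.
Qed.

(** Under commutators with [L] and [Lam] the pair (e, i) spans the standard two-dimensional
    representation of sl2. The instances are [covec_intertwiner] at a point and [ddelta_intertwiner]
    for d and its codifferential. *)
Record intertwiner (e i : V -> V) : Prop := Intertwiner {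
  tw_e_lin : additive_on A e;
  tw_i_lin : additive_on A i;
  tw_e_deg : forall k a, A k a -> A (k + 1) (e a);
  tw_i_deg : forall k a, A k a -> A (k - 1) (i a);
  tw_L_e : forall k a, A k a -> e (L a) = L (e a);
  tw_L_i : forall k a, A k a -> i (L a) = L (i a) + e a;
  tw_Lam_e : forall k a, A k a -> Lam (e a) = e (Lam a) - i a;
  tw_Lam_i : forall k a, A k a -> Lam (i a) = i (Lam a) }.

Section Intertwiner.
Variables (e i : V -> V) (tw : intertwiner e i).

Lemma iterL_e p k a : A k a -> e (iter p L a) = iter p L (e a).
Proof.
by move=> Aa; elim: p => //= p IHp; rewrite (tw_L_e tw (st_iterL p Aa)) IHp.
Qed.

Lemma iterL_i p k a : A k a ->
  i (iter p L a) = iter p L (i a) + p%:R *: iter p.-1 L (e a).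
Proof.
move=> Aa; elim: p => [|p IHp] /=; first by rewrite scale0r addr0.
rewrite (tw_L_i tw (st_iterL p Aa)) (iterL_e _ Aa) IHp linearD linearZ /= -addrA.
congr (_ + _); case: p {IHp} => [|p] /=; first by rewrite scale0r add0r scale1r.
by rewrite -[in X in _ + X](scale1r (L _)) -scalerDl natr1.
Qed.

Lemma Lpow_i z k a : A k a -> i (Lpow z a) = Lpow z (i a) + Lpow (z - 1) (e a).
Proof.
move=> Aa; case: z => [p|p]; last first.
  have -> : Negz p - 1 = Negz p.+1 by lia.
  by rewrite /= addr0 (additive_on0 gA (tw_i_lin tw)).
rewrite /Lpow (additive_onZ _ gA (tw_i_lin tw) (st_iterL p Aa)) (iterL_i _ Aa) scalerDr.
congr (_ + _); case: p => [|p]; first by rewrite scale0r scaler0.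
have -> : Posz p.+1 - 1 = Posz p by lia.
rewrite /= scalerA factS natrM invfM mulrAC mulVf ?mul1r // pnatr_eq0.
Qed.

Lemma iterLam_e j k a : A k a ->
  iter j Lam (e a) = e (iter j Lam a) - j%:R *: i (iter j.-1 Lam a).
Proof.
move=> Aa; elim: j => [|j IHj] /=; first by rewrite scale0r subr0.
rewrite IHj linearB linearZ /= (tw_Lam_e tw (st_iterLam j Aa)) -addrA -opprD.
congr (_ - _); case: j {IHj} => [|j] /=; first by rewrite !scale0r addr0 scale1r.
by rewrite (tw_Lam_i tw (st_iterLam j Aa)) -[in X in X + _](scale1r (i _)) -scalerDl nat1r.
Qed.

(** Passing e through Lam^j costs - j i Lam^(j-1), and passing i through a divided power of L costs
    e with the power lowered by one. The e-terms agree one by one, the i-terms after shifting j. *)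
Lemma weyl_intertwine c k a : A k a -> weyl c (k + 1) (e a) = i (weyl c k a).
Proof.
move=> Aa; rewrite /weyl.
have Aj (j : nat) : A (2 * c - k) (Lpow (c + j%:Z - k) (iter j Lam a)).
  by have := st_Lpow (c + j%:Z - k) (st_iterLam j Aa); congr (A _ _); lia.
rewrite (additive_on_sum _ gA (tw_i_lin tw) (k := 2 * c - k)); last first.
  by move=> j; exact: gr_scale.
transitivity (\sum_(j < n.+2) (((-1) ^+ j / j`!%:R) *:
    Lpow (c + j%:Z - k - 1) (e (iter j Lam a)) +
    ((-1) ^+ j / j`!%:R) *: Lpow (c + j%:Z - k) (i (iter j Lam a)))); last first.
  apply: eq_bigr => j _; rewrite (additive_onZ _ gA (tw_i_lin tw) (Aj j)).
  by rewrite (Lpow_i _ (st_iterLam j Aa)) scalerDr addrC.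
transitivity (\sum_(j < n.+2) (((-1) ^+ j / j`!%:R) *:
    Lpow (c + j%:Z - k - 1) (e (iter j Lam a)) -
    ((-1) ^+ j / j`!%:R) *: Lpow (c + j%:Z - k - 1) (j%:R *: i (iter j.-1 Lam a)))).
  apply: eq_bigr => j _; rewrite (iterLam_e _ Aa).
  by rewrite opprD addrA LpowB scalerBr.
rewrite !big_split /=; congr (_ + _).
(* The shift loses the last term j = n+1, which vanishes because Lam^(n+1) = 0; this is why [weyl]
   sums up to n+1. *)
rewrite big_ord_recl [RHS]big_ord_recr /= scale0r Lpow0 scaler0 oppr0 add0r.
have -> : Lam (iter n Lam a) = 0 by exact: iterLam_bound Aa.
rewrite (additive_on0 gA (tw_i_lin tw)) Lpow0 scaler0 addr0.
apply: eq_bigr => j _; rewrite /bump /= add1n LpowZ scalerA -scaleNr.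
have -> : c + j.+1%:Z - k - 1 = c + j%:Z - k by lia.
congr (_ *: _); rewrite exprS mulN1r mulNr mulNr opprK factS natrM invfM.
by rewrite -mulrA [_^-1 * _]mulrC -[_ / _ * _]mulrA mulVf ?mulr1 // pnatr_eq0.
Qed.


(** Since e commutes with L, the power of L does not drop when e moves inwards, and the e-terms form
    the operator with parameter n+1 instead of n. For covectors that operator is zero by
    [weyl_succ_eq0]. *)
Lemma weyl_intertwineC k a : A k a ->
  e (weyl n k a) = weyl n.+1 (k + 1) (e a) - weyl n (k - 1) (i a).
Proof.
move=> Aa; rewrite /weyl.
have Aj (j : nat) : A (2 * n%:Z - k) (Lpow (n%:Z + j%:Z - k) (iter j Lam a)).
  by have := st_Lpow (n%:Z + j%:Z - k) (st_iterLam j Aa); congr (A _ _); lia.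
rewrite (additive_on_sum _ gA (tw_e_lin tw) (k := 2 * n%:Z - k)); last first.
  by move=> j; exact: gr_scale.
have eLp (j : nat) : e (Lpow (n%:Z + j%:Z - k) (iter j Lam a)) =
    Lpow (n%:Z + j%:Z - k) (e (iter j Lam a)).
  case: (n%:Z + j%:Z - k) => p /=; last exact: (additive_on0 gA (tw_e_lin tw)).
  have Ap := st_iterL p (st_iterLam j Aa).
  by rewrite (additive_onZ _ gA (tw_e_lin tw) Ap) (iterL_e _ (st_iterLam j Aa)).
have iLam j : i (iter j Lam a) = iter j Lam (i a).
  by elim: j => //= j IHj; rewrite -(tw_Lam_i tw (st_iterLam j Aa)) IHj.
transitivity (\sum_(j < n.+2) (((-1) ^+ j / j`!%:R) *:
    Lpow (n%:Z + j%:Z - k) (iter j Lam (e a)) +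
    ((-1) ^+ j / j`!%:R) *: Lpow (n%:Z + j%:Z - k) (j%:R *: iter j.-1 Lam (i a)))).
  apply: eq_bigr => j _; rewrite (additive_onZ _ gA (tw_e_lin tw) (Aj j)) eLp.
  rewrite (iterLam_e _ Aa) iLam -scalerDr; congr (_ *: _).
  by rewrite LpowB subrK.
rewrite big_split /=; congr (_ + _).
  apply: eq_bigr => j _; congr (_ *: Lpow _ _).
  by move: (nat_of_ord j) => {}j; lia.
rewrite big_ord_recl [X in _ = - X]big_ord_recr /= scale0r Lpow0 scaler0 add0r.
have -> : Lam (iter n Lam (i a)) = 0.
  rewrite -iterS -iLam (_ : iter n.+1 Lam a = 0) ?(additive_on0 gA (tw_i_lin tw)) //.
  exact: iterLam_bound Aa.
rewrite Lpow0 scaler0 addr0 -sumrN.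
apply: eq_bigr => j _; rewrite /bump /= add1n LpowZ scalerA -scaleNr.
have -> : n%:Z + j.+1%:Z - k = n%:Z + j%:Z - (k - 1) by lia.
congr (_ *: _); rewrite exprS mulN1r !mulNr factS natrM invfM.
by rewrite -mulrA [_^-1 * _]mulrC -[_ / _ * _]mulrA mulVf ?mulr1 // pnatr_eq0.
Qed.

End Intertwiner.
End Stable.
End GradedModule.

(** * The d delta-lemma for graded sl2-modules *)

Section DdeltaLemma.
Variables (K : numFieldType) (V : lmodType K) (n : nat).
Variables (L Lam : {linear V -> V}) (A : int -> V -> Prop) (d : V -> V).

Local Notation S := (weyl n L Lam n).

(** The last two fields are pointwise facts about the exterior algebra. They make [S] an invertible
    operator conjugating L to -Lam, which replaces the decomposition into irreducible
    sl2-modules. *)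
Record ddelta_module : Prop := DdeltaModule {
  dm_stable : stable n L Lam A;
  dm_comm : forall k a, A k a -> Lam (L a) = L (Lam a) + (n%:Z - k)%:~R *: a;
  dm_d_lin : additive_on A d;
  dm_d_deg : forall k a, A k a -> A (k + 1) (d a);
  dm_dd : forall k a, A k a -> d (d a) = 0;
  dm_dL : forall k a, A k a -> d (L a) = L (d a);
  dm_SS : exists2 r : int -> K, forall k, r k != 0 &
    forall k a, A k a -> S (2 * n%:Z - k) (S k a) = r k *: a;
  dm_SL : forall k a, A k a -> S (k + 2) (L a) = - Lam (S k a) }.

Hypothesis dm : ddelta_module.
Let sA := dm_stable dm.
Let gA := st_graded sA.

Definition codiff (a : V) : V := d (Lam a) - Lam (d a).

(** Iterated commutators of d with [Lam]; [adLam 1] is [codiff]. *)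
Fixpoint adLam (m : nat) (a : V) : V :=
  if m is m'.+1 then adLam m' (Lam a) - Lam (adLam m' a) else d a.

Arguments adLam : simpl never.

Lemma adLamS m a : adLam m.+1 a = adLam m (Lam a) - Lam (adLam m a).
Proof. by []. Qed.

Lemma LLam_deg k a : A k a -> A k (L (Lam a)).
Proof. by move=> Aa; have := st_L sA (st_Lam sA Aa); congr (A _ _); lia. Qed.

Lemma adLam_deg m k a : A k a -> A (k + 1 - m.*2%:Z) (adLam m a).
Proof.
elim: m k a => [|m IHm] k a Aa; first by rewrite subr0; exact: dm_d_deg.
rewrite adLamS.
apply: (gr_sub gA).
  by have := IHm _ _ (st_Lam sA Aa); congr (A _ _); lia.
by have := st_Lam sA (IHm _ _ Aa); congr (A _ _); lia.
Qed.

Lemma adLam_lin m : additive_on A (adLam m).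
Proof.
elim: m => [|m IHm] k c u v Au Av; first exact: dm_d_lin Au Av.
rewrite !adLamS linearP (IHm _ _ _ _ (st_Lam sA Au) (st_Lam sA Av)) (IHm _ _ _ _ Au Av).
by rewrite linearP scalerBr opprD addrACA.
Qed.

(** The sl2 formula e f^(m+1) v = (m+1) (w - m) f^m v in the module of operators, for v = d, which
    commutes with L and has weight w = 1. *)
Lemma adLam_L m k a : A k a ->
  adLam m.+1 (L a) = L (adLam m.+1 a) +
                     ((m.+1)%:R * (1 - m%:R)) *: adLam m a.
Proof.
elim: m k a => [|m IHm] k a Aa.
  rewrite !adLamS /adLam (dm_comm dm Aa) (dm_dL dm Aa) (dm_comm dm (dm_d_deg dm Aa)).
  rewrite (additive_onD (dm_d_lin dm) (LLam_deg Aa) (gr_scale _ gA Aa)).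
  rewrite (additive_onZ _ gA (dm_d_lin dm) Aa) (dm_dL dm (st_Lam sA Aa)) linearB /=.
  rewrite subr0 mulr1 scale1r opprD addrACA; congr (_ + _); rewrite -scalerBl -[RHS]scale1r.
  by congr (_ *: _); rewrite -intrB (_ : _ - _ = 1) //; lia.
rewrite (adLamS m.+1 (L a)) (adLamS m.+1 a).
have Am := adLam_deg m.+1 Aa.
rewrite (dm_comm dm Aa) (IHm _ _ Aa) linearD linearZ /= (dm_comm dm Am).
rewrite (additive_onD (adLam_lin m.+1) (LLam_deg Aa) (gr_scale _ gA Aa)).
rewrite (additive_onZ _ gA (adLam_lin m.+1) Aa) (IHm _ _ (st_Lam sA Aa)).
set x := adLam m.+1 (Lam a); set y := adLam m.+1 a; set z := adLam m (Lam a).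
set c := _ * (1 - m%:R).
have -> : z = y + Lam (adLam m a) by rewrite /y adLamS subrK.
set w := Lam (adLam m a).
clearbody x y w.
have aux (X Y : V) (s t : K) : (X + c *: (y + w) + s *: y) -
    (Y + t *: y + c *: w) = X - Y + (c + s - t) *: y.
  rewrite scalerDr !scalerDl scaleNr !opprD.
  by rewrite !addrA [LHS](ACl (1*5*2*4*6*(3*7)))%AC /= subrr addr0.
rewrite aux linearB; congr (_ + _ *: _).
rewrite /c -addrA -intrB.
have -> : n%:Z - k - (n%:Z - (k + 1 - m.+1.*2%:Z)) = 1 - 2 * m.+1%:Z by lia.
by rewrite intrB intrM -!pmulrn -!natr1; ring.
Qed.

(** Downward induction on m. For large m no degree is left; below, the coefficient (m+3) (1 - (m+2))
    of [adLam_L] is non-zero and can be divided out. *)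
Lemma adLam_eq0 m k a : A k a -> adLam m.+2 a = 0.
Proof.
have [p] : exists p, (n.+2 <= m + p)%N by exists n.+2; lia.
elim: p m k a => [|p IHp] m k a mp Aa.
  have [/andP[k0 kn]|kb] := boolP ((0 <= k) && (k <= n.*2%:Z)).
    by apply: (gr_bound gA (adLam_deg m.+2 Aa)); lia.
  rewrite (gr_bound gA Aa _); first exact: additive_on0 gA (adLam_lin _).
  by move: kb; rewrite negb_and -!ltNge.
have := adLam_L m.+2 Aa.
rewrite (IHp m.+1 _ _ _ (st_L sA Aa)) ?(IHp m.+1 _ _ _ Aa); [|lia..].
rewrite linear0 add0r => /esym/eqP; rewrite scaler_eq0 => /orP[|/eqP//].
rewrite mulf_eq0 pnatr_eq0 /= subr_eq0 eq_sym.
by rewrite -[X in _ == X]/(1%:R) eqr_nat.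
Qed.

Lemma codiff_lin : additive_on A codiff.
Proof. exact: (adLam_lin 1). Qed.

Lemma codiff_deg k a : A k a -> A (k - 1) (codiff a).
Proof. by move=> /(adLam_deg 1); congr (A _ _); lia. Qed.

Lemma ddelta_intertwiner : intertwiner L Lam A d codiff.
Proof.
split; [exact: dm_d_lin|exact: codiff_lin|exact: dm_d_deg|exact: codiff_deg|exact: dm_dL|..].
- by move=> k a Aa; have := adLam_L 0 Aa; rewrite subr0 mulr1 scale1r.
- by move=> k a Aa; rewrite /codiff opprB addrCA subrr addr0.
- move=> k a Aa; apply/esym/eqP; rewrite -subr_eq0.
  by have := adLam_eq0 0 Aa; rewrite adLamS => /eqP.
Qed.
Let tw := ddelta_intertwiner.

Lemma weyl_d k a : A k a -> S (k + 1) (d a) = codiff (S k a).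
Proof. exact: (weyl_intertwine sA tw). Qed.

Lemma weyl_deg k a : A k a -> A (2 * n%:Z - k) (S k a).
Proof. exact: st_weyl. Qed.

Lemma codiff_d k a : A k a -> codiff (d a) = - d (codiff a).
Proof.
move=> Aa; rewrite /codiff (dm_dd dm Aa) linear0 subr0.
rewrite (additive_onB (dm_d_lin dm) (k := k - 1)); last 2 first.
- by have := dm_d_deg dm (st_Lam sA Aa); congr (A _ _); lia.
- by have := st_Lam sA (dm_d_deg dm Aa); congr (A _ _); lia.
by rewrite (dm_dd dm (st_Lam sA Aa)) sub0r opprK.
Qed.

Lemma weyl_inv k a : A k a ->
  exists2 r, r != 0 & S (2 * n%:Z - k) (S k a) = r *: a.
Proof. by case: (dm_SS dm) => r r0 rP Aa; exists (r k) => //; exact: rP. Qed.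

Lemma weyl_inj k a : A k a -> S k a = 0 -> a = 0.
Proof.
move=> Aa Sa; have [r r0] := weyl_inv Aa; rewrite Sa weyl0 => /esym/eqP.
by rewrite scaler_eq0 (negPf r0) => /eqP.
Qed.

Lemma weyl_surj l b : A l b ->
  exists2 b', A (2 * n%:Z - l) b' & b = S (2 * n%:Z - l) b'.
Proof.
move=> Ab; have [r r0 rP] := weyl_inv Ab.
exists (r^-1 *: S l b); first by apply: (gr_scale _ gA); exact: weyl_deg.
by rewrite weylZ rP scalerA mulVf // scale1r.
Qed.

Lemma codiff_codiff k a : A k a -> codiff (codiff a) = 0.
Proof.
move=> Aa; have [b Ab ->] := weyl_surj Aa.
rewrite -(weyl_d Ab) -(weyl_d (dm_d_deg dm Ab)) (dm_dd dm Ab).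
exact: weyl0.
Qed.

Definition harmonic k a := [/\ A k a, d a = 0 & codiff a = 0].

(** The commutators [codiff, L] = d and [d, Lam] = codiff vanish on harmonic elements. *)
Lemma harmonic_stable : stable n L Lam harmonic.
Proof.
split=> [|k a [Aa da ca]|k a [Aa da ca]].
- split=> [k c u v [Au du cu] [Av dv cv]|k|k a [Aa _ _]].
  + split; first exact: (gr_lin gA).
      by rewrite (dm_d_lin dm _ Au Av) du dv scaler0 addr0.
    by rewrite (codiff_lin _ Au Av) cu cv scaler0 addr0.
  + split; first exact: (gr_zero gA).
      exact: (additive_on0 gA (dm_d_lin dm)).
    exact: (additive_on0 gA codiff_lin).
  + exact: (gr_bound gA Aa).
- split; [exact: (st_L sA)|by rewrite (dm_dL dm Aa) da linear0|].
  by rewrite (tw_L_i tw Aa) ca da linear0 addr0.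
- split; [exact: (st_Lam sA)| |by rewrite -(tw_Lam_i tw Aa) ca linear0].
  by move: ca; rewrite /codiff da linear0 subr0.
Qed.

(* The two halves of the hard Lefschetz isomorphism at the level of forms:
   both are read off the formula for [S], using that [S] is invertible. *)
Lemma iterL_surj (B : int -> V -> Prop) (k : nat) c : stable n L Lam B ->
  (forall l a, B l a -> A l a) ->
  (k <= n)%N -> B (n.*2%:Z - k%:Z) c -> exists2 b, B k b & c = iter (n - k) L b.
Proof.
move=> sB BA kn Bc; have [r r0] := weyl_inv (BA _ _ Bc).
have -> : 2 * n%:Z - (n.*2%:Z - k%:Z) = k by lia.
move=> rP; have : B k (S (n.*2%:Z - k%:Z) c).
  by have := st_weyl sB n Bc; congr (B _ _); lia.
move=> /(weyl_factor sB kn)[b Bb eb].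
exists (r^-1 *: b); first by apply: (gr_scale _ (st_graded sB)).
by rewrite iter_linZ -eb rP scalerA mulVf ?scale1r.
Qed.

Lemma weyl_iterL p k a : A k a ->
  S (k + p.*2%:Z) (iter p L a) = (-1) ^+ p *: iter p Lam (S k a).
Proof.
move=> Aa; elim: p => [|p IHp]; first by rewrite /= addr0 expr0 scale1r.
have -> : k + p.+1.*2%:Z = k + p.*2%:Z + 2 by lia.
by rewrite (dm_SL dm (st_iterL sA p Aa)) IHp linearZ exprS mulN1r scaleNr.
Qed.

Lemma iterL_inj (k : nat) a : (k <= n)%N -> A k a -> iter (n - k) L a = 0 -> a = 0.
Proof.
move=> kn Aa La; have := weyl_iterL (n - k) Aa.
rewrite La weyl0 => /esym/eqP; rewrite scaler_eq0 signr_eq0 /= => /eqP Sa0.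
have [r r0] := weyl_inv Aa.
(* In S (S a) the terms with j < n-k carry a negative power of L; the others contain Lam^(n-k),
   which kills S a because L^(n-k) kills a. *)
rewrite {1}/weyl big1 => [/esym/eqP|j _].
  by rewrite scaler_eq0 (negPf r0) => /eqP.
have [jk|jk] := ltnP j (n - k).
  have -> : n%:Z + j%:Z - (2 * n%:Z - k%:Z) = Negz (n - k - j).-1 by lia.
  by rewrite /= scaler0.
by rewrite -(subnK jk) iterD Sa0 iter_lin0 Lpow0 scaler0.
Qed.

Definition exact k a := exists2 b, A (k - 1) b & d b = a.
Definition coexact k a := exists2 b, A (k + 1) b & codiff b = a.
Definition dcodiff k a := exists2 b, A k b & d (codiff b) = a.

Definition exact_ddelta k :=
  forall a, A k a -> exact k a -> codiff a = 0 -> dcodiff k a.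
Definition coexact_ddelta k :=
  forall a, A k a -> coexact k a -> d a = 0 -> dcodiff k a.

(** The Lefschetz conditions in terms of representatives: the first clause is injectivity on
    cohomology, the second surjectivity. *)
Definition lefschetz_upto (s : nat) := forall k : nat, (k <= s)%N ->
  (forall a, A k a -> d a = 0 ->
     exact (n.*2%:Z - k%:Z) (iter (n - k) L a) -> exact k a) /\
  (forall c, A (n.*2%:Z - k%:Z) c -> d c = 0 ->
     exists2 a, A k a /\ d a = 0 & exact (n.*2%:Z - k%:Z) (c - iter (n - k) L a)).

Definition ddelta_upto (s : nat) :=
  (forall k : nat, (k <= s)%N -> exact_ddelta k /\ coexact_ddelta k) /\
  exact_ddelta s.+1.

Definition dual_ddelta_upto (s : nat) :=
  (forall k : nat, (n.*2 - s <= k)%N -> exact_ddelta k /\ coexact_ddelta k) /\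
  coexact_ddelta (n.*2 - s - 1)%N.

Lemma exact_lin k c u v : exact k u -> exact k v -> exact k (c *: u + v).
Proof.
move=> [x Ax <-] [y Ay <-]; exists (c *: x + y); first exact: (gr_lin gA).
exact: (dm_d_lin dm _ Ax Ay).
Qed.

Lemma dcodiff_lin k c u v : dcodiff k u -> dcodiff k v -> dcodiff k (c *: u + v).
Proof.
move=> [x Ax <-] [y Ay <-]; exists (c *: x + y); first exact: (gr_lin gA).
by rewrite (codiff_lin _ Ax Ay) (dm_d_lin dm _ (codiff_deg Ax) (codiff_deg Ay)).
Qed.

Lemma dcodiff0 k : dcodiff k 0.
Proof.
exists 0; first exact: (gr_zero gA).
by rewrite (additive_on0 gA codiff_lin) (additive_on0 gA (dm_d_lin dm)).
Qed.

Lemma dcodiff_bound k a : A k a -> (k < 0) || (n.*2%:Z < k) -> dcodiff k a.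
Proof. by move=> Aa kb; rewrite (gr_bound gA Aa kb); exact: dcodiff0. Qed.

Lemma dcodiffZ k c u : dcodiff k u -> dcodiff k (c *: u).
Proof. by move=> hu; rewrite -[_ *: u]addr0; apply: dcodiff_lin => //; exact: dcodiff0. Qed.

Lemma exact0 k : exact k 0.
Proof. by exists 0; [exact: (gr_zero gA)|exact: (additive_on0 gA (dm_d_lin dm))]. Qed.

Lemma exactZ k c u : exact k u -> exact k (c *: u).
Proof. by move=> hu; rewrite -[_ *: u]addr0; apply: exact_lin => //; exact: exact0. Qed.

Lemma exactD k u v : exact k u -> exact k v -> exact k (u + v).
Proof. by move=> hu; rewrite -[u]scale1r; exact: exact_lin. Qed.

Lemma exactB k u v : exact k u -> exact k v -> exact k (u - v).
Proof. by move=> hu hv; apply: exactD hu _; rewrite -scaleN1r; exact: exactZ. Qed.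

Lemma d_iterL p k a : A k a -> d (iter p L a) = iter p L (d a).
Proof. exact: (iterL_e sA tw). Qed.

Lemma exact_iterL p k l a : l = k + p.*2%:Z -> exact k a -> exact l (iter p L a).
Proof.
move=> -> [b Ab <-]; exists (iter p L b); last exact: d_iterL Ab.
by have := st_iterL sA p Ab; congr (A _ _); lia.
Qed.

(** The commutator of codiff with L is d, which is killed by the outer d. *)
Lemma d_codiff_iterL p k b : A k b ->
  d (codiff (iter p L b)) = iter p L (d (codiff b)).
Proof.
move=> Ab; elim: p => //= p IHp; have Ap := st_iterL sA p Ab.
rewrite (tw_L_i tw Ap) -IHp (d_iterL _ Ab) (additive_onD (dm_d_lin dm) (k := k + p.*2%:Z + 1)).
- rewrite (dm_dL dm (codiff_deg Ap)) -(d_iterL _ Ab) (dm_dd dm Ap).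
  by rewrite addr0.
- by have := st_L sA (codiff_deg Ap); congr (A _ _); lia.
- by rewrite -(d_iterL _ Ab); exact: dm_d_deg.
Qed.

Lemma dcodiff_iterL p k l a : l = k + p.*2%:Z -> dcodiff k a -> dcodiff l (iter p L a).
Proof.
move=> -> [b Ab <-]; exists (iter p L b); first exact: (st_iterL sA).
exact: d_codiff_iterL Ab.
Qed.

Lemma exact_A k a : exact k a -> A k a.
Proof. by move=> [b Ab <-]; have := dm_d_deg dm Ab; congr (A _ _); lia. Qed.

Lemma exact_closed k a : exact k a -> d a = 0.
Proof. by move=> [b Ab <-]; exact: (dm_dd dm Ab). Qed.

Lemma dcodiff_exact k a : dcodiff k a -> exact k a /\ codiff a = 0.
Proof.
move=> [b Ab <-]; have Ab' := codiff_deg Ab; split; first by exists (codiff b).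
by rewrite (codiff_d Ab') (codiff_codiff Ab) (additive_on0 gA (dm_d_lin dm)) oppr0.
Qed.

Lemma dcodiff_coexact k a : dcodiff k a -> coexact k a /\ d a = 0.
Proof.
move=> [b Ab <-]; split; last exact: (dm_dd dm (codiff_deg Ab)).
exists (- d b); first by rewrite -scaleN1r; apply: (gr_scale _ gA); exact: dm_d_deg.
rewrite -scaleN1r (additive_onZ _ gA codiff_lin (dm_d_deg dm Ab)) (codiff_d Ab).
by rewrite scaleN1r opprK.
Qed.

(** For b = S b' one has codiff b = S d b', so a second S returns d b' up to the scalar of S^2. This
    is the converse direction of the exchange of d and codiff. *)
Lemma weyl_codiff k b : A k b -> exists2 r, r != 0 & exists2 b',
  A (2 * n%:Z - k) b' & b = S (2 * n%:Z - k) b' /\ S (k - 1) (codiff b) = r *: d b'.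
Proof.
move=> Ab; have [b' Ab' eb] := weyl_surj Ab.
have [r r0 rP] := weyl_inv (dm_d_deg dm Ab'); exists r => //; exists b' => //; split=> //.
rewrite {1}eb -(weyl_d Ab') -rP; congr (S _ _); lia.
Qed.

Lemma codiff_ker_weyl k a : A k a -> codiff a = 0 -> d (S k a) = 0.
Proof.
move=> Aa ca; apply: (weyl_inj (dm_d_deg dm (weyl_deg Aa))).
have [r r0 rP] := weyl_inv Aa.
rewrite (weyl_d (weyl_deg Aa)) rP (additive_onZ _ gA codiff_lin Aa) ca.
exact: scaler0.
Qed.

Lemma d_ker_weyl k a : A k a -> d a = 0 -> codiff (S k a) = 0.
Proof. by move=> Aa da; rewrite -(weyl_d Aa) da weyl0. Qed.

Lemma exact_weyl k a : exact k a -> coexact (2 * n%:Z - k) (S k a).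
Proof.
move=> [b Ab <-]; exists (S (k - 1) b).
  by have := weyl_deg Ab; congr (A _ _); lia.
by rewrite -(weyl_d Ab); congr (S _ _); lia.
Qed.

Lemma coexact_weyl k a : coexact k a -> exact (2 * n%:Z - k) (S k a).
Proof.
move=> [b Ab <-]; have [r r0 [b' Ab' [eb]]] := weyl_codiff Ab.
have -> : k + 1 - 1 = k by lia.
move=> ->; apply: exactZ; exists b' => //.
by move: Ab'; congr (A _ _); lia.
Qed.

Lemma dcodiff_weyl k a : dcodiff k a -> dcodiff (2 * n%:Z - k) (S k a).
Proof.
move=> [b Ab <-]; have [r r0 [b' Ab' [eb e]]] := weyl_codiff Ab.
have -> : S k (d (codiff b)) = codiff (S (k - 1) (codiff b)).
  by rewrite -(weyl_d (codiff_deg Ab)); congr (S _ _); lia.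
rewrite e (additive_onZ _ gA codiff_lin (dm_d_deg dm Ab')) (codiff_d Ab').
rewrite scalerN -scaleNr; apply: dcodiffZ.
by exists b'.
Qed.

Lemma dcodiff_weylK k a : A k a -> dcodiff (2 * n%:Z - k) (S k a) -> dcodiff k a.
Proof.
move=> Aa /dcodiff_weyl; have [r r0 ->] := weyl_inv Aa.
have -> : 2 * n%:Z - (2 * n%:Z - k) = k by lia.
by move=> /(dcodiffZ r^-1); rewrite scalerA mulVf // scale1r.
Qed.

Lemma exact_ddelta_dual k l : l = n.*2%:Z - k -> exact_ddelta k <-> coexact_ddelta l.
Proof.
have -> : n.*2%:Z - k = 2 * n%:Z - k by lia.
move=> ->; split=> h a Aa ea ca; apply: (dcodiff_weylK Aa).
  have -> : 2 * n%:Z - (2 * n%:Z - k) = k by lia.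
  apply: h.
  - by have := weyl_deg Aa; congr (A _ _); lia.
  - by have := coexact_weyl ea; congr (exact _ _); lia.
  - exact: d_ker_weyl.
by apply: h; [exact: weyl_deg|exact: exact_weyl|exact: codiff_ker_weyl].
Qed.

Lemma ddelta_dual (s : nat) : (s < n)%N -> ddelta_upto s <-> dual_ddelta_upto s.
Proof.
move=> sn; split=> -[h h'].
  split=> [k sk|]; last by apply/(exact_ddelta_dual (k := s.+1)); [lia|].
  have [kn|kn] := leqP k n.*2; last first.
    by split=> a Aa _ _; apply: dcodiff_bound => //; lia.
  have [h1 h2] : exact_ddelta (n.*2 - k)%N /\ coexact_ddelta (n.*2 - k)%N by apply: h; lia.
  split; [apply/(exact_ddelta_dual (l := (n.*2 - k)%N))|apply/(exact_ddelta_dual (k := (n.*2 - k)%N))] => //; lia.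
split=> [k ks|]; last by apply/(exact_ddelta_dual (l := (n.*2 - s - 1)%N)); [lia|].
have [h1 h2] : exact_ddelta (n.*2 - k)%N /\ coexact_ddelta (n.*2 - k)%N by apply: h; lia.
split; [apply/(exact_ddelta_dual (l := (n.*2 - k)%N))|apply/(exact_ddelta_dual (k := (n.*2 - k)%N))] => //; lia.
Qed.

(** The element L^(n-k+1) a has degree 2n - (k-2), so [iterL_surj] writes it as L^(n-k+2) b with b
    of degree k-2. Keeping [B] general makes b harmonic when a is. *)
Lemma primitive_part (B : int -> V -> Prop) (k : nat) a : stable n L Lam B ->
  (forall l b, B l b -> A l b) -> (k <= n)%N -> B k a ->
  exists2 b, B (k%:Z - 2) b & iter (n - k).+1 L (a - L b) = 0.
Proof.
move=> sB BA kn Ba; have BL : B (k + (n - k).+1.*2)%N (iter (n - k).+1 L a).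
  by have := st_iterL sB (n - k).+1 Ba; congr (B _ _); lia.
have [k2|k2] := leqP 2 k.
  have := iterL_surj (k := k - 2) sB BA _ (c := iter (n - k).+1 L a).
  case=> [||b Bb eb]; [lia|by move: BL; congr (B _ _); lia|].
  exists b; first by move: Bb; congr (B _ _); lia.
  by rewrite iter_linB eb -iterSr (_ : n - (k - 2) = (n - k).+2)%N ?subrr //; lia.
(* For k < 2 the element L^(n-k+1) a has degree above 2n and is already 0. *)
exists 0; first exact: (gr_zero (st_graded sB)).
by rewrite linear0 subr0; apply: (gr_bound gA (BA _ _ BL)); lia.
Qed.

(** * From the Lefschetz property to the d delta-lemma *)

Section LefschetzToDdelta.
Variable s : nat.
Hypotheses (sn : (s < n)%N) (lef : lefschetz_upto s).

Lemma primitive_exact (k : nat) a : (k <= s.+1)%N -> A k a ->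
  iter (n - k).+1 L a = 0 -> exact k a -> dcodiff k a.
Proof.
case: k => [|k] ks Aa La [b Ab eb].
  suff -> : a = 0 by exact: dcodiff0.
  rewrite -eb (_ : b = 0) ?(additive_on0 gA (dm_d_lin dm)) //.
  by apply: (gr_bound gA Ab); lia.
have kE : k.+1%:Z - 1 = k by lia.
have rE : (n - k.+1).+1 = (n - k)%N by lia.
rewrite kE in Ab; rewrite rE in La.
(* Here a = d b has degree k+1. As a is primitive, L^(n-k) b is closed, and surjectivity in degree k
   writes it as L^(n-k) g + d h with g closed. *)
have [|||g [Ag dg] [h Ah eh]] := (lef (k := k) _).2 (iter (n - k) L b); first by lia.
- by have := st_iterL sA (n - k) Ab; congr (A _ _); lia.
- by rewrite (d_iterL _ Ab) eb.
(* The potential h has degree 2n-k-1, hence is L^(n-k-1) x. Splitting x = x0 + L y with x0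
   primitive, the part y only contributes the exact form d y. *)
have [|||x Ax ex] := iterL_surj (B := A) (k := k.+1) (c := h) sA _ _ _ => //; first by lia.
  by move: Ah; congr (A _ _); lia.
have [|||y Ay ey] := primitive_part (B := A) (k := k.+1) (a := x) sA _ _ _ => //; first by lia.
rewrite rE in ey; set x0 := x - L y in ey.
have ALy : A k.+1 (L y) by have := st_L sA Ay; congr (A _ _); lia.
have Ax0 : A k.+1 x0 by exact: (gr_sub gA).
have xE : x = x0 + L y by rewrite /x0 subrK.
have r0 : (n - k)%:R != 0 :> K by rewrite pnatr_eq0; lia.
(* Applying codiff to L^(n-k) x0 = 0 gives (n-k) L^(n-k-1) d x0 = - L^(n-k) codiff x0, the origin of
   the constant. The equality is checked after applying the injective operator L^(n-k). *)
have key : b - g = - (n - k)%:R^-1 *: codiff x0 + d y.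
  have Ak1 u : A (k.+1%:Z - 1) u -> A k u by rewrite kE.
  have Acx := Ak1 _ (codiff_deg Ax0).
  have Ady : A k (d y) by have := dm_d_deg dm Ay; congr (A _ _); lia.
  apply/eqP; rewrite -subr_eq0; apply/eqP; apply: (iterL_inj (k := k)); first by lia.
    by apply: (gr_sub gA); [exact: (gr_sub gA)|exact: (gr_lin gA)].
  rewrite iter_linB (iter_linB _ _ b) -eh ex iter_lin [x in LHS]xE iter_linD.
  have -> : iter (n - k.+1) L (L y) = iter (n - k) L y by rewrite -rE -iterSr.
  rewrite (additive_onD (dm_d_lin dm) (k := (n.*2 - k.+1)%N)); last 2 first.
  - by have := st_iterL sA (n - k.+1) Ax0; congr (A _ _); lia.
  - by have := st_iterL sA (n - k) Ay; congr (A _ _); lia.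
  rewrite (d_iterL _ Ay) (d_iterL _ Ax0) opprD addrACA subrr addr0.
  have := iterL_i sA tw (n - k) Ax0; rewrite ey (additive_on0 gA codiff_lin).
  rewrite -rE /= => /eqP; rewrite eq_sym addr_eq0 => /eqP ->.
  by rewrite rE scaleNr scalerN !opprK scalerA mulVf // scale1r subrr.
have -> : a = d (b - g) by rewrite (additive_onB (dm_d_lin dm) Ab Ag) dg subr0.
have Acx := codiff_deg Ax0.
rewrite key (dm_d_lin dm (k := k)); last 2 first.
- by move: Acx; rewrite kE.
- by have := dm_d_deg dm Ay; congr (A _ _); lia.
by rewrite (dm_dd dm Ay) addr0; apply: dcodiffZ; exists x0.
Qed.

Lemma harmonic_exact (k : nat) a : (k <= s.+1)%N -> harmonic k a -> exact k a ->
  dcodiff k a.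
Proof.
elim/ltn_ind: k a => k IHk a ks ha ea; have [Aa da ca] := ha.
have BA l b : harmonic l b -> A l b by case.
have [|b hb eb] := primitive_part harmonic_stable BA _ ha; first by lia.
have [Ab db cb] := hb.
have ALb : A k (L b) by have := st_L sA Ab; congr (A _ _); lia.
suff Lb : dcodiff k (L b).
  have -> : a = 1 *: (a - L b) + L b by rewrite scale1r subrK.
  apply: dcodiff_lin => //; apply: primitive_exact => //; first exact: (gr_sub gA).
  by apply: exactB => //; case: (dcodiff_exact Lb).
have [k2|k2] := leqP 2 k; last first.
  rewrite (_ : b = 0) ?linear0; first exact: dcodiff0.
  by apply: (gr_bound gA Ab); lia.
have kE : k%:Z - 2 = (k - 2)%N by lia.
apply: (dcodiff_iterL (p := 1) (k := (k - 2)%N)); first by lia.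
apply: IHk; [lia|lia|by rewrite -kE|].
(* Since a - L b is primitive, L^(n-k+2) b equals L^(n-k+1) a, which is exact because a is. *)
have /lef[inj _] : (k - 2 <= s)%N by lia.
apply: inj; [by rewrite -kE|by []|].
have -> : iter (n - (k - 2)) L b = iter (n - k).+1 L a.
  apply/esym/eqP; rewrite (_ : n - (k - 2) = (n - k).+2)%N; last by lia.
  by move: eb; rewrite iter_linB -iterSr => /eqP; rewrite subr_eq0.
by apply: exact_iterL ea; lia.
Qed.

(** Such an a is harmonic and S a is exact. Since S a = L^(n-k) b with b harmonic, injectivity in
    degree k makes b exact, so [harmonic_exact] applies to b; the result returns to a through
    L^(n-k) and S. *)
Lemma coexact_closed_ddelta (k : nat) : (k <= s)%N -> coexact_ddelta k.
Proof.
move=> ks a Aa cea da; have ca : codiff a = 0.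
  by case: cea => b Ab <-; exact: codiff_codiff Ab.
have ha : harmonic k a by [].
have [|b hb eb] := weyl_factor harmonic_stable _ ha; first by lia.
have [Ab db cb] := hb.
apply: (dcodiff_weylK Aa); rewrite eb.
apply: (dcodiff_iterL (k := k)); first by lia.
apply: harmonic_exact => //; first by lia.
have [inj _] := lef ks; apply: inj => //; rewrite -eb.
by have := coexact_weyl cea; congr (exact _ _); lia.
Qed.

Lemma lefschetz_ddelta : ddelta_upto s.
Proof.
have e (k : nat) : (k <= s.+1)%N -> exact_ddelta k.
  move=> ks a Aa ea ca; apply: harmonic_exact => //.
  by split=> //; exact: exact_closed ea.
split=> [k ks|]; last exact: e.
by split; [apply: e; lia|exact: coexact_closed_ddelta].
Qed.
End LefschetzToDdelta.

Lemma ddelta_lefschetz (s : nat) : (s < n)%N -> ddelta_upto s -> lefschetz_upto s.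
Proof.
move=> sn [dd dds] k ks; have kE : n.*2%:Z - k%:Z = 2 * n%:Z - k%:Z by lia.
have ed (l : nat) : (l <= s.+1)%N -> exact_ddelta l.
  by rewrite leq_eqVlt => /orP[/eqP -> //|ls]; apply: (dd l _).1; lia.
have BA l b : harmonic l b -> A l b by case.
split=> [a Aa da ea|c Ac dc].
  (* The element codiff a is closed and coexact of degree k-1, hence d codiff e for some e. As
     codiff d = - d codiff, the sum a + d e is harmonic, and it is cohomologous to a. *)
  have [e Ae [_ _ ch]] : exists2 e, A (k%:Z - 1) e & harmonic k (a + d e).
    have Aca := codiff_deg Aa.
    have dca : d (codiff a) = 0.
      by apply: oppr_inj; rewrite oppr0 -(codiff_d Aa) da (additive_on0 gA codiff_lin).
    have [e Ae ee] : dcodiff (k%:Z - 1) (codiff a).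
      case: k ks Aa Aca {kE ea} => [|k] ks Aa Aca.
        by apply: dcodiff_bound => //; lia.
      have kE : k.+1%:Z - 1 = k by lia.
      rewrite kE in Aca *; apply: (dd k _).2 => //; first by lia.
      by exists a => //; move: Aa; congr (A _ _); lia.
    have Ade : A k (d e) by have := dm_d_deg dm Ae; congr (A _ _); lia.
    exists e => //; split; first exact: (gr_add gA).
      by rewrite (additive_onD (dm_d_lin dm) Aa Ade) da (dm_dd dm Ae) addr0.
    by rewrite (additive_onD codiff_lin Aa Ade) (codiff_d Ae) ee subrr.
  have ede : exact k (d e) by exists e.
  set a' := a + d e in ch.
  have Aa' : A k a' by apply: (gr_add gA) => //; exact: exact_A.
  suff : exact k a' by move=> /exactB -/(_ _ ede); rewrite addrK.
  have da' : d a' = 0.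
    by rewrite (additive_onD (dm_d_lin dm) Aa (exact_A ede)) da (dm_dd dm Ae) addr0.
  have ea' : exact (n.*2%:Z - k%:Z) (iter (n - k) L a').
    by rewrite iter_linD; apply: exactD => //; apply: exact_iterL ede; lia.
  have cLa' : codiff (iter (n - k) L a') = 0.
    by rewrite (iterL_i sA tw _ Aa') ch da' !iter_lin0 scaler0 addr0.
  (* The statement needed in degree 2n-k is dual, under S, to the coexact half in degree k. *)
  have : dcodiff (n.*2%:Z - k%:Z) (iter (n - k) L a').
    have /(exact_ddelta_dual (k := n.*2%:Z - k%:Z) (l := k)) : coexact_ddelta k by apply: (dd k ks).2.
    by apply => //; [lia|exact: exact_A].
  move=> [z Az ez].
  (* With z = L^(n-k) x, and since d codiff commutes with L, the injective operator L^(n-k) can be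
     cancelled, leaving a' = d codiff x. *)
  have [|||x Ax ex] := iterL_surj (B := A) (k := k) (c := z) sA _ _ _ => //; first by lia.
  apply: (dcodiff_exact _).1; exists x => //.
  apply/eqP; rewrite -subr_eq0; apply/eqP; apply: (iterL_inj (k := k)); first by lia.
    apply: (gr_sub gA) => //.
    by have := dm_d_deg dm (codiff_deg Ax); congr (A _ _); lia.
  by rewrite iter_linB -ez ex (d_codiff_iterL _ Ax) subrr.
have Ac' : A (2 * n%:Z - k%:Z) c by rewrite -kE.
(* For surjectivity, the closed element c is S b with b of degree k and codiff b = 0. *)
have [b Ab eb] := weyl_surj Ac'.
have bE : 2 * n%:Z - (2 * n%:Z - k%:Z) = k by lia.
rewrite bE in Ab eb.
have cb : codiff b = 0.
  have [r r0 rP] := weyl_inv Ab; rewrite -eb in rP.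
  have : codiff (r *: b) = 0 by rewrite -rP; exact: d_ker_weyl.
  rewrite (additive_onZ _ gA codiff_lin Ab) => /eqP.
  by rewrite scaler_eq0 (negPf r0) => /eqP.
(* For k = s this uses the clause in degree s+1. Subtracting codiff x makes b harmonic, and S maps
   codiff x to an exact element. *)
have [x Ax ex] : dcodiff k.+1 (d b).
  apply: ed; [lia|by have := dm_d_deg dm Ab; congr (A _ _); lia| |].
    by exists b => //; move: Ab; congr (A _ _); lia.
  by rewrite (codiff_d Ab) cb (additive_on0 gA (dm_d_lin dm)) oppr0.
have Acx : A k (codiff x) by have := codiff_deg Ax; congr (A _ _); lia.
have hb : harmonic k (b - codiff x).
  split; first exact: (gr_sub gA).
    by rewrite (additive_onB (dm_d_lin dm) Ab Acx) ex subrr.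
  by rewrite (additive_onB codiff_lin Ab Acx) cb (codiff_codiff Ax) subr0.
have [|y hy ey] := weyl_factor harmonic_stable _ hb; first by lia.
have [Ay dy cy] := hy.
exists y => //; rewrite -ey weylB -eb opprB addrCA subrr addr0.
have : coexact k (codiff x) by exists x => //; move: Ax; congr (A _ _); lia.
by move/coexact_weyl; congr (exact _ _); lia.
Qed.

Lemma lefschetz_iff_ddelta (s : nat) : (s < n)%N ->
  (lefschetz_upto s <-> ddelta_upto s) /\ (ddelta_upto s <-> dual_ddelta_upto s).
Proof.
move=> sn; split; last exact: ddelta_dual.
by split; [exact: lefschetz_ddelta|exact: ddelta_lefschetz].
Qed.
End DdeltaLemma.

(** * Linear symplectic algebra *)

Section HorizontalForms.
Variables (R : realType) (m : nat) (P : {vspace 'rV[R]_m}).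
Implicit Types (a b c f : covec R m) (u v w : 'rV[R]_m) (s : seq 'rV[R]_m).

Lemma hcovec_lin k (r : R) a b :
  hcovec P k a -> hcovec P k b -> hcovec P k (r *: a + b).
Proof.
move=> [aa ha] [ab hb]; split; first exact: altform_lin.
by move=> v s vP; rewrite !fctE ha // hb // scaler0 addr0.
Qed.

Lemma hcovec0 k : hcovec P k 0.
Proof. by split=> //; exact: altform_zero. Qed.

Lemma hcovec_icovP k a : hcovec P k a -> forall v, v \in P -> icov v a = 0.
Proof. by move=> [_ ha] v vP; apply/funext => s; exact: ha. Qed.

Lemma hcovecI k a : altform k a -> (forall v, v \in P -> icov v a = 0) -> hcovec P k a.
Proof. by move=> aa ha; split=> // v s /ha /(congr1 (@^~ s)). Qed.

Lemma hcovecZ k (r : R) a : hcovec P k a -> hcovec P k (r *: a).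
Proof. by move=> ha; rewrite -[_ *: _]addr0; apply: hcovec_lin => //; exact: hcovec0. Qed.

Lemma hcovecD k a b : hcovec P k a -> hcovec P k b -> hcovec P k (a + b).
Proof. by move=> ha; rewrite -[a]scale1r; exact: hcovec_lin. Qed.

Lemma hcovec_icov k v a : hcovec P k.+1 a -> hcovec P k (icov v a).
Proof.
move=> ha; apply: hcovecI => [|u uP]; first exact: icov_altform ha.1.
by rewrite (icovC _ _ ha.1) (hcovec_icovP ha uP) oppr0.
Qed.

Lemma hcovec_wedge i j a b :
  hcovec P i a -> hcovec P j b -> hcovec P (i + j) (wedge a b).
Proof.
move=> ha hb; apply: hcovecI => [|v vP]; first exact: altform_wedge ha.1 hb.1.
rewrite icov_wedge (hcovec_icovP ha vP) (hcovec_icovP hb vP) wedge0l linear0.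
by rewrite addr0.
Qed.

Lemma hcovec1 : hcovec P 0 (@covec1 R m).
Proof. by split=> //; apply/altform0P; rewrite /covec1 scale1r. Qed.

Lemma altform_size k a s : altform k a -> size s != k -> a s = 0.
Proof. by move=> [a0 _ _] /eqP; exact: a0. Qed.

Lemma covec_ext a b : a [::] = b [::] -> (forall v, icov v a = icov v b) -> a = b.
Proof.
move=> e0 eS; apply/funext => -[//|v s]; exact: (congr1 (@^~ s) (eS v)).
Qed.

Lemma icov_altform1 f v : altform 1 f -> icov v f = f [:: v] *: @covec1 R m.
Proof. by move=> /(icov_altform v) /altform0P. Qed.

Lemma icov_wedge1 f v a : altform 1 f ->
  icov v (wedge f a) = f [:: v] *: a - wedge f (icov v a).
Proof.
move=> hf; rewrite icov_wedge (icov_altform1 _ hf) wedgeZl wedge1l.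
by rewrite (sgcov_altform hf) expr1 scaleN1r wedgeNl.
Qed.

(* Degrees are integers so that operators of any degree may be composed;
   there are no forms of negative degree. *)
Definition hgr (z : int) a := if z is Posz k then hcovec P k a else a = 0.

(** Contraction with the bivector dual to [sg] when (X, Y) is a frame. The sum over the whole basis
    counts each pair of dual directions twice, whence the factor 1/2. *)
Definition lam n (X Y : 'I_n -> 'rV[R]_m) a : covec R m :=
  2^-1 *: \sum_i icov (X i) (icov (Y i) a).

Lemma lam_is_linear n (X Y : 'I_n -> 'rV[R]_m) : linear (lam X Y).
Proof.
move=> r a b; rewrite /lam scalerA mulrC -scalerA -scalerDr; congr (_ *: _).
by rewrite scaler_sumr -big_split /=; apply: eq_bigr => i _.
Qed.

HB.instance Definition _ n (X Y : 'I_n -> 'rV[R]_m) :=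
  GRing.isLinear.Build R (covec R m) (covec R m) _ (lam X Y)
    (lam_is_linear X Y).

Lemma lam0 n (X Y : 'I_n -> 'rV[R]_m) : lam X Y 0 = 0.
Proof. exact: linear0. Qed.

Lemma lamZ n (X Y : 'I_n -> 'rV[R]_m) (r : R) a : lam X Y (r *: a) = r *: lam X Y a.
Proof. exact: linearZ. Qed.

Lemma wedge0r a : wedge a 0 = 0.
Proof. exact: linear0. Qed.

End HorizontalForms.

Definition presymplectic (R : realType) (m : nat) (P : {vspace 'rV[R]_m})
    (sg : covec R m) :=
  altform 2 sg /\ forall v, v \in P <-> forall w, sg [:: v; w] = 0.

(* [X] is a basis of a complement of [P]; the 1-forms [icov (Y i) sg] are its
   dual basis. *)
Definition frame (R : realType) (m n : nat) (P : {vspace 'rV[R]_m})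
    (sg : covec R m) (X Y : 'I_n -> 'rV[R]_m) :=
  (forall i j, sg [:: Y i; X j] = (i == j)%:R) /\
  (forall w, w - \sum_i sg [:: Y i; w] *: X i \in P).

(** * Exterior algebra in a symplectic frame *)

Section Frames.
Variables (R : realType) (m n : nat) (P : {vspace 'rV[R]_m}) (sg : covec R m).
Variables (X Y : 'I_n.*2 -> 'rV[R]_m).
Hypotheses (hsg : presymplectic P sg) (hfr : frame P sg X Y).
Implicit Types (a b c f : covec R m) (u v w : 'rV[R]_m) (s : seq 'rV[R]_m).

Lemma presymplectic_hcovec : hcovec P 2 sg.
Proof.
apply: hcovecI => [|v /(hsg.2 v) vP]; first exact: hsg.1.
apply: covec_ext => [|w].
  by rewrite /icov (altform_size hsg.1).
by rewrite (icov_altform1 _ (icov_altform v hsg.1)) /icov vP scale0r.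
Qed.
Let hsg2 := presymplectic_hcovec.

Lemma icov_sg u : hcovec P 1 (icov u sg). Proof. exact: hcovec_icov. Qed.

Lemma sgC u v : sg [:: u; v] = - sg [:: v; u].
Proof. exact: (congr1 (@^~ [::]) (icovC v u hsg.1)). Qed.

Lemma sg_sumr u (I : Type) (r : seq I) (F : I -> 'rV[R]_m) (c : I -> R) :
  sg [:: u; \sum_(i <- r) c i *: F i] = \sum_(i <- r) c i * sg [:: u; F i].
Proof.
have h := icov_altform u hsg.1.
rewrite -[LHS]/(icov _ (icov u sg) [::]) (icov_sumv _ _ _ h).
rewrite -[LHS]/((\sum_(i <- r) icov (c i *: F i) (icov u sg)) [::]) fct_sumE.
by apply: eq_bigr => i _; rewrite (icovZv _ _ h).
Qed.

Lemma sg_suml u (I : Type) (r : seq I) (F : I -> 'rV[R]_m) (c : I -> R) :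
  sg [:: \sum_(i <- r) c i *: F i; u] = \sum_(i <- r) c i * sg [:: F i; u].
Proof.
rewrite sgC sg_sumr -sumrN; apply: eq_bigr => i _.
by rewrite sgC mulrN opprK.
Qed.

Lemma sgDl u v w : sg [:: u + v; w] = sg [:: u; w] + sg [:: v; w].
Proof.
by have := congr1 (@^~ [:: w]) (icovDv u v hsg.1).
Qed.

Lemma icov_mod k a u v : hcovec P k a -> u - v \in P -> icov u a = icov v a.
Proof.
move=> ha /(hcovec_icovP ha); rewrite (icovDv _ _ ha.1) (icovNv _ ha.1).
by move/eqP; rewrite subr_eq0 => /eqP.
Qed.

Lemma sg_mod u v w : u - v \in P -> sg [:: u; w] = sg [:: v; w].
Proof. by move=> uv; have := congr1 (@^~ [:: w]) (icov_mod hsg2 uv). Qed.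

Lemma icov_frame k a w : hcovec P k a ->
  icov w a = \sum_i sg [:: Y i; w] *: icov (X i) a.
Proof.
move=> ha; rewrite (icov_mod ha (hfr.2 w)) (icov_sumv _ _ _ ha.1).
by apply: eq_bigr => i _; rewrite (icovZv _ _ ha.1).
Qed.

Lemma frame_mem v : (forall j, sg [:: v; X j] = 0) -> v \in P.
Proof.
move=> vX; apply/(hsg.2 v) => w; rewrite sgC.
rewrite (sg_mod _ (hfr.2 w)) sg_suml big1 ?oppr0 // => i _.
by rewrite sgC vX oppr0 mulr0.
Qed.

(** Duality is symmetric up to sign, so Y also spans modulo P, with coefficients - [sg] (X i, w). *)
Lemma frame_expY w : w + \sum_i sg [:: X i; w] *: Y i \in P.
Proof.
apply: frame_mem => j; rewrite sgDl sg_suml (bigD1 j) //= (hfr.1 j j) eqxx mulr1.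
rewrite big1 => [|i ij]; last by rewrite (hfr.1 i j) (negPf ij) mulr0.
by rewrite addr0 sgC addNr.
Qed.

Lemma icov_frameY k a w : hcovec P k a ->
  \sum_i sg [:: X i; w] *: icov (Y i) a = - icov w a.
Proof.
move=> ha; have := hcovec_icovP ha (frame_expY w).
rewrite (icovDv _ _ ha.1) (icov_sumv _ _ _ ha.1) => /eqP.
rewrite addrC addr_eq0 => /eqP <-.
by apply: eq_bigr => i _; rewrite (icovZv _ _ ha.1).
Qed.

(** The left-hand side is a derivation acting on 1-forms as the scalar c, hence as c k in degree k.
    Contracting with an arbitrary v turns this into an induction on the degree. *)
Lemma euler_gen (c : R) (f : 'I_n.*2 -> covec R m) (Z : 'I_n.*2 -> 'rV[R]_m) :
  (forall i, hcovec P 1 (f i)) ->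
  (forall k a v, hcovec P k a -> \sum_i f i [:: v] *: icov (Z i) a = c *: icov v a) ->
  forall k a, hcovec P k a ->
    \sum_i wedge (f i) (icov (Z i) a) = (c * k%:R) *: a.
Proof.
move=> f1 fZ; elim=> [|k IHk] a ha.
  rewrite mulr0 scale0r big1 // => i _.
  by rewrite (icov_altform0 _ ha.1) linear0.
have hw i : hcovec P k.+1 (wedge (f i) (icov (Z i) a)).
  by apply: (hcovec_wedge (i := 1)) => //; exact: hcovec_icov.
apply: covec_ext => [|v].
  rewrite !fctE fct_sumE; rewrite (altform_size ha.1) // scaler0 big1 // => i _.
  by rewrite (altform_size (hw i).1).
have -> : icov v (\sum_i wedge (f i) (icov (Z i) a)) =
    \sum_i icov v (wedge (f i) (icov (Z i) a)).
  by apply/funext => s; rewrite /icov !fct_sumE.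
under eq_bigr do rewrite (icov_wedge1 _ _ (f1 _).1).
rewrite big_split /= (fZ _ _ _ ha) sumrN.
have -> : \sum_i wedge (f i) (icov v (icov (Z i) a)) =
    - \sum_i wedge (f i) (icov (Z i) (icov v a)).
  by rewrite -sumrN; apply: eq_bigr => i _; rewrite (icovC _ _ ha.1) linearN.
by rewrite opprK (IHk _ (hcovec_icov v ha)) icovZ -scalerDl -nat1r mulrDr mulr1.
Qed.

Lemma euler k a : hcovec P k a ->
  \sum_i wedge (icov (Y i) sg) (icov (X i) a) = k%:R *: a.
Proof.
move=> ha; rewrite (euler_gen (c := 1) _ _ ha) ?mul1r // => [i|l b v hb].
  exact: icov_sg.
by rewrite scale1r (icov_frame _ hb).
Qed.

Lemma eulerY k a : hcovec P k a ->
  \sum_i wedge (icov (X i) sg) (icov (Y i) a) = - (k%:R *: a).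
Proof.
move=> ha; rewrite (euler_gen (c := -1) _ _ ha) ?mulN1r ?scaleNr // => [i|l b v hb].
  exact: icov_sg.
by rewrite scaleN1r -(icov_frameY _ hb).
Qed.

Lemma altform_expand k a p s v : hcovec P k a ->
  a (p ++ v :: s) = \sum_i sg [:: Y i; v] * a (p ++ X i :: s).
Proof.
elim: p k a => [|w p IHp] k a ha /=.
  have := congr1 (@^~ s) (icov_frame v ha).
  by rewrite /= fct_sumE.
case: k ha => [|k] ha; last exact: (IHp _ _ (hcovec_icov w ha)).
by rewrite !(altform_size ha.1) // big1 // => i _; rewrite (altform_size ha.1) ?mulr0.
Qed.

Lemma nuniq_split (T : eqType) (I : seq T) : ~~ uniq I ->
  exists x p q r, I = p ++ x :: q ++ x :: r.
Proof.
elim: I => //= x I IHI; rewrite negb_and negbK => /orP[/path.splitPr[p q]|/IHI].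
  by exists x, [::], p, q.
by move=> [y [p [q [r ->]]]]; exists y, (x :: p), q, r.
Qed.

(* Expanding the arguments in the basis [X], a form of degree above [2n] has a
   repeated argument. *)
Lemma hcovec_bound k a : (n.*2 < k)%N -> hcovec P k a -> a = 0.
Proof.
move=> nk ha.
suff h (I : seq 'I_n.*2) s : (n.*2 < size I + size s)%N -> a (map X I ++ s) = 0.
  apply/funext => s; change (a s = 0).
  have [sk|sk] := eqVneq (size s) k; first by apply: (h [::]); rewrite sk.
  exact: altform_size ha.1 sk.
elim: s I => [|v s IHs] I /=; rewrite ?addn0 => sI.
  have /nuniq_split[i [p [q [r ->]]]] : ~~ uniq I.
    by apply/negP => /card_uniqP uI; have := max_card (mem I); rewrite uI card_ord leqNgt sI.
  by rewrite cats0 map_cat /= map_cat /=; case: ha.1 => _ _ ->.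
rewrite (altform_expand _ _ v ha).
by rewrite big1 // => i _; rewrite -cat_rcons -map_rcons IHs ?mulr0 // size_rcons; lia.
Qed.

Lemma hgr_graded : graded n (hgr P).
Proof.
split=> [[k|k] r u v|[k|k]|[k|k] a] /=.
- exact: hcovec_lin.
- by move=> -> ->; rewrite scaler0 addr0.
- exact: hcovec0.
- by [].
- by move=> ha nk; apply: (hcovec_bound _ ha); lia.
- by [].
Qed.

Lemma hgr_icov z v a : hgr P z a -> hgr P (z - 1) (icov v a).
Proof.
case: z => [[|k]|k] ha.
- by rewrite /= (icov_altform0 _ ha.1).
- have -> : k.+1%:Z - 1 = k by lia.
  exact: hcovec_icov.
- have -> : Negz k - 1 = Negz k.+1 by lia.
  by move: ha => /= ->.
Qed.

Lemma hgr_wedge z k f a : hcovec P k f -> hgr P z a -> hgr P (z + k%:Z) (wedge f a).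
Proof.
move=> hf; case: z => z ha.
  by rewrite -PoszD addnC; exact: hcovec_wedge.
by rewrite ha linear0; apply (gr_zero hgr_graded).
Qed.

Local Notation L := (wedge sg).
Local Notation Lam := (lam X Y).

Lemma hgr_lam z a : hgr P z a -> hgr P (z - 2) (Lam a).
Proof.
move=> ha; apply: (gr_scale _ hgr_graded); apply: (gr_sum _ hgr_graded) => i _.
by have := hgr_icov (X i) (hgr_icov (Y i) ha); congr (hgr _ _ _); lia.
Qed.

Lemma hgr_stable : stable n L Lam (hgr P).
Proof.
split; [exact: hgr_graded|move=> k a ha|exact: hgr_lam].
exact: hgr_wedge.
Qed.

Lemma lam_wedge_sg k a : hcovec P k a ->
  Lam (wedge sg a) = wedge sg (Lam a) + (n%:Z - k%:Z)%:~R *: a.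
Proof.
move=> ha; have esg : sgcov sg = sg.
  by rewrite (sgcov_altform hsg.1) sqrrN expr1n scale1r.
(* Besides the term moved past [sg], each index contributes a and one summand of each Euler
   operator; half of 2n - k - k is n - k. *)
have e i : icov (X i) (icov (Y i) (wedge sg a)) = wedge sg (icov (X i) (icov (Y i) a)) +
    (a - wedge (icov (Y i) sg) (icov (X i) a) + wedge (icov (X i) sg) (icov (Y i) a)).
  rewrite icov_wedge esg icovD (icov_wedge1 _ _ (icov_sg _).1) icov_wedge esg.
  by rewrite /icov (hfr.1 i i) eqxx scale1r [RHS]addrC addrA.
rewrite /lam; under eq_bigr do rewrite e.
rewrite big_split /= scalerDr; congr (_ + _).
  by rewrite wedgeZr wedge_sumr.
rewrite big_split /= big_split /= sumrN (euler ha) (eulerY ha) sumr_const card_ord.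
rewrite -(scaler_nat _ a) -!scalerBl scalerA; congr (_ *: _).
by rewrite intrB -!pmulrn -muln2 natrM; field.
Qed.

Lemma hgr_comm z a : hgr P z a ->
  Lam (wedge sg a) = wedge sg (Lam a) + (n%:Z - z)%:~R *: a.
Proof.
case: z => [k|k] /=; first exact: lam_wedge_sg.
by move=> ->; rewrite wedge0r !lam0 wedge0r scaler0 addr0.
Qed.

Lemma icov_sum v (I : Type) (r : seq I) (F : I -> covec R m) :
  icov v (\sum_(i <- r) F i) = \sum_(i <- r) icov v (F i).
Proof. by apply/funext => s; rewrite /icov !fct_sumE. Qed.

(** The pointwise model of the pair (d, codiff). *)
Lemma covec_intertwiner u : intertwiner L Lam (hgr P) (wedge (icov u sg)) (icov u).
Proof.
have esg : sgcov sg = sg.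
  by rewrite (sgcov_altform hsg.1) sqrrN expr1n scale1r.
split=> //.
- by move=> z r a b _ _; rewrite linearP.
- by move=> z a; exact: hgr_wedge (icov_sg u).
- by move=> z a; exact: hgr_icov.
- move=> z a _; rewrite wedgeA (wedgeC_even (icov u sg) esg) -wedgeA //.
- by move=> z a _; rewrite icov_wedge esg addrC.
- case=> [k|k] a /=; last by move=> ->; rewrite lam0 !wedge0r lam0 subr0.
  move=> ha; have f1 := (icov_sg u).1.
  have e i : icov (X i) (icov (Y i) (wedge (icov u sg) a)) =
     wedge (icov u sg) (icov (X i) (icov (Y i) a)) +
     (sg [:: u; Y i] *: icov (X i) a - sg [:: u; X i] *: icov (Y i) a).
    rewrite (icov_wedge1 _ _ f1) icovD icovN icovZ (icov_wedge1 _ _ f1) opprB.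
    by rewrite [RHS]addrC -addrA [- _ + _]addrC.
  rewrite /lam; under eq_bigr do rewrite e.
  rewrite big_split /= scalerDr; congr (_ + _).
    by rewrite wedgeZr wedge_sumr.
  rewrite sumrB.
  under eq_bigr do rewrite sgC scaleNr.
  under [X in _ - X]eq_bigr do rewrite sgC scaleNr.
  rewrite !sumrN -(icov_frame u ha) (icov_frameY u ha) opprK -opprD scalerN; congr (- _).
  by rewrite -mulr2n -(scaler_nat _ (icov u a)) scalerA mulVf ?scale1r // pnatr_eq0.
- case=> [k|k] a /=; last by move=> ->; rewrite /icov lam0.
  move=> ha; rewrite /lam icovZ icov_sum; congr (_ *: _); apply: eq_bigr => i _.
  case: k ha => [|k] ha; first by rewrite !(icov_altform0 _ ha.1).
  rewrite (icovC (Y i) u ha.1) icovN (icovC _ _ (icov_altform _ ha.1)).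
  by rewrite opprK.
Qed.

(** Euler's identity writes a form of degree k+1 as a combination of products of 1-forms [icov u sg]
    with forms of degree k, so horizontal forms are generated from 1 by such products. *)
Lemma hcovec_ind (Q : nat -> covec R m -> Prop) :
  (forall k (r : R) a b, hcovec P k a -> hcovec P k b -> Q k a -> Q k b -> Q k (r *: a + b)) ->
  Q 0%N (@covec1 R m) ->
  (forall k u a, hcovec P k a -> Q k a -> Q k.+1 (wedge (icov u sg) a)) ->
  forall k a, hcovec P k a -> Q k a.
Proof.
move=> Qlin Q1 QS.
have Q0 k a : hcovec P k a -> Q k a -> Q k 0.
  by move=> ha Qa; have := Qlin _ (-1) a a ha ha Qa Qa; rewrite scaleN1r addNr.
have QZ k (r : R) a : hcovec P k a -> Q k a -> Q k (r *: a).
  move=> ha Qa; rewrite -[_ *: _]addr0; apply: Qlin => //; first exact: hcovec0.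
  exact: Q0 ha Qa.
elim=> [|k IHk] a ha.
  have /altform0P -> := ha.1; apply: QZ => //; exact: hcovec1.
have -> : a = k.+1%:R^-1 *: \sum_i wedge (icov (Y i) sg) (icov (X i) a).
  by rewrite (euler ha) scalerA mulVf ?scale1r // pnatr_eq0.
have hi i := hcovec_icov (X i) ha.
have hw i : hcovec P k.+1 (wedge (icov (Y i) sg) (icov (X i) a)).
  exact: (hcovec_wedge (icov_sg _)).
have Qi i := QS k (Y i) _ (hi i) (IHk _ (hi i)).
have [Qs hs] : Q k.+1 (\sum_i wedge (icov (Y i) sg) (icov (X i) a)) /\
   hcovec P k.+1 (\sum_i wedge (icov (Y i) sg) (icov (X i) a)).
  apply: (big_rec (fun x => Q k.+1 x /\ hcovec P k.+1 x)).
    split; last exact: hcovec0.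
    have := IHk _ (hcovec0 P k) => /(QS k 0 _ (hcovec0 P k)).
    by rewrite linear0.
  move=> i x _ [Qx hx]; split; last exact: hcovecD.
  by rewrite -[X in X + _]scale1r; exact: Qlin.
exact: QZ.
Qed.

(** * The operator S on exterior forms and the star *)

Local Notation S := (weyl n L Lam n%:Z).
Let st := hgr_stable.
Let gr := hgr_graded.

Lemma hgr_weyl (c : int) z a : hgr P z a -> hgr P (2 * c - z) (weyl n L Lam c z a).
Proof. exact: (st_weyl st). Qed.

Lemma hgr_nat k a : hcovec P k a -> hgr P k%:Z a. Proof. by []. Qed.

(** By the intertwining relation it suffices to test on 1, whose image has degree 2n+2 and is
    therefore 0. *)
Lemma weyl_succ_eq0 z a : hgr P z a -> weyl n L Lam n.+1%:Z z a = 0.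
Proof.
case: z => [k|k] ha; last by move: ha => /= ->; exact: weyl0.
move: k a ha; apply: hcovec_ind => [k r a b ha hb Ta Tb||k u a ha Ta].
- by rewrite weyl_lin Ta Tb scaler0 addr0.
- by apply: (gr_bound gr (hgr_weyl n.+1%:Z (hgr_nat (hcovec1 P)))); lia.
- have -> : k.+1%:Z = k%:Z + 1 by lia.
  by rewrite (weyl_intertwine st (covec_intertwiner u) _ (hgr_nat ha)) Ta.
Qed.

Lemma weyl_wedge u z a : hgr P z a ->
  S (z + 1) (wedge (icov u sg) a) = icov u (S z a).
Proof. exact: (weyl_intertwine st (covec_intertwiner u)). Qed.

Lemma weyl_icov u z a : hgr P z a ->
  S (z - 1) (icov u a) = - wedge (icov u sg) (S z a).
Proof.
move=> ha; rewrite (weyl_intertwineC st (covec_intertwiner u) ha).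
rewrite weyl_succ_eq0 ?sub0r ?opprK //.
exact: hgr_wedge (icov_sg u) ha.
Qed.

Lemma lam_iterL1 q : Lam (iter q L (@covec1 R m)) =
  (q%:R * (n%:R - q%:R + 1)) *: iter q.-1 L (@covec1 R m).
Proof.
elim: q => [|q IHq].
  by rewrite mul0r scale0r /lam /= big1 ?scaler0.
have hq : hgr P (q.*2)%:Z (iter q L (@covec1 R m)).
  by have := st_iterL st q (hgr_nat (hcovec1 P)); rewrite add0r.
rewrite /= (hgr_comm hq) IHq wedgeZr.
have -> : (q%:R * (n%:R - q%:R + 1)) *: wedge sg (iter q.-1 L (@covec1 R m)) =
   (q%:R * (n%:R - q%:R + 1)) *: iter q L (@covec1 R m).
  by case: q {IHq hq} => [|q] //=; rewrite !mul0r !scale0r.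
rewrite -scalerDl; congr (_ *: _).
by rewrite intrB -!pmulrn -muln2 natrM -natr1; ring.
Qed.

Lemma iterLam_iterL1 p : (p <= n)%N ->
  iter p Lam (iter n L (@covec1 R m)) =
  (n ^_ p * p`!)%N%:R *: iter (n - p) L (@covec1 R m).
Proof.
elim: p => [|p IHp] pn; first by rewrite subn0 ffactn0 fact0 scale1r.
rewrite /= (IHp (ltnW pn)) lamZ lam_iterL1 scalerA.
have -> : (n - p).-1 = (n - p.+1)%N by lia.
congr (_ *: _); rewrite ffactnSr factS !natrM natrB ?(ltnW pn) // -natr1; ring.
Qed.

Lemma weyl1 : S 0 (@covec1 R m) = (n`!%:R)^-1 *: iter n L (@covec1 R m).
Proof.
rewrite /weyl big_ord_recl big1 => [|j _].
  by rewrite /= !addn0 expr0 fact0 divr1 scale1r addr0.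
rewrite (_ : iter _ Lam _ = 0) ?Lpow0 ?scaler0 //.
have := st_iterLam st j.+1 (hgr_nat (hcovec1 P)).
by move/(gr_bound gr) => -> //; rewrite /bump; move: (nat_of_ord j) => {}j; lia.
Qed.

Lemma weyl_weyl1 : S (n.*2%:Z) (S 0 (@covec1 R m)) = (-1) ^+ n *: @covec1 R m.
Proof.
(* Only j = n survives: smaller j give negative powers of L, and Lam^(n+1) kills L^n 1. *)
rewrite weyl1 weylZ {1}/weyl big_ord_recr big_ord_recr big1 => [|j _] /=; last first.
  have -> : n%:Z + j%:Z - n.*2%:Z = Negz (n - j).-1.
    by have := ltn_ord j; move: (nat_of_ord j) => {}j; lia.
  by rewrite scaler0.
have -> : n%:Z + n%:Z - n.*2%:Z = 0%N by lia.
have -> : n%:Z + n.+1%:Z - n.*2%:Z = 1%N by lia.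
have e := iterLam_iterL1 (leqnn n); rewrite subnn /= in e.
have Lam1 : Lam (@covec1 R m) = 0 by rewrite /lam big1 ?scaler0.
rewrite add0r e lamZ Lam1 scaler0 Lpow0 scaler0 addr0 /= !scalerA; congr (_ *: _).
have f0 : n`!%:R != 0 :> R by rewrite pnatr_eq0 -lt0n fact_gt0.
by rewrite ffactnn fact0 natrM invr1 mulr1; field.
Qed.

(** S turns exterior product with [icov u sg] into contraction with u, and contraction back into
    minus the product; each factor added to 1 thus contributes -1 to the value (-1)^n at 1. *)
Lemma weyl_weyl z a : hgr P z a -> S (2 * n%:Z - z) (S z a) = (-1) ^+ (n + `|z|) *: a.
Proof.
case: z => [k|k] ha; last by move: ha => /= ->; rewrite !weyl0 scaler0.
rewrite absz_nat; move: k a ha.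
apply: hcovec_ind => [k r a b ha hb Sa Sb||k u a ha Sa].
- rewrite 2!weyl_lin.
  transitivity (r *: ((-1) ^+ (n + k) *: a) + (-1) ^+ (n + k) *: b).
    by congr (_ *: _ + _); [exact: Sa|exact: Sb].
  by rewrite scalerDr 2!scalerA [r * _]mulrC.
- have -> : 2 * n%:Z - 0 = n.*2%:Z by lia.
  by rewrite weyl_weyl1 addn0.
- have -> : k.+1%:Z = k%:Z + 1 by lia.
  rewrite (weyl_wedge u (hgr_nat ha)).
  have -> : 2 * n%:Z - (k%:Z + 1) = 2 * n%:Z - k%:Z - 1 by lia.
  rewrite (weyl_icov u (hgr_weyl n%:Z (hgr_nat ha))) Sa wedgeZr.
  by rewrite addnS exprS mulN1r scaleNr.
Qed.

Lemma wedge_sgE a : wedge sg a =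
  2^-1 *: \sum_i wedge (icov (Y i) sg) (wedge (icov (X i) sg) a).
Proof.
transitivity (wedge (2^-1 *: \sum_i wedge (icov (Y i) sg) (icov (X i) sg)) a).
  by rewrite (euler hsg2) scalerA mulVf ?scale1r // pnatr_eq0.
rewrite wedgeZl; congr (_ *: _).
rewrite (big_morph (fun b => wedge b a) (id1 := 0) (op1 := +%R)).
- by apply: eq_bigr => i _; rewrite wedgeA.
- by move=> b c; exact: wedgeDl.
- exact: wedge0l.
Qed.

(** Writing [sg] as half the sum of products of dual 1-forms, S turns the two products into two
    contractions in the opposite order, and anticommutation gives the minus sign. *)
Lemma weyl_wedge_sg z a : hgr P z a -> S (z + 2) (wedge sg a) = - Lam (S z a).
Proof.
move=> ha; rewrite wedge_sgE weylZ /lam -scalerN; congr (_ *: _).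
rewrite (big_morph (S (z + 2)) (id1 := 0) (op1 := +%R)); last 2 first.
- by move=> b c; exact: weylD.
- exact: weyl0.
rewrite -sumrN; apply: eq_bigr => i _.
have -> : z + 2 = z + 1 + 1 by lia.
rewrite (weyl_wedge (Y i) (hgr_wedge (icov_sg (X i)) ha)) (weyl_wedge (X i) ha).
have := hgr_weyl n%:Z ha; case: (2 * n%:Z - z) => [k|k] /=.
  by case=> hS _; rewrite (icovC _ _ hS).
by move=> ->; rewrite /icov oppr0.
Qed.

(* The form [B] of degree [k], computed by contracting along the frame. *)
Fixpoint frame_form (k : nat) (b a : covec R m) : R :=
  if k is k'.+1 then
    k%:R^-1 * \sum_i frame_form k' (icov (X i) b) (icov (Y i) a)
  else b [::] * a [::].

Lemma frame_form_linl k (r : R) b b' a :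
  frame_form k (r *: b + b') a = r * frame_form k b a + frame_form k b' a.
Proof.
elim: k b b' a => [|k IHk] b b' a /=; first by rewrite !fctE !scaleRE; ring.
under eq_bigr do rewrite IHk.
by rewrite big_split /= -mulr_sumr; ring.
Qed.

Lemma frame_form_linr k (r : R) b a a' :
  frame_form k b (r *: a + a') = r * frame_form k b a + frame_form k b a'.
Proof.
elim: k b a a' => [|k IHk] b a a' /=; first by rewrite !fctE !scaleRE; ring.
under eq_bigr do rewrite IHk.
by rewrite big_split /= -mulr_sumr; ring.
Qed.

Lemma frame_form0l k a : frame_form k 0 a = 0.
Proof. by have := frame_form_linl k (-1) 0 0 a; rewrite scaler0 addr0 mulN1r addNr. Qed.

Lemma frame_form0r k b : frame_form k b 0 = 0.
Proof. by have := frame_form_linr k (-1) b 0 0; rewrite scaler0 addr0 mulN1r addNr. Qed.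

Lemma frame_formNl k b a : frame_form k (- b) a = - frame_form k b a.
Proof.
by have := frame_form_linl k (-1) b 0 a; rewrite addr0 scaleN1r mulN1r frame_form0l addr0.
Qed.

Lemma frame_formNr k b a : frame_form k b (- a) = - frame_form k b a.
Proof.
by have := frame_form_linr k (-1) b a 0; rewrite addr0 scaleN1r mulN1r frame_form0r addr0.
Qed.

Lemma frame_form_suml k (c : 'I_n.*2 -> R) (F : 'I_n.*2 -> covec R m) a :
  frame_form k (\sum_i c i *: F i) a = \sum_i c i * frame_form k (F i) a.
Proof.
elim/big_rec2: _ => [|i x y _ <-]; first exact: frame_form0l.
exact: frame_form_linl.
Qed.

Lemma frame_form_sumr k b (c : 'I_n.*2 -> R) (F : 'I_n.*2 -> covec R m) :
  frame_form k b (\sum_i c i *: F i) = \sum_i c i * frame_form k b (F i).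
Proof.
elim/big_rec2: _ => [|i x y _ <-]; first exact: frame_form0r.
exact: frame_form_linr.
Qed.

Lemma icov_frameX k a u : hcovec P k a ->
  \sum_i sg [:: u; X i] *: icov (Y i) a = icov u a.
Proof.
move=> ha; apply: oppr_inj; rewrite -(icov_frameY u ha) -sumrN.
by apply: eq_bigr => i _; rewrite sgC scaleNr opprK.
Qed.

Lemma frame_form1 b a :
  frame_form 1 b a = \sum_i frame_form 0 (icov (X i) b) (icov (Y i) a).
Proof. by rewrite /= invr1 mul1r. Qed.

Lemma frame_formS k b a : k.+1%:R * frame_form k.+1 b a =
  \sum_i frame_form k (icov (X i) b) (icov (Y i) a).
Proof. by rewrite /= mulrA mulfV ?mul1r // pnatr_eq0. Qed.

Lemma frame_form_neq k l b a : hcovec P k b -> k != l -> frame_form l b a = 0.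
Proof.
elim: l k b a => [|l IHl] k b a hb kl /=.
  by rewrite (altform_size hb.1) ?mul0r // eq_sym.
rewrite big1 ?mulr0 // => i _.
case: k hb kl => [|k] hb kl; first by rewrite (icov_altform0 _ hb.1) frame_form0l.
by apply: IHl (hcovec_icov _ hb) _.
Qed.

Lemma frame_form0 b a : frame_form 0 b a = b [::] * a [::]. Proof. by []. Qed.

Arguments frame_form : simpl never.

(** Exterior product is adjoint to contraction; the factor 1/k in [frame_form] makes this exact. In
    the right slot the antisymmetry of [sg] adds a sign. *)
Lemma frame_form_wedgel k u b a : hcovec P k b -> hcovec P k.+1 a ->
  frame_form k.+1 (wedge (icov u sg) b) a = frame_form k b (icov u a).
Proof.
elim: k u b a => [|k IHk] u b a hb ha.
  rewrite frame_form1 -(icov_frameX u ha) frame_form_sumr.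
  apply: eq_bigr => i _.
  rewrite (icov_wedge1 _ _ (icov_sg u).1) (icov_altform0 _ hb.1) wedge0r subr0.
  by rewrite !frame_form0 !fctE scaleRE -mulrA.
apply: (mulfI (x := k.+2%:R)); first by rewrite pnatr_eq0.
rewrite frame_formS.
transitivity (\sum_i (sg [:: u; X i] * frame_form k.+1 b (icov (Y i) a) +
                      frame_form k (icov (X i) b) (icov (Y i) (icov u a)))).
  apply: eq_bigr => i _; rewrite (icov_wedge1 _ _ (icov_sg u).1) frame_form_linl.
  rewrite frame_formNl IHk; [|exact: hcovec_icov..].
  by rewrite (icovC u _ ha.1) frame_formNr opprK.
rewrite big_split /= -frame_form_sumr (icov_frameX u ha) -frame_formS.
by rewrite -[k.+2%:R]nat1r mulrDl mul1r.
Qed.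

Lemma frame_form_wedger k u b a : hcovec P k.+1 b -> hcovec P k a ->
  frame_form k.+1 b (wedge (icov u sg) a) = - frame_form k (icov u b) a.
Proof.
elim: k u b a => [|k IHk] u b a hb ha.
  rewrite frame_form1 (icov_frame u hb) frame_form_suml -sumrN.
  apply: eq_bigr => i _.
  rewrite (icov_wedge1 _ _ (icov_sg u).1) (icov_altform0 _ ha.1) wedge0r subr0.
  by rewrite !frame_form0 /icov !fctE scaleRE (sgC u); ring.
apply: (mulfI (x := k.+2%:R)); first by rewrite pnatr_eq0.
rewrite frame_formS.
transitivity (- (\sum_i (sg [:: Y i; u] * frame_form k.+1 (icov (X i) b) a +
                      frame_form k (icov (X i) (icov u b)) (icov (Y i) a)))).
  rewrite -sumrN; apply: eq_bigr => i _.
  rewrite (icov_wedge1 _ _ (icov_sg u).1) frame_form_linr.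
  rewrite frame_formNr IHk; [|exact: hcovec_icov..].
  by rewrite (icovC u _ hb.1) frame_formNl opprK opprD -mulNr /icov -sgC.
rewrite big_split /= -frame_form_suml -(icov_frame u hb) -frame_formS.
by rewrite -[k.+2%:R]nat1r mulrN mulrDl mul1r.
Qed.

(** [is_sharp] describes a single function for all degrees, which receives no degree as an argument;
    on homogeneous forms only one summand is non-zero. *)
Definition total_form (b a : covec R m) : R := \sum_(k < n.*2.+1) frame_form k b a.

Lemma total_formE k b a : hcovec P k b -> total_form b a = frame_form k b a.
Proof.
move=> hb; have [kn|kn] := ltnP k n.*2.+1.
  rewrite /total_form (bigD1 (Ordinal kn)) //= big1 ?addr0 // => i ik.
  by rewrite (frame_form_neq _ hb) //; apply: contra ik => /eqP ki; apply/eqP/val_inj.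
rewrite (hcovec_bound kn hb) frame_form0l /total_form big1 // => i _.
exact: frame_form0l.
Qed.

Lemma sharp1P f : hcovec P 1 f -> icov (sharp1 sg f) sg = f.
Proof.
(* U shows that the set defining [sharp1] is inhabited. The chosen element is determined only modulo
   P, so the conclusion is stated through [icov]. *)
move=> hf; pose U := \sum_i f [:: X i] *: Y i.
have UP w : sg [:: U; w] = f [:: w].
  rewrite sg_suml; have := congr1 (@^~ [::]) (icov_frame w hf).
  rewrite /icov /= fct_sumE => ->; apply: eq_bigr => i _.
  by rewrite !fctE scaleRE mulrC.
have : [set V | forall w, sg [:: V; w] = f [:: w]] (sharp1 sg f).
  exact: (xgetPex 0 (ex_intro _ U UP)).
move=> /= sP; apply: covec_ext => [|w].
  by rewrite /icov (altform_size hsg.1) // (altform_size hf.1).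
by rewrite (icov_altform1 _ (icov_sg _).1) (icov_altform1 _ hf.1) /icov sP.
Qed.

Lemma hcovec_wedges (fs : seq (covec R m)) :
  (forall f, f \in fs -> hcovec P 1 f) -> hcovec P (size fs) (wedges fs).
Proof.
elim: fs => [_|f fs IHfs h]; first exact: hcovec1.
apply: (hcovec_wedge (i := 1)); first by apply: h; rewrite mem_head.
by apply: IHfs => g gfs; apply: h; rewrite inE gfs orbT.
Qed.

Lemma total_form_is_sharp : is_sharp P sg total_form.
Proof.
split=> [k r a a' b ha ha' _|fs b fsP hb].
  rewrite !(@total_formE k) //; last exact: hcovec_lin.
  exact: frame_form_linl.
rewrite (total_formE _ (hcovec_wedges fsP)); elim: fs b fsP hb => [|f fs IHfs] b fsP hb.
  by rewrite /= frame_form0 /covec1 mul1r.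
have fs1 g : g \in fs -> hcovec P 1 g by move=> gfs; apply: fsP; rewrite inE gfs orbT.
have hf : hcovec P 1 f by apply: fsP; rewrite mem_head.
have -> : wedges (f :: fs) = wedge (icov (sharp1 sg f) sg) (wedges fs).
  by rewrite (sharp1P hf).
rewrite [size _]/= (frame_form_wedgel _ (hcovec_wedges fs1) hb) (IHfs _ fs1) //.
exact: hcovec_icov.
Qed.

Lemma wedges_rcons (fs : seq (covec R m)) f :
  wedges (rcons fs f) = wedge (wedges fs) f.
Proof.
by elim: fs => /= [|g fs ->]; rewrite ?wedge1l ?wedge1r // wedgeA.
Qed.

Lemma is_sharp_unique (S1 S2 : covec R m -> covec R m -> R) k b a :
  is_sharp P sg S1 -> is_sharp P sg S2 -> hcovec P k b -> hcovec P k a ->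
  S1 b a = S2 b a.
Proof.
move=> [lin1 w1] [lin2 w2] hb ha.
have lin0 (T : covec R m -> covec R m -> R) :
    (forall r c c', hcovec P k c -> hcovec P k c' ->
       T (r *: c + c') a = r * T c a + T c' a) ->
    T 0 a = 0 /\ forall r c, hcovec P k c -> T (r *: c) a = r * T c a.
  move=> Tl; have T0 : T 0 a = 0.
    have := Tl 1 _ _ (hcovec0 P k) (hcovec0 P k).
    by rewrite scaler0 addr0 mul1r => /eqP; rewrite -subr_eq subrr => /eqP.
  by split=> // r c hc; rewrite -[_ *: _]addr0 (Tl _ _ _ hc (hcovec0 P k)) T0 addr0.
have [T10 T1Z] := lin0 S1 (fun r c c' hc hc' => lin1 k r c c' a hc hc' ha).
have [T20 T2Z] := lin0 S2 (fun r c c' hc hc' => lin2 k r c c' a hc hc' ha).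
(* Euler's identity peels 1-forms off c and stores them in fs; once c is a scalar, both maps are
   given by the rule for decomposable forms. *)
suff h j (fs : seq (covec R m)) c : (forall f, f \in fs -> hcovec P 1 f) ->
    hcovec P j c -> (size fs + j)%N = k ->
    S1 (wedge (wedges fs) c) a = S2 (wedge (wedges fs) c) a.
  by have := h k [::] b; rewrite /= wedge1l; apply.
elim: j fs c => [|j IHj] fs c fsP hc sk.
  have /altform0P -> := hc.1; rewrite addn0 in sk.
  have hfs : hcovec P k (wedges fs) by rewrite -sk; exact: hcovec_wedges.
  rewrite wedgeZr wedge1r T1Z // T2Z //; congr (_ * _).
  by rewrite w1 ?w2 ?sk.
have hk i : hcovec P k (wedge (wedges fs) (wedge (icov (Y i) sg) (icov (X i) c))).
  rewrite -sk; apply: hcovec_wedge; first exact: hcovec_wedges.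
  exact: (hcovec_wedge (icov_sg _) (hcovec_icov _ hc)).
have -> : c = j.+1%:R^-1 *: \sum_i wedge (icov (Y i) sg) (icov (X i) c).
  by rewrite (euler hc) scalerA mulVf ?scale1r // pnatr_eq0.
rewrite wedgeZr wedge_sumr.
have [hs es] : hcovec P k (\sum_i wedge (wedges fs) (wedge (icov (Y i) sg) (icov (X i) c)))
  /\ S1 (\sum_i wedge (wedges fs) (wedge (icov (Y i) sg) (icov (X i) c))) a =
     S2 (\sum_i wedge (wedges fs) (wedge (icov (Y i) sg) (icov (X i) c))) a.
  apply: (big_rec (fun x => hcovec P k x /\ S1 x a = S2 x a)) => [|i x _ [hx ex]].
    by split; [exact: hcovec0|rewrite T10 T20].
  split; first exact: hcovecD.
  rewrite -[X in X + _]scale1r (lin1 k) // (lin2 k) // ex !mul1r; congr (_ + _).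
  rewrite wedgeA -wedges_rcons; apply: IHj; last by rewrite size_rcons; lia.
    move=> f; rewrite mem_rcons inE => /orP[/eqP->|]; [exact: icov_sg|exact: fsP].
  exact: hcovec_icov.
by rewrite T1Z // T2Z // es.
Qed.

Lemma sformE k b a : hcovec P k b -> hcovec P k a ->
  sform P sg b a = frame_form k b a.
Proof.
move=> hb ha; rewrite -(total_formE a hb) /sform /sharp.
apply: (is_sharp_unique _ total_form_is_sharp hb ha).
exact: (xgetPex (fun _ _ => 0) (ex_intro _ _ total_form_is_sharp)).
Qed.

Lemma frame_form_nondeg k x : hcovec P k x ->
  (forall b, hcovec P k b -> frame_form k b x = 0) -> x = 0.
Proof.
elim: k x => [|k IHk] x hx xP.
  have := xP _ (hcovec1 P); rewrite frame_form0 /covec1 mul1r => x0.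
  by have /altform0P -> := hx.1; rewrite x0 scale0r.
apply: covec_ext => [|u]; first by rewrite (altform_size hx.1).
apply: (IHk _ (hcovec_icov u hx)) => b hb.
by rewrite -frame_form_wedgel // xP //; exact: (hcovec_wedge (icov_sg u)).
Qed.

(* The sign [(-1)^(k (k + 1) / 2)] that relates [weyl n k] to the star. *)
Fixpoint star_sign (k : nat) : R :=
  if k is k'.+1 then (-1) ^+ k * star_sign k' else 1.

Lemma star_sign_neq0 k : star_sign k != 0.
Proof. by elim: k => [|k IHk] /=; rewrite ?oner_neq0 // mulf_neq0 // signr_eq0. Qed.

Lemma wedge_weyl k b a : hcovec P k a -> hcovec P k b ->
  wedge b (star_sign k *: S k a) = frame_form k b a *: liouville n sg.
Proof.
have vol : liouville n sg = S 0 (@covec1 R m) by rewrite weyl1.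
rewrite vol => ha; move: k a ha b.
apply: hcovec_ind => [k r a a' ha ha' Qa Qa' b hb|b hb|k u a ha Qa b hb].
- rewrite weyl_lin scalerDr scalerA mulrC -scalerA linearP /=.
  transitivity (r *: (frame_form k b a *: S 0 (@covec1 R m)) +
                frame_form k b a' *: S 0 (@covec1 R m)).
    by congr (_ *: _ + _); [exact: Qa|exact: Qa'].
  by rewrite frame_form_linr scalerDl scalerA.
- have /altform0P -> := hb.1; rewrite scale1r wedgeZl wedge1l; congr (_ *: _).
  by rewrite frame_form0 !fctE scaleRE /covec1 !mulr1.
- have -> : Posz k.+1 = k%:Z + 1 by lia.
  have hs := hgr_weyl n%:Z (hgr_nat ha).
  rewrite (weyl_wedge u (hgr_nat ha)) (frame_form_wedger u hb ha).
  (* The product has degree (k+1) + (2n-k) = 2n+1. Contracting it with u moves the contraction from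
     S a to b, with the sign recorded in [star_sign]. *)
  have w0 : wedge b (S k a) = 0.
    by apply: (gr_bound gr (hgr_wedge hb hs)); lia.
  have := congr1 (icov u) w0; rewrite icov_wedge (sgcov_altform hb.1) wedgeZl.
  move/eqP; rewrite addrC addr_eq0 => /eqP e.
  rewrite wedgeZr /= mulrC -scalerA e scalerN -wedgeZr.
  by rewrite (Qa _ (hcovec_icov u hb)) scaleNr.
Qed.

Lemma star_atE k a : hcovec P k a -> star_at n P sg k a = star_sign k *: S k a.
Proof.
move=> ha; have [kn|kn] := leqP k n.*2; last first.
  rewrite (hcovec_bound kn ha) weyl0 scaler0 /star_at; case: xgetP => // g _ [l []].
  by lia.
have kl : (k + (n.*2 - k))%N = n.*2 by lia.
have hs : hcovec P (n.*2 - k) (S k a).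
  have := hgr_weyl n%:Z (hgr_nat ha).
  by have -> : 2 * n%:Z - k%:Z = (n.*2 - k)%N by lia.
apply: xget_unique => /= [|g [l [kl' hg gP]]].
  exists (n.*2 - k)%N; split=> //; first exact: hcovecZ.
  by move=> b hb; rewrite (wedge_weyl ha hb) (sformE hb ha).
have lE : l = (n.*2 - k)%N by lia.
rewrite lE in hg.
have hg' : hgr P (2 * n%:Z - k%:Z) g by have -> : 2 * n%:Z - k%:Z = (n.*2 - k)%N by lia.
(* Since S^2 is a non-zero scalar, any candidate g is [star_sign k] times S a' for some a'; c undoes
   that scalar and the sign. Nondegeneracy of [frame_form] then forces a' = a. *)
pose c := (-1) ^+ (n + absz (2 * n%:Z - k%:Z)%R) * (star_sign k)^-1.
have sk0 := star_sign_neq0 k.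
pose a' := c *: S (2 * n%:Z - k%:Z) g.
have ha' : hcovec P k a'.
  apply: hcovecZ; have := hgr_weyl n%:Z hg'.
  by have -> : 2 * n%:Z - (2 * n%:Z - k%:Z) = k by lia.
have ga' : g = star_sign k *: S k a'.
  have := weyl_weyl hg'; have -> : 2 * n%:Z - (2 * n%:Z - k%:Z) = k by lia.
  rewrite /a' weylZ => ->; rewrite !scalerA /c.
  by rewrite -mulrA [_ / _ * _]mulrAC -expr2 sqrr_sign mul1r mulfV // scale1r.
(* The volume form is S 1, and S maps it back to a non-zero multiple of 1. *)
have vol0 : liouville n sg != 0.
  apply/eqP => v0; have := weyl_weyl1; rewrite weyl1 -/(liouville n sg).
  rewrite [X in S _ X](_ : _ = 0) ?weyl0; last exact: v0.
  move/(congr1 (@^~ [::])); rewrite !fctE scaleRE mulr1 => /esym/eqP.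
  by rewrite signr_eq0.
have ff b : hcovec P k b -> frame_form k b a = frame_form k b a'.
  move=> hb; have := gP b hb; rewrite {1}ga' (wedge_weyl ha' hb) (sformE hb ha).
  by move/eqP; rewrite -subr_eq0 -scalerBl scaler_eq0 (negPf vol0) orbF subr_eq0 => /eqP.
suff -> : a = a' by [].
apply/eqP; rewrite -subr_eq0; apply/eqP.
have hd : hcovec P k (a - a').
  by rewrite addrC -scaleN1r; exact: hcovec_lin.
apply: (frame_form_nondeg hd) => b hb.
by rewrite addrC -scaleN1r frame_form_linr mulN1r ff // addNr.
Qed.
End Frames.

(** This allows an arbitrary frame at each point of the manifold in the definition of Lam, and a
    smooth one in chart computations. *)
Lemma lam_frame_indep (R : realType) (m n1 n2 : nat) (P : {vspace 'rV[R]_m})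
    (sg : covec R m) (X Y : 'I_n1.*2 -> 'rV[R]_m) (X' Y' : 'I_n2.*2 -> 'rV[R]_m) k a :
  presymplectic P sg -> frame P sg X Y -> frame P sg X' Y' -> hcovec P k a ->
  lam X Y a = lam X' Y' a.
Proof.
move=> hsg hfr hfr' ha; rewrite /lam; congr (_ *: _).
have ic (u : 'rV[R]_m) : exists j, hcovec P j (icov u a).
  case: k ha => [|k] ha; last by exists k; exact: hcovec_icov.
  by exists 0%N; rewrite (icov_altform0 _ ha.1); exact: hcovec0.
(* Expand both slots of [a] in the frame [X]; the coefficients recombine to
   [sg (Y i, Y l)] because [X'] and [Y'] are dual to each other. *)
transitivity (\sum_i \sum_l (sg [:: Y l; Y i]) *: icov (X i) (icov (X l) a)).
  apply: eq_bigr => i _.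
  rewrite (icov_frame hfr (Y i) ha) icov_sum; apply: eq_bigr => l _.
  by rewrite icovZ.
transitivity (\sum_j \sum_l \sum_i (sg [:: Y l; Y' j] * sg [:: Y i; X' j]) *:
    icov (X i) (icov (X l) a)); last first.
  apply: eq_bigr => j _; have [q hq] := ic (Y' j).
  rewrite (icov_frame hfr (X' j) hq).
  under [RHS]eq_bigr => i _ do
    rewrite (icov_frame hfr (Y' j) ha) icov_sum scaler_sumr.
  rewrite [RHS]exchange_big; apply: eq_bigr => l _; apply: eq_bigr => i _.
  by rewrite icovZ scalerA mulrC.
rewrite exchange_big [RHS]exchange_big /=; apply: eq_bigr => l _.
rewrite [RHS]exchange_big /=; apply: eq_bigr => i _.
rewrite -scaler_suml; congr (_ *: _).
rewrite (sg_mod hsg _ (hfr'.2 (Y l))) (sg_suml hsg).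
by apply: eq_bigr => j _; rewrite (sgC hsg (Y' j)) (sgC hsg (X' j)); ring.
Qed.

(** * Functions of class C^k *)

Section Derivatives.
Variables (R : realType) (V W : normedModType R).
Implicit Types (f g : V -> W).

Lemma near_eq_diff f g (x : V) : (\forall y \near x, f y = g y) ->
  differentiable f x -> differentiable g x.
Proof.
move=> fg df; have fgx : f x = g x := nbhs_singleton fg.
have dfc : continuous ('d f x) by exact: diff_continuous.
have dg : g \o shift x = cst (g x) + 'd f x +o_ (0 : V) id.
  apply/eqaddoP => e e0; have /eqaddoP/(_ e e0) := diff_locally df.
  apply: filter_app; have fg0 : \forall h \near (0 : V), f (h + x) = g (h + x).
    by move: fg; rewrite (near_shift 0 x) /=; apply: filter_app; near=> h; rewrite /= subr0.
  near=> h => /=; rewrite -fgx !fctE /=.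
  by rewrite (near fg0 h).
apply/diff_locallyP; split; last by rewrite (diff_unique dfc dg).
by rewrite (diff_unique dfc dg).
Unshelve. all: by end_near. Qed.

Lemma derive_linear f x : differentiable f x ->
  forall (c : R) u v, 'D_(c *: u + v) f x = c *: 'D_u f x + 'D_v f x.
Proof. by move=> df c u v; rewrite !deriveE // linearP. Qed.

Lemma derive_scale f x : differentiable f x ->
  forall (c : R) u, 'D_(c *: u) f x = c *: 'D_u f x.
Proof. by move=> df c u; rewrite !deriveE // linearZ. Qed.

Lemma derive_comp (U : normedModType R) (h : U -> V) f x v :
  differentiable h x -> differentiable f (h x) ->
  'D_v (f \o h) x = 'D_('D_v h x) f (h x).
Proof.
move=> dh df; have dfh := differentiable_comp dh df.
by rewrite (deriveE v dh) (deriveE _ df) (deriveE v dfh) (diff_comp dh df).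
Qed.
End Derivatives.

Section SmoothFunctions.
Variables (R : realType) (m : nat).
Implicit Types (U : set 'rV[R]_m) (x v : 'rV[R]_m).

Lemma Cn_sub (W : normedModType R) k U U' (f : 'rV[R]_m -> W) :
  U' `<=` U -> Cn k U f -> Cn k U' f.
Proof.
move=> UU; elim: k f => [|k IHk] f /=; first by move=> h x /UU; exact: h.
by move=> [h1 h2]; split=> [x /UU|v]; [exact: h1|exact/IHk].
Qed.

(** Derivatives in [Cn] are taken in the ambient space, so the class C^k makes sense on a single
    point; smoothness can then be checked near each point, in a chart chosen for it. *)
Lemma CnP (W : normedModType R) k U (f : 'rV[R]_m -> W) :
  Cn k U f <-> forall x, U x -> Cn k [set x] f.
Proof.
split=> [h x Ux|]; first by apply: Cn_sub h => y /= ->.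
elim: k f => [|k IHk] f h /=; first by move=> x Ux; exact: (h x Ux x erefl).
split=> [x Ux|v]; first by have [/(_ x erefl)] := h x Ux.
by apply: IHk => x Ux; have [_] := h x Ux; apply.
Qed.

Lemma near_open U x : open U -> U x -> \forall y \near x, U y.
Proof. by move=> oU Ux; apply: open_nbhs_nbhs. Qed.

Lemma Cn_ext (W : normedModType R) k U (f g : 'rV[R]_m -> W) : open U ->
  (forall x, U x -> f x = g x) -> Cn k U f -> Cn k U g.
Proof.
move=> oU; elim: k f g => [|k IHk] f g fg /=.
  move=> h x Ux; have fgn : \forall y \near x, f y = g y.
    by apply: filterS (near_open oU Ux).
  have fx : f y @[y --> x] --> f x := h x Ux.
  change (g y @[y --> x] --> g x); rewrite -(fg x Ux).
  by apply: cvg_trans fx; exact: (near_eq_cvg fgn).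
have fgn x : U x -> \forall y \near x, f y = g y.
  by move=> Ux; apply: filterS (near_open oU Ux).
move=> [h1 h2]; split=> [x Ux|v]; first exact: near_eq_diff (fgn x Ux) (h1 x Ux).
apply: IHk (h2 v) => x Ux; exact: near_eq_derive (fgn x Ux).
Qed.

Lemma Cn_pred (W : normedModType R) k U (f : 'rV[R]_m -> W) : Cn k.+1 U f -> Cn k U f.
Proof.
elim: k f => [|k IHk] f [h1 h2]; last by split=> // v; exact/IHk.
by move=> x Ux; exact/differentiable_continuous/h1.
Qed.

Lemma Cn_cst (W : normedModType R) k U (c : W) : Cn k U (fun=> c).
Proof.
elim: k c => [|k IHk] c /=; first by move=> x _; exact: cst_continuous.
split=> [x _|v]; first exact: differentiable_cst.
by have -> : (fun x => 'D_v (fun=> c) x) = (fun=> 0) by apply/funext => x; exact: derive_cst.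
Qed.

Lemma Cn_id k U : Cn k U (@idfun 'rV[R]_m).
Proof.
case: k => [|k] /=; first by move=> x _; exact: cvg_id.
split=> [x _|v]; first exact: ex_diff.
have -> : (fun x => 'D_v (@idfun 'rV[R]_m) x) = (fun=> v).
  by apply/funext => x; exact: derive_id.
exact: Cn_cst.
Qed.

Lemma Cn_lin (W : normedModType R) k U (c : R) (f g : 'rV[R]_m -> W) : open U ->
  Cn k U f -> Cn k U g -> Cn k U (fun x => c *: f x + g x).
Proof.
move=> oU; elim: k f g => [|k IHk] f g /=.
  move=> hf hg x Ux.
  exact: (continuousD (continuousZl_tmp (k := c) (hf x Ux)) (hg x Ux)).
move=> [hf1 hf2] [hg1 hg2]; split=> [x Ux|v].
  by apply: differentiableD; [exact: differentiableZ (hf1 x Ux)|exact: hg1].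
apply: (Cn_ext oU) (IHk _ _ (hf2 v) (hg2 v)) => x Ux.
have df := @diff_derivable _ _ _ _ _ v (hf1 x Ux); have dg := @diff_derivable _ _ _ _ _ v (hg1 x Ux).
by rewrite -[RHS]/('D_v (c *: f + g) x) deriveD ?deriveZ //; exact: derivableZ.
Qed.

Lemma CnD (W : normedModType R) k U (f g : 'rV[R]_m -> W) : open U ->
  Cn k U f -> Cn k U g -> Cn k U (fun x => f x + g x).
Proof.
move=> oU hf hg; apply: (Cn_ext oU) (Cn_lin 1 oU hf hg) => x _.
by rewrite scale1r.
Qed.

Lemma CnZ (W : normedModType R) k U (c : R) (f : 'rV[R]_m -> W) : open U ->
  Cn k U f -> Cn k U (fun x => c *: f x).
Proof.
move=> oU hf; apply: (Cn_ext oU) (Cn_lin c oU hf (Cn_cst k U 0)) => x _.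
by rewrite addr0.
Qed.

Lemma Cn_sum (W : normedModType R) k U (I : Type) (r : seq I) (P : pred I)
    (F : I -> 'rV[R]_m -> W) : open U ->
  (forall i, P i -> Cn k U (F i)) -> Cn k U (fun x => \sum_(i <- r | P i) F i x).
Proof.
move=> oU FP; elim: r => [|i r IHr].
  by apply: (Cn_ext oU) (Cn_cst k U 0) => x _; rewrite big_nil.
have [Pi|Pi] := boolP (P i).
  by apply: (Cn_ext oU) (CnD oU (FP i Pi) IHr) => x _; rewrite big_cons Pi.
by apply: (Cn_ext oU) IHr => x _; rewrite big_cons (negPf Pi).
Qed.

Lemma CnM k U (f g : 'rV[R]_m -> R) : open U ->
  Cn k U f -> Cn k U g -> Cn k U (fun x => f x * g x : R).
Proof.
move=> oU; elim: k f g => [|k IHk] f g.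
  by move=> hf hg x Ux; exact: (continuousM (hf x Ux) (hg x Ux)).
move=> hf hg; have [hf1 hf2] := hf; have [hg1 hg2] := hg; split=> [x Ux|v].
  by apply: differentiableM; [exact: hf1|exact: hg1].
have := CnD oU (IHk _ _ (Cn_pred hf) (hg2 v)) (IHk _ _ (Cn_pred hg) (hf2 v)).
apply: (Cn_ext oU) => x Ux.
have df := @diff_derivable _ _ _ _ _ v (hf1 x Ux); have dg := @diff_derivable _ _ _ _ _ v (hg1 x Ux).
exact: (esym (deriveM df dg)).
Qed.

Lemma Cn_prod k U (I : Type) (r : seq I) (F : I -> 'rV[R]_m -> R) : open U ->
  (forall i, Cn k U (F i)) -> Cn k U (fun x => \prod_(i <- r) F i x).
Proof.
move=> oU FP; elim: r => [|i r IHr].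
  by apply: (Cn_ext oU) (Cn_cst k U (1 : R)) => x _; rewrite big_nil.
by apply: (Cn_ext oU) (CnM oU (FP i) IHr) => x _; rewrite big_cons.
Qed.

Lemma Cn_inv k U (f : 'rV[R]_m -> R) : open U -> (forall x, U x -> f x != 0) ->
  Cn k U f -> Cn k U (fun x => (f x)^-1 : R).
Proof.
move=> oU f0; elim: k => [|k IHk].
  by move=> hf x Ux; exact: (continuousV (f0 x Ux) (hf x Ux)).
move=> hf; have [hf1 hf2] := hf; split=> [x Ux|v].
  by apply: differentiableV; [exact: hf1|exact: f0].
have Vk := IHk (Cn_pred hf).
have := CnZ (-1) oU (CnM oU (CnM oU Vk Vk) (hf2 v)).
apply: (Cn_ext oU) => x Ux.
have df := @diff_derivable _ _ _ _ _ v (hf1 x Ux).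
rewrite -[RHS]/('D_v (fun y => (f y)^-1) x) (deriveV (f0 x Ux) df).
by rewrite !scaleRE expr2 invfM; ring.
Qed.

End SmoothFunctions.

Section Coordinates.
Variables (R : realType) (m p : nat).
Implicit Types (U : set 'rV[R]_m) (x v : 'rV[R]_m).

Definition coordf (j : 'I_p) (N : 'rV[R]_p) : R := N ord0 j.

Lemma coordf_linear j : linear (coordf j).
Proof. by move=> c M N; rewrite /coordf !mxE. Qed.

HB.instance Definition _ j :=
  GRing.isLinear.Build R 'rV[R]_p R _ (coordf j) (coordf_linear j).

Lemma coordf_continuous j : continuous (coordf j).
Proof. exact: coord_continuous. Qed.

Lemma derive_coordf j M w : 'D_w (coordf j) M = w ord0 j.
Proof.
have df : differentiable (coordf j) M by exact/linear_differentiable/coordf_continuous.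
by rewrite (deriveE w df) diff_lin //; exact: coordf_continuous.
Qed.

Lemma Cn_coord k U (f : 'rV[R]_m -> 'rV[R]_p) j :
  open U -> Cn k U f -> Cn k U (fun x => f x ord0 j : R).
Proof.
move=> oU; elim: k f => [|k IHk] f.
  move=> hf x Ux; apply: (@continuous_comp _ _ _ f (coordf j)); first exact: hf.
  exact: coordf_continuous.
have df M : differentiable (coordf j) M by exact/linear_differentiable/coordf_continuous.
move=> [hf1 hf2]; split=> [x Ux|v].
  by apply: (@differentiable_comp _ _ _ _ f (coordf j)); [exact: hf1|exact: df].
apply: (Cn_ext oU) (IHk _ (hf2 v)) => x Ux.
by rewrite -(derive_coordf j (f x)); exact: esym (derive_comp v (hf1 x Ux) (df _)).
Qed.

Lemma derive_coord (f : 'rV[R]_m -> 'rV[R]_p) j x v : differentiable f x ->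
  'D_v (fun y => f y ord0 j : R) x = 'D_v f x ord0 j.
Proof.
move=> df; have dc M : differentiable (coordf j) M by exact/linear_differentiable/coordf_continuous.
by rewrite -(derive_coordf j (f x)); exact: derive_comp v df (dc _).
Qed.

Lemma Cn_scale k U (W : normedModType R) (h : 'rV[R]_m -> R) (w : W) :
  open U -> Cn k U h -> Cn k U (fun x => h x *: w).
Proof.
move=> oU; elim: k h => [|k IHk] h.
  by move=> hh x Ux; apply: (@continuousZr_tmp _ _ _ h w); exact: hh.
move=> [hf1 hf2]; split=> [x Ux|v]; first by apply: differentiableZl; exact: hf1.
apply: (Cn_ext oU) (IHk _ (hf2 v)) => x Ux.
have dh := hf1 x Ux; rewrite (deriveE _ dh) deriveE; last exact: differentiableZl.
by rewrite diffZl.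
Qed.

Lemma Cn_row k U (f : 'rV[R]_m -> 'rV[R]_p) : open U ->
  (forall j, Cn k U (fun x => f x ord0 j : R)) -> Cn k U f.
Proof.
move=> oU hf; apply: (Cn_ext oU)
  (Cn_sum (index_enum _) (P := predT) oU (fun j _ => Cn_scale (delta_mx 0 j : 'rV[R]_p) oU (hf j))) => x _.
by rewrite [RHS]row_sum_delta.
Qed.

Lemma derive_delta (W : normedModType R) (g : 'rV[R]_p -> W) (y w : 'rV[R]_p) :
  differentiable g y ->
  'D_w g y = \sum_j w ord0 j *: 'D_(delta_mx 0 j) g y.
Proof.
move=> dg; rewrite {1}[w]row_sum_delta deriveE // linear_sum.
by apply: eq_bigr => j _; rewrite linearZ /= deriveE.
Qed.

Lemma Cn_comp k U (U' : set 'rV[R]_p) (f : 'rV[R]_m -> 'rV[R]_p) (g : 'rV[R]_p -> R) :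
  open U -> (forall x, U x -> U' (f x)) ->
  Cn k U f -> Cn k U' g -> Cn k U (fun x => g (f x) : R).
Proof.
move=> oU fU; elim: k f fU g => [|k IHk] f fU g.
  move=> hf hg x Ux; apply: (@continuous_comp _ _ _ f g); first exact: hf.
  exact/hg/fU.
move=> hf hg; have [hf1 hf2] := hf; have [hg1 hg2] := hg; split=> [x Ux|v].
  by apply: (@differentiable_comp _ _ _ _ f g); [exact: hf1|exact/hg1/fU].
have h j : Cn k U (fun x => 'D_v f x ord0 j * 'D_(delta_mx 0 j) g (f x) : R).
  apply: (CnM oU); first exact: Cn_coord (hf2 v).
  exact: (IHk f fU ('D_(delta_mx 0 j) g) (Cn_pred hf) (hg2 _)).
apply: (Cn_ext oU) (Cn_sum (index_enum _) (P := predT) oU (fun j _ => h j)) => x Ux.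
have dg := hg1 _ (fU _ Ux).
by rewrite -(derive_delta _ dg); exact: esym (derive_comp v (hf1 x Ux) dg).
Qed.
End Coordinates.

Lemma Cn_comp_row (R : realType) (m p q k : nat) (U : set 'rV[R]_m) (U' : set 'rV[R]_p)
    (f : 'rV[R]_m -> 'rV[R]_p) (g : 'rV[R]_p -> 'rV[R]_q) :
  open U -> open U' -> (forall x, U x -> U' (f x)) ->
  Cn k U f -> Cn k U' g -> Cn k U (fun x => g (f x)).
Proof.
move=> oU oU' fU hf hg; apply: Cn_row => // j.
apply: (Cn_comp (g := fun y => g y ord0 j) oU fU hf).
exact: Cn_coord.
Qed.

(** * Symmetry of second derivatives *)

Section SecondDerivatives.
Variables (R : realType) (m : nat).
Implicit Types (U : set 'rV[R]_m) (x u v : 'rV[R]_m).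

Lemma is_derive_line (f : 'rV[R]_m -> R) (q u : 'rV[R]_m) (s : R) :
  differentiable f (q + s *: u) ->
  is_derive s 1 (fun t => f (q + t *: u)) ('D_u f (q + s *: u)).
Proof.
move=> df; pose l (t : R) := q + t *: u.
have dl : is_diff s l (fun t => 0 + t *: u).
  by apply: is_diffD.
have dll : differentiable l s by exact: ex_diff.
have Dl : 'D_1 l s = u by rewrite (deriveE _ dll) diff_val /= add0r scale1r.
split; first by apply: diff_derivable; exact: (differentiable_comp dll df).
by have e := @derive_comp _ _ _ _ l f s (1 : R) dll df; rewrite Dl in e.
Qed.

Lemma mean_value (f df : R -> R) (h : R) : 0 < h ->
  (forall s : R, 0 <= s <= h -> is_derive s 1 f (df s)) ->
  exists2 c : R, 0 <= c <= h & f h - f 0 = df c * h.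
Proof.
move=> h0 hf; have [|s sh||c ch ec] := @MVT_segment R f df 0 h; first exact: ltW.
- by apply: hf; move: sh; rewrite in_itv /= => /andP[/ltW -> /ltW ->].
- apply: derivable_within_continuous => s; rewrite in_itv /= => sh.
  by have [] := hf s sh.
- by exists c; [move: ch; rewrite in_itv|rewrite ec subr0].
Qed.

Lemma second_difference (f : 'rV[R]_m -> R) x u v (h : R) : 0 < h ->
  (forall s t : R, 0 <= s <= h -> 0 <= t <= h ->
     differentiable f (x + s *: u + t *: v) /\
     differentiable ('D_u f) (x + s *: u + t *: v)) ->
  exists s t : R, [/\ 0 <= s <= h, 0 <= t <= h &
    f (x + h *: u + h *: v) - f (x + h *: u) - (f (x + h *: v) - f x) =
    h * h * 'D_v ('D_u f) (x + s *: u + t *: v)].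
Proof.
move=> h0 hf; have hh : 0 <= h <= h by rewrite lexx ltW.
have h00 : 0 <= (0 : R) <= h by rewrite lexx ltW.
pose phi (s : R) := f (x + h *: v + s *: u) - f (x + s *: u).
have dphi (s : R) : 0 <= s <= h -> is_derive s 1 phi
    ('D_u f (x + h *: v + s *: u) - 'D_u f (x + s *: u)).
  move=> sh; apply: is_deriveB.
    by apply: is_derive_line; rewrite addrAC; exact: (hf s h sh hh).1.
  by apply: is_derive_line; have := (hf s 0 sh h00).1; rewrite scale0r addr0.
have [c ch ec] := mean_value h0 dphi.
pose psi (t : R) := 'D_u f (x + c *: u + t *: v).
have dpsi (t : R) : 0 <= t <= h ->
    is_derive t 1 psi ('D_v ('D_u f) (x + c *: u + t *: v)).
  by move=> th; apply: is_derive_line; exact: (hf c t ch th).2.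
have [t th et] := mean_value h0 dpsi.
exists c, t; split=> //.
have -> : f (x + h *: u + h *: v) - f (x + h *: u) - (f (x + h *: v) - f x) = phi h - phi 0.
  by rewrite /phi scale0r !addr0 [x + h *: u + _]addrAC.
rewrite ec; move: et; rewrite /psi scale0r !addr0 [x + c *: u + _]addrAC.
by move=> ->; ring.
Qed.

Lemma common_ball (V : normedModType R) (U : set V) (f g : V -> R) (x : V) (e : R) :
  open U -> U x -> 0 < e -> {for x, continuous f} -> {for x, continuous g} ->
  exists2 r : R, 0 < r & forall y, ball x r y ->
    [/\ U y, `|f x - f y| < e & `|g x - g y| < e].
Proof.
move=> oU Ux e0 /cvgrPdist_lt/(_ _ e0) cf /cvgrPdist_lt/(_ _ e0) cg.
have nU : \forall y \near x, U y by apply: open_nbhs_nbhs.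
have Fx := nbhs_filter x.
have /nbhs_ballP[r r0 rP] := @filterI _ _ Fx _ _ nU (@filterI _ _ Fx _ _ cf cg).
by exists r => // y /rP[? []].
Qed.

(** The second difference is symmetric in u and v, so by the mean value theorem each mixed
    derivative at some nearby point equals the other one at another; continuity concludes. *)
Lemma derive_sym U (f : 'rV[R]_m -> R) x u v : open U -> U x -> Cn 2 U f ->
  'D_u ('D_v f) x = 'D_v ('D_u f) x.
Proof.
move=> oU Ux [f1 f2].
have cA : {for x, continuous ('D_u ('D_v f))} by exact: (f2 v).2.
have cB : {for x, continuous ('D_v ('D_u f))} by exact: (f2 u).2.
apply/eqP; rewrite -subr_eq0 -normr_eq0 eq_le normr_ge0 andbT.
apply/ler_addgt0Pr => e e0; rewrite add0r.
have e20 : 0 < e / 2 by rewrite divr_gt0.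
have [r r0 rP] := common_ball oU Ux e20 cA cB.
(* The summand 1 keeps N positive when u = v = 0; with h = r / (2N) the parallelogram on h u and h v
   stays in the ball of radius r. *)
pose N := `|u| + `|v| + 1.
have N0 : 0 < N by rewrite ltr_wpDl // addr_ge0.
pose h := r / N / 2.
have h0 : 0 < h by rewrite !divr_gt0.
have inB s t : 0 <= s <= h -> 0 <= t <= h -> ball x r (x + s *: u + t *: v).
  move=> /andP[s0 sh] /andP[t0 th]; rewrite -ball_normE /ball_ /= -addrA opprD addNKr normrN.
  rewrite (le_lt_trans (ler_normD _ _)) // !normrZ !ger0_norm //.
  apply: (@le_lt_trans _ _ (h * N)).
    by rewrite /N mulrDr mulr1 mulrDr ler_wpDr ?(ltW h0) // lerD // ler_wpM2r.
  by rewrite /h mulrAC divfK ?gt_eqF // ltr_pdivrMr // ltr_pMr // ltr1n.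
have [|s [t [sh th e1]]] := @second_difference f x u v h h0.
  move=> s t sh th; have [Uy _ _] := rP _ (inB _ _ sh th).
  by split; [exact: f1|exact: (f2 u).1].
have [|s' [t' [sh' th' e2]]] := @second_difference f x v u h h0.
  move=> s' t' sh' th'; have [Uy _ _] := rP _ (inB _ _ th' sh').
  by rewrite addrAC; split; [exact: f1|exact: (f2 v).1].
have [_ _ B1] := rP _ (inB _ _ sh th).
have [_ A1 _] := rP _ (inB _ _ th' sh').
have hh : h * h != 0 by rewrite mulf_neq0 // gt_eqF.
rewrite [x + s' *: v + _]addrAC [x + h *: v + h *: u]addrAC in e2.
move: ('D_u ('D_v f) (x + t' *: u + s' *: v)) e2 A1 => A e2 A1.
move: ('D_v ('D_u f) (x + s *: u + t *: v)) e1 B1 => B e1 B1.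
have E : A = B by apply: (mulfI hh); rewrite -e1 -e2; ring.
move: ('D_u ('D_v f) x) ('D_v ('D_u f) x) A1 B1 => A0 B0; rewrite E => A1 B1.
rewrite -[A0 - B0](subrKA B) (le_trans (ler_normD _ _)) // [e]splitr lerD // ?(ltW A1) //.
by rewrite distrC ltW.
Qed.
End SecondDerivatives.

(** * Smooth bump functions *)

Section Bump.
Variable R : realType.

(** The functions t^(-j) exp(-1/t), extended by 0. The derivative of one is a linear combination of
    two others, so a single induction proves all of them smooth. *)
Definition flat (j : nat) (t : R) : R :=
  if 0 < t then t ^- j * expR (- t^-1) else 0.

(** One term of the exponential series at 1/t dominates t^(-j-2). The quadratic bound makes the
    derivative at 0 vanish. *)
Lemma flat_bound j (t : R) : 0 < t -> 0 <= flat j t <= j.+2`!%:R * t ^+ 2.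
Proof.
move=> t0; rewrite /flat t0; apply/andP; split.
  by rewrite mulr_ge0 ?expR_ge0 // invr_ge0 exprn_ge0 // ltW.
have x0 : 0 < t^-1 by rewrite invr_gt0.
have f0 : 0 < j.+2`!%:R :> R by rewrite ltr0n fact_gt0.
rewrite expRN ler_pdivrMr ?expR_gt0 //.
have := expR_ge1Dxn j.+1 (ltW x0).
move=> /(le_trans _) => /(_ (t^-1 ^+ j.+2 / j.+2`!%:R)) h.
have {}h : t^-1 ^+ j.+2 / j.+2`!%:R <= expR t^-1 by apply: h; rewrite lerDr.
apply: (@le_trans _ _ (j.+2`!%:R * t ^+ 2 * (t^-1 ^+ j.+2 / j.+2`!%:R))).
  rewrite -exprVn; have -> : j.+2 = (2 + j)%N by [].
  rewrite exprD !exprVn mulrA [_ * (_ * _)]mulrA [X in _ <= X]mulrC.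
  rewrite -[j.+2`!%:R * _ * _]mulrA divff ?mulr1; last by rewrite expf_neq0 // gt_eqF.
  by rewrite mulrA mulVf ?mul1r // gt_eqF.
by rewrite ler_wpM2l // mulr_ge0 ?ltW // exprn_gt0.
Qed.

Lemma is_derive_flat j (t : R) :
  is_derive t 1 (flat j) (- j%:R * flat j.+1 t + flat j.+2 t).
Proof.
have [t0|t0|<-] := ltgtP 0 t.
- pose g (s : R) : R := s^-1 ^+ j * expR (- s^-1).
  have fg : \forall s \near t, g s = flat j s.
    near=> s; have s0 : 0 < s by near: s; exact: lt_nbhsr.
    by rewrite /flat s0 /g exprVn.
  apply: (near_eq_is_derive fg).
  have tn0 : t != 0 by rewrite gt_eqF.
  have dV : is_derive t 1 (fun s : R => s^-1) (- t ^- 2 *: 1) by exact: is_deriveV.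
  have dE : is_derive t 1 (fun s : R => expR (- s^-1)) (expR (- t^-1) * t ^- 2).
    have dN := is_deriveN dV.
    have dC := @is_derive1_comp R expR (fun s => - s^-1) t _ _ (is_derive_expR _) dN.
    apply: (is_derive_eq dC).
    by rewrite scaleNr opprK scaleRE mulr1.
  have dX := is_deriveX j dV.
  have -> : g = (fun s => s^-1) ^+ j * (fun s => expR (- s^-1)).
    by apply/funext => s; rewrite /g fctE exprfctE.
  apply: (is_derive_eq (is_deriveM dX dE)).
  rewrite /flat t0 !scaleRE mulr1.
  rewrite exprfctE; move: (expR (- t^-1)) => E.
  rewrite -(exprVn t 2) -(exprVn t j.+1) -(exprVn t j.+2); move: (t^-1) => x.
  by case: j {g fg dX} => [|j]; rewrite /= !exprS !expr0; ring.
- have fg : \forall s \near t, (fun=> 0) s = flat j s.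
    near=> s; have s0 : s < 0 by near: s; exact: lt_nbhsl.
    by rewrite /flat ltNge (ltW s0).
  rewrite /flat !ltNge (ltW t0) /= mulr0 addr0.
  exact: (near_eq_is_derive fg).
have h : (fun h : R => h^-1 *: ((flat j \o shift 0) (h *: 1) - flat j 0)) @ 0^' --> (0 : R).
  apply/cvgr0Pnorm_le => e e0; near=> h.
  have h0 : h != 0 by near: h; exact: nbhs_dnbhs_neq.
  rewrite /= addr0 !scaleRE mulr1 {2}/flat ltxx subr0.
  have [hp|hn] := ltP 0 h; last by rewrite /flat ltNge hn /= mulr0 normr0 ltW.
  have /andP[f0 fb] := flat_bound j hp.
  rewrite ger0_norm; last by rewrite mulr_ge0 // invr_ge0 ltW.
  apply: (@le_trans _ _ (j.+2`!%:R * h)).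
    by rewrite mulrC ler_pdivrMr // -mulrA -expr2.
  rewrite -ler_pdivlMl ?ltr0n ?fact_gt0 //.
  have : `|h| <= j.+2`!%:R^-1 * e.
    near: h; apply: dnbhs0_le; rewrite mulr_gt0 // invr_gt0 ltr0n fact_gt0 //.
  by rewrite gtr0_norm.
rewrite /flat ltxx mulr0 addr0; split; first by apply/cvg_ex; exists 0.
exact: cvg_lim h.
Unshelve. all: by end_near. Qed.

Variable m : nat.
Implicit Types (U : set 'rV[R]_m) (x v : 'rV[R]_m).

Lemma Cn_flat k j U (g : 'rV[R]_m -> R) : open U -> Cn k U g ->
  Cn k U (fun x => flat j (g x)).
Proof.
move=> oU; have df i t : differentiable (flat i) t.
  by apply/derivable1_diffP; have [] := is_derive_flat i t.
elim: k j g => [|k IHk] j g.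
  move=> hg x Ux; apply: (@continuous_comp _ _ _ g (flat j)); first exact: hg.
  exact/differentiable_continuous/df.
move=> hg; have [hg1 hg2] := hg; split=> [x Ux|v].
  by apply: (@differentiable_comp _ _ _ _ g (flat j)); [exact: hg1|exact: df].
have h i : Cn k U (fun x => flat i (g x)) := IHk i g (Cn_pred hg).
apply: (Cn_ext oU) (CnM oU (Cn_lin (- j%:R) oU (h j.+1) (h j.+2)) (hg2 v)) => x Ux.
have := derive_comp v (hg1 x Ux) (df j (g x)) => /= ->.
move: ('D_v g x) => w; have := derive_scale (df j (g x)) w 1.
have [_ ->] := is_derive_flat j (g x); rewrite !scaleRE mulr1 => ->.
by rewrite mulrC.
Qed.

(** The squared Euclidean distance is polynomial, hence smooth; it dominates the square of the
    maximum norm, which is the norm on rows, so the support lies in the ball of radius r. *)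
Definition bump_fun (c : 'rV[R]_m) (r : R) (y : 'rV[R]_m) : R :=
  flat 0 (r ^+ 2 - \sum_j (y ord0 j - c ord0 j) ^+ 2).

Lemma bump_smooth c r U : open U -> smooth_on U (bump_fun c r).
Proof.
move=> oU k; apply: Cn_flat => //; apply: CnD => //; first exact: Cn_cst.
have h j : Cn k U (fun y => y ord0 j - c ord0 j : R).
  apply: CnD => //; last exact: Cn_cst.
  by apply: Cn_coord => //; exact: Cn_id.
apply: (Cn_ext oU) (CnZ (-1) oU (Cn_sum (index_enum _) (P := predT) oU
  (fun j _ => CnM oU (h j) (h j)))) => y _.
by rewrite scaleN1r.
Qed.

Lemma bump_center c r : 0 < r -> bump_fun c r c != 0.
Proof.
move=> r0; rewrite /bump_fun big1 => [|j _]; last by rewrite subrr expr0n.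
by rewrite subr0 /flat exprn_gt0 // expr0 invr1 mul1r gt_eqF // expR_gt0.
Qed.

Lemma bump_support c r y : 0 < r -> bump_fun c r y != 0 -> `|c - y| <= r.
Proof.
move=> r0; rewrite /bump_fun /flat; case: ltP => [yr _|_]; last by rewrite eqxx.
have hs j : (y ord0 j - c ord0 j) ^+ 2 <= r ^+ 2.
  rewrite subr_gt0 in yr; apply: (le_trans _ (ltW yr)).
  by rewrite (bigD1 j) //= lerDl sumr_ge0 // => i _; exact: sqr_ge0.
rewrite /Num.norm /= mx_normrE; apply: bigmax_le; first exact: ltW.
move=> [i j] _ /=; rewrite ord1 !mxE distrC.
by rewrite -(ler_pXn2r (n := 2)) ?nnegrE ?normr_ge0 ?(ltW r0) // real_normK ?num_real.
Qed.
End Bump.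

(** * Differential forms on open sets of R^m *)

Section RealDerivatives.
Variables (R : realType) (V : normedModType R).
Implicit Types (f g : V -> R) (x v : V).

Lemma derive_real_lin f g x v (c : R) : differentiable f x -> differentiable g x ->
  'D_v (fun z => c * f z + g z : R) x = c * 'D_v f x + 'D_v g x.
Proof.
move=> df dg; have df' : derivable f x v by exact: diff_derivable.
have dg' : derivable g x v by exact: diff_derivable.
have dcf : derivable (c *: f) x v by exact: derivableZ.
exact: (etrans (deriveD dcf dg') (congr1 (fun w : R => w + 'D_v g x) (deriveZ c df'))).
Qed.

Lemma derive_real_scale f x v (c : R) : differentiable f x ->
  'D_v (fun z => c * f z : R) x = c * 'D_v f x.
Proof. by move=> df; apply: (@deriveZ _ _ _ f c); exact: diff_derivable. Qed.

Lemma derive_real_mul f g x v : differentiable f x -> differentiable g x ->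
  'D_v (fun z => f z * g z : R) x = 'D_v f x * g x + f x * 'D_v g x.
Proof.
move=> df dg; have df' : derivable f x v by exact: diff_derivable.
have dg' : derivable g x v by exact: diff_derivable.
by rewrite addrC [_ * g x]mulrC; exact: (deriveM df' dg').
Qed.

Lemma diff_real_sum (I : Type) (r : seq I) (F : I -> V -> R) x :
  (forall i, differentiable (F i) x) ->
  differentiable (fun z => \sum_(i <- r) F i z : R) x.
Proof.
move=> dF; elim: r => [|i r IHr].
  have -> : (fun z => \sum_(i <- [::]) F i z : R) = cst 0.
    by apply/funext => z; rewrite big_nil.
  exact: differentiable_cst.
have -> : (fun z => \sum_(i <- i :: r) F i z : R) = (F i + fun z => \sum_(i <- r) F i z).
  by apply/funext => z; rewrite big_cons.
by apply: (differentiableD (dF i) IHr).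
Qed.

Lemma derive_real_sum (I : Type) (r : seq I) (F : I -> V -> R) x v :
  (forall i, differentiable (F i) x) ->
  'D_v (fun z => \sum_(i <- r) F i z : R) x = \sum_(i <- r) 'D_v (F i) x.
Proof.
move=> dF; elim: r => [|i r IHr].
  rewrite big_nil; have -> : (fun z => \sum_(i <- [::]) F i z : R) = cst 0.
    by apply/funext => z; rewrite big_nil.
  exact: derive_cst.
rewrite big_cons -IHr.
have -> : (fun z => \sum_(i <- i :: r) F i z : R) =
    (fun z => 1 * F i z + \sum_(i <- r) F i z).
  by apply/funext => z; rewrite big_cons mul1r.
by rewrite (derive_real_lin _ _ (dF i) (diff_real_sum r dF)) mul1r.
Qed.
End RealDerivatives.

(** * Exterior derivative, pullback and Cartan's formula in coordinates *)

Section EuclideanForms.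
Variables (R : realType) (m : nat).
Implicit Types (U : set 'rV[R]_m) (y z u v : 'rV[R]_m) (s : seq 'rV[R]_m).
Implicit Types (a c : covec R m) (b : 'rV[R]_m -> covec R m).

Definition dE b y : covec R m := fun s => \sum_(i < size s) (-1) ^+ i *
  'D_(s`_i) (fun z => b z (take i s ++ drop i.+1 s) : R) y.

Definition derivF v b y : covec R m := fun s => 'D_v (fun z => b z s : R) y.

Definition diffF b y := forall s, differentiable (fun z => b z s : R) y.

Definition smoothF U b := forall s, smooth_on U (fun z => b z s : R).

Lemma dE_nil b y : dE b y [::] = 0.
Proof. by rewrite /dE big_ord0. Qed.

(** Cartan's formula for a constant vector field, which drives the inductions on the arguments. *)
Lemma dE_cons b y v s :
  dE b y (v :: s) = derivF v b y s - dE (fun z => icov v (b z)) y s.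
Proof.
rewrite /dE /= big_ord_recl /= expr0 mul1r drop0 -sumrN; congr (_ + _).
by apply: eq_bigr => i _; rewrite /bump /= exprS mulN1r mulNr.
Qed.

Lemma icov_dE b y v : icov v (dE b y) = derivF v b y - dE (fun z => icov v (b z)) y.
Proof. by apply/funext => s; exact: dE_cons. Qed.

Lemma dE_lin b b' y (r : R) s : diffF b y -> diffF b' y ->
  dE (fun z => r *: b z + b' z) y s = r * dE b y s + dE b' y s.
Proof.
move=> db db'; rewrite /dE mulr_sumr -big_split /=; apply: eq_bigr => i _.
by rewrite (derive_real_lin _ _ (db _) (db' _)); ring.
Qed.

Lemma near_eq_dE b b' y : (\forall z \near y, b z = b' z) -> dE b y = dE b' y.
Proof.
move=> bb; apply/funext => s; apply: eq_bigr => i _; congr (_ * _).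
by apply: near_eq_derive; apply: filterS bb => z ->.
Qed.

Lemma smoothF_diff U b y : smoothF U b -> U y -> diffF b y.
Proof. by move=> sb Uy s; have [/(_ y Uy)] := sb s 1%N. Qed.

Lemma smoothF_derivF U b v : smoothF U b -> smoothF U (derivF v b).
Proof. by move=> sb s k; have [_] := sb s k.+1; apply. Qed.

Lemma smoothF_icov U b v : smoothF U b -> smoothF U (fun z => icov v (b z)).
Proof. by move=> sb s; exact: sb. Qed.

Lemma smoothF_dE U b : open U -> smoothF U b -> smoothF U (dE b).
Proof.
move=> oU sb s k; apply: Cn_sum => // i _; apply: CnM => //; first exact: Cn_cst.
by have [_] := sb (take i s ++ drop i.+1 s) k.+1; apply.
Qed.

Lemma derivF_dE U b y v : open U -> U y -> smoothF U b ->
  derivF v (dE b) y = dE (derivF v b) y.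
Proof.
move=> oU Uy sb; apply/funext => s; rewrite /derivF.
have ds i : differentiable ('D_(s`_i) (fun z => b z (take i s ++ drop i.+1 s) : R)) y.
  by have [_ /(_ s`_i)[/(_ y Uy)]] := sb (take i s ++ drop i.+1 s) 2%N.
rewrite /dE derive_real_sum => [|i]; last exact: (differentiableZ ((-1) ^+ i)) (ds i).
apply: eq_bigr => i _; apply: (etrans (derive_real_scale v ((-1) ^+ i) (ds i))).
exact: (congr1 (fun w : R => (-1) ^+ i * w) (derive_sym v s`_i oU Uy (sb _ 2%N))).
Qed.

(** Contracting with v leaves D_v d b - d D_v b, zero by symmetry of second derivatives, and d d of
    the contraction of b, zero by induction. *)
Lemma dEdE U b y : open U -> U y -> smoothF U b -> dE (dE b) y = 0.
Proof.
move=> oU Uy sb; apply/funext => s; change (dE (dE b) y s = 0).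
elim: s b sb => [|v s IHs] b sb; first exact: dE_nil.
have sbv := smoothF_icov v sb.
rewrite dE_cons (derivF_dE v oU Uy sb).
have -> : (fun z => icov v (dE b z)) =
    (fun z => (-1) *: dE (fun z => icov v (b z)) z + derivF v b z).
  by apply/funext => z; rewrite icov_dE scaleN1r addrC.
rewrite dE_lin; first by rewrite (IHs _ sbv) mulr0 add0r subrr.
  exact: smoothF_diff (smoothF_dE oU sbv) Uy.
exact: smoothF_diff (smoothF_derivF v sb) Uy.
Qed.

Lemma diffF_icov b y v : diffF b y -> diffF (fun z => icov v (b z)) y.
Proof. by move=> db s; exact: db. Qed.

Lemma diffF_sgcov b y : diffF b y -> diffF (fun z => sgcov (b z)) y.
Proof. by move=> db s; apply: (differentiableZ ((-1) ^+ size s)) (db s). Qed.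

Lemma diffF_wedge b b' y : diffF b y -> diffF b' y -> diffF (fun z => wedge (b z) (b' z)) y.
Proof.
move=> db db' s; elim: s b b' db db' => [|v s IHs] b b' db db'.
  have -> : (fun z => wedge (b z) (b' z) [::]) = (fun z => b z [::] * b' z [::]).
    by apply/funext => z; rewrite wedge_nil.
  exact: differentiableM.
have -> : (fun z => wedge (b z) (b' z) (v :: s)) =
   (fun z => wedge (icov v (b z)) (b' z) s : R) +
   (fun z => wedge (sgcov (b z)) (icov v (b' z)) s : R).
  by apply/funext => z; rewrite wedge_cons.
apply: differentiableD; apply: IHs => //; first exact: diffF_icov.
  exact: diffF_sgcov.
exact: diffF_icov.
Qed.

Lemma derivF_sgcov b y v : diffF b y ->
  derivF v (fun z => sgcov (b z)) y = sgcov (derivF v b y).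
Proof.
move=> db; apply/funext => s; rewrite /derivF /sgcov.
exact: (derive_real_scale v ((-1) ^+ size s) (db s)).
Qed.

Lemma derivF_wedge b b' y v : diffF b y -> diffF b' y ->
  derivF v (fun z => wedge (b z) (b' z)) y =
  wedge (derivF v b y) (b' y) + wedge (b y) (derivF v b' y).
Proof.
move=> db db'; apply/funext => s; elim: s b b' db db' => [|w s IHs] b b' db db'.
  rewrite /derivF !fctE !wedge_nil.
  have -> : (fun z => wedge (b z) (b' z) [::]) = (fun z => b z [::] * b' z [::]).
    by apply/funext => z; rewrite wedge_nil.
  exact: derive_real_mul.
rewrite /derivF.
have -> : (fun z => wedge (b z) (b' z) (w :: s)) =
   (fun z => 1 * wedge (icov w (b z)) (b' z) s + wedge (sgcov (b z)) (icov w (b' z)) s : R).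
  by apply/funext => z; rewrite wedge_cons mul1r.
have dbw := diffF_icov w db; have dbw' := diffF_icov w db'.
have dbs := diffF_sgcov db.
rewrite (derive_real_lin _ _ (diffF_wedge dbw db' s) (diffF_wedge dbs dbw' s)) mul1r.
have := IHs _ _ dbw db'; have := IHs _ _ dbs dbw'; rewrite /derivF => -> ->.
rewrite !fctE !wedge_cons -/(derivF v (fun z => sgcov (b z)) y) (derivF_sgcov _ db).
rewrite -!/(derivF _ _ _) addrACA.
by [].
Qed.

Lemma size_remove s (i : 'I_(size s)) : size (take i s ++ drop i.+1 s) = (size s).-1.
Proof.
rewrite size_cat size_take size_drop ltn_ord; have := ltn_ord i.
by move: (nat_of_ord i) => {}i; lia.
Qed.

Lemma dE_sgcov b y : diffF b y ->
  dE (fun z => sgcov (b z)) y = - sgcov (dE b y).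
Proof.
move=> db; apply/funext => s.
change (dE (fun z => sgcov (b z)) y s = - ((-1) ^+ size s * dE b y s)).
rewrite /dE mulr_sumr -sumrN; apply: eq_bigr => i _.
apply: (etrans (congr1 (fun w : R => (-1) ^+ i * w) (derive_real_scale s`_i
  ((-1) ^+ size (take i s ++ drop i.+1 s)) (db _)))).
rewrite size_remove; case: s i => [|v s] i; first by case: i.
by rewrite /= exprS; ring.
Qed.

Lemma wedgeDr a c c' : wedge a (c + c') = wedge a c + wedge a c'.
Proof. exact: linearD. Qed.

Lemma wedgeNr a c : wedge a (- c) = - wedge a c.
Proof. exact: linearN. Qed.

Lemma dE_wedge b b' y s : diffF b y -> diffF b' y ->
  dE (fun z => wedge (b z) (b' z)) y s =
  wedge (dE b y) (b' y) s + wedge (sgcov (b y)) (dE b' y) s.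
Proof.
elim: s b b' => [|v s IHs] b b' db db'.
  by rewrite !wedge_nil !dE_nil mul0r mulr0 addr0.
have dbw := diffF_icov v db; have dbw' := diffF_icov v db'.
have dbs := diffF_sgcov db.
rewrite dE_cons (derivF_wedge v db db').
have -> : (fun z => icov v (wedge (b z) (b' z))) = (fun z => 1 *: wedge (icov v (b z)) (b' z) +
   wedge (sgcov (b z)) (icov v (b' z))).
  by apply/funext => z; rewrite icov_wedge scale1r.
rewrite dE_lin; [|exact: diffF_wedge..].
rewrite !IHs // mul1r !wedge_cons !icov_dE.
rewrite (dE_sgcov db) icov_sgcov !sgcovK !wedgeDl !wedgeDr !wedgeNl !wedgeNr !fctE.
by ring.
Qed.

(* The derivative of [a] at the first components of [r], in the direction of
   the second components. *)
Fixpoint ins a (r : seq ('rV[R]_m * 'rV[R]_m)) : R :=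
  if r is (u, u') :: r' then a (u' :: map fst r') + ins (icov u a) r' else 0.

Lemma ins_lin (c : R) a a' r : ins (c *: a + a') r = c * ins a r + ins a' r.
Proof.
elim: r a a' => [|[u u'] r IHr] a a' /=; first by rewrite mulr0 addr0.
have -> : icov u (c *: a + a') = c *: icov u a + icov u a' by [].
by rewrite IHr !fctE scaleRE; ring.
Qed.

Lemma ins0 r : ins 0 r = 0.
Proof. by have := ins_lin (-1) 0 0 r; rewrite scaler0 addr0 mulN1r addNr. Qed.

Lemma ins_sum (I : Type) (l : seq I) (c : I -> R) (F : I -> covec R m) r :
  ins (\sum_(i <- l) c i *: F i) r = \sum_(i <- l) c i * ins (F i) r.
Proof.
elim/big_rec2: _ => [|i x w _ <-]; first exact: ins0.
exact: ins_lin.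
Qed.

Lemma icov_row k a (w : 'rV[R]_m) s : altform k a ->
  a (w :: s) = \sum_j w ord0 j * icov (delta_mx 0 j) a s.
Proof.
move=> ha; rewrite -[LHS]/(icov w a s) {1}[w]row_sum_delta (icov_sumv _ _ _ ha) fct_sumE.
by apply: eq_bigr => j _; rewrite (icovZv _ _ ha).
Qed.

Lemma ins_set_nth k a (q : 'rV[R]_m -> 'rV[R]_m) s : altform k a ->
  ins a [seq (t, q t) | t <- s] = \sum_(i < size s) a (set_nth 0 s i (q s`_i)).
Proof.
elim: s k a => [|t s IHs] k a ha /=; first by rewrite big_ord0.
rewrite big_ord_recl /= -map_comp map_id; congr (_ + _).
case: k ha => [|k] ha; last by rewrite (IHs k _ (icov_altform t ha)).
by rewrite (icov_altform0 _ ha) ins0 big1 // => i _; case: ha => ->.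
Qed.

(* Moving the differentiated argument to the front costs the sign of a
   transposition per step. *)
Lemma ins_front k a (A q : 'rV[R]_m -> 'rV[R]_m) s : altform k a ->
  ins a [seq (A t, q t) | t <- s] = \sum_(i < size s) (-1) ^+ i *
    a (q s`_i :: map A (take i s ++ drop i.+1 s)).
Proof.
elim: s k a => [|t s IHs] k a ha /=; first by rewrite big_ord0.
rewrite big_ord_recl /= expr0 mul1r drop0 -map_comp; congr (_ + _).
case: k ha => [|k] ha.
  rewrite (icov_altform0 _ ha) ins0 big1 // => i _.
  by case: ha => -> //; rewrite mulr0.
rewrite (IHs k _ (icov_altform _ ha)); apply: eq_bigr => i _.
rewrite /bump /= exprS mulN1r mulNr -mulrN; congr (_ * _).
have := congr1 (@^~ (map A (take i s ++ drop i.+1 s))) (icovC (q s`_i) (A t) ha).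
by rewrite /icov !fctE.
Qed.

(** The second-order terms in the differential of a pullback, with A the differential of the map and
    Q its second derivative. They cancel because Q is symmetric while a alternates. *)
Definition insQ a (A : 'rV[R]_m -> 'rV[R]_m) (Q : 'rV[R]_m -> 'rV[R]_m -> 'rV[R]_m) s :=
  \sum_(i < size s) (-1) ^+ i *
    ins a [seq (A t, Q s`_i t) | t <- take i s ++ drop i.+1 s].

Lemma insQ_eq0 k a A Q s : altform k a -> (forall u v, Q u v = Q v u) -> insQ a A Q s = 0.
Proof.
move=> + Qs; elim: s k a => [|v s IHs] k a ha; first by rewrite /insQ big_ord0.
rewrite /insQ /= big_ord_recl /= expr0 mul1r drop0 (ins_front _ _ _ ha).
have -> : \sum_(i < size s) (-1) ^+ bump 0 i *
    (a (Q s`_i v :: [seq x.1 | x <- [seq (A t, Q s`_i t) | t <- take i s ++ drop i.+1 s]]) +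
     ins (icov (A v) a) [seq (A t, Q s`_i t) | t <- take i s ++ drop i.+1 s]) =
  - \sum_(i < size s) (-1) ^+ i * a (Q v s`_i :: map A (take i s ++ drop i.+1 s)) -
  insQ (icov (A v) a) A Q s.
  rewrite /insQ -opprD -big_split -sumrN; apply: eq_bigr => i _.
  by rewrite -map_comp Qs /bump /= exprS; ring.
rewrite addrA subrr sub0r.
case: k ha => [|k] ha; last by rewrite (IHs k _ (icov_altform _ ha)) oppr0.
by rewrite (icov_altform0 _ ha) /insQ big1 ?oppr0 // => i _; rewrite ins0 mulr0.
Qed.

Lemma icov_row_near U (k : nat) b x (w : 'rV[R]_m -> 'rV[R]_m) (r : 'rV[R]_m -> seq 'rV[R]_m) :
  open U -> U x -> (forall z, U z -> altform k (b z)) ->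
  \forall z \near x, \sum_j w z ord0 j * icov (delta_mx 0 j) (b z) (r z) = b z (w z :: r z).
Proof.
move=> oU Ux ab; apply: filterS (near_open oU Ux) => z Uz.
by rewrite (icov_row _ _ (ab z Uz)).
Qed.

Lemma altform_icov_U U (k : nat) b v : (forall z, U z -> altform k (b z)) ->
  exists k', forall z, U z -> altform k' (icov v (b z)).
Proof.
case: k => [|k] ab; last by exists k => z Uz; exact/icov_altform/ab.
by exists 0%N => z Uz; rewrite (icov_altform0 _ (ab z Uz)); exact: altform_zero.
Qed.

(** Product rule for a form whose arguments move with the point: the first argument is expanded in
    coordinates, and the induction runs over the contractions with the coordinate vectors. *)
Lemma derive_args U (k : nat) b x v (W : 'rV[R]_m -> 'rV[R]_m -> 'rV[R]_m) s :
  open U -> U x -> (forall z, U z -> altform k (b z)) -> diffF b x ->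
  (forall t, differentiable (W t) x) ->
  differentiable (fun z => b z [seq W t z | t <- s] : R) x /\
  'D_v (fun z => b z [seq W t z | t <- s] : R) x =
    'D_v (fun z => b z [seq W t x | t <- s] : R) x +
    ins (b x) [seq (W t x, 'D_v (W t) x) | t <- s].
Proof.
move=> oU Ux + + dW; elim: s k b => [|t s IHs] k b ab db.
  by rewrite /= addr0; split => //; exact: db.
have nE := icov_row_near (W t) (fun z => [seq W t z | t <- s]) oU Ux ab.
have nE' := icov_row_near (fun=> W t x) (fun=> [seq W t x | t <- s]) oU Ux ab.
have dWj j : differentiable (fun z => W t z ord0 j : R) x.
  by apply: (@differentiable_comp _ _ _ _ (W t) (coordf j)) => //; exact/linear_differentiable/coordf_continuous.
have IH j := let: ex_intro k' ab' := altform_icov_U (delta_mx 0 j) ab in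
  IHs k' (fun z => icov (delta_mx 0 j) (b z)) ab' (diffF_icov _ db).
have dprod j : differentiable (fun z => W t z ord0 j *
    icov (delta_mx 0 j) (b z) [seq W t z | t <- s] : R) x.
  by apply: differentiableM => //; exact: (IH j).1.
have dcst j : differentiable (fun z => icov (delta_mx 0 j) (b z) [seq W t x | t <- s] : R) x.
  exact: db.
split; first exact: near_eq_diff nE (diff_real_sum _ dprod).
rewrite -(near_eq_derive v nE) (derive_real_sum _ _ dprod).
rewrite -(near_eq_derive v nE').
rewrite (derive_real_sum _ _ (fun j => differentiableZ (W t x ord0 j) (dcst j))).
rewrite /= -map_comp (icov_row _ _ (ab x Ux)).
have -> : icov (W t x) (b x) = \sum_j W t x ord0 j *: icov (delta_mx 0 j) (b x).
  apply/funext => r; rewrite fct_sumE -[LHS]/(b x (W t x :: r)).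
  by rewrite (icov_row _ _ (ab x Ux)).
rewrite ins_sum -!big_split /=; apply: eq_bigr => j _.
apply: (etrans (derive_real_mul v (dWj j) (IH j).1)).
rewrite (IH j).2 (derive_coord _ _ (dW t)).
rewrite [X in _ = X + _](derive_real_scale v (W t x ord0 j) (dcst j)).
by rewrite mulrDr addrCA.
Qed.

Lemma Cn_args U (k l : nat) b (W : 'rV[R]_m -> 'rV[R]_m -> 'rV[R]_m) s : open U ->
  (forall z, U z -> altform k (b z)) ->
  (forall r, Cn l U (fun z => b z r : R)) -> (forall t, Cn l U (W t)) ->
  Cn l U (fun z => b z [seq W t z | t <- s] : R).
Proof.
move=> oU + + CW; elim: s k b => [|t s IHs] k b ab Cb; first exact: Cb.
have IH j := let: ex_intro k' ab' := altform_icov_U (delta_mx 0 j) ab in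
  IHs k' (fun z => icov (delta_mx 0 j) (b z)) ab' (fun r => Cb _).
apply: (Cn_ext oU) (Cn_sum (index_enum _) (P := predT) oU
  (fun j _ => CnM oU (Cn_coord j oU (CW t)) (IH j))) => z Uz.
by rewrite /= (icov_row _ _ (ab z Uz)).
Qed.

Definition pull (tau : 'rV[R]_m -> 'rV[R]_m) b y : covec R m :=
  fun s => b (tau y) [seq 'D_t tau y | t <- s].

Lemma smooth_derive U (tau : 'rV[R]_m -> 'rV[R]_m) t l :
  smooth_on U tau -> Cn l U ('D_t tau).
Proof. by move=> st; have [_] := st l.+1; apply. Qed.

Section Pullback.
Variables (U U' : set 'rV[R]_m) (tau : 'rV[R]_m -> 'rV[R]_m).
Hypotheses (oU : open U) (oU' : open U') (tU : forall z, U z -> U' (tau z)).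
Hypothesis st : smooth_on U tau.
Variables (k : nat) (b : 'rV[R]_m -> covec R m).
Hypotheses (ab : forall z, U' z -> altform k (b z)) (sb : smoothF U' b).

Lemma pull_smooth : smoothF U (pull tau b).
Proof.
move=> s l; apply: (@Cn_args U k l (fun z => b (tau z)) (fun t => 'D_t tau)) => //.
- by move=> z Uz; exact/ab/tU.
- by move=> r; exact: (Cn_comp (g := fun z => b z r : R) oU tU (st l) (sb r l)).
- by move=> t; exact: smooth_derive.
Qed.

Lemma dE_pull y : U y -> dE (pull tau b) y = pull tau (dE b) y.
Proof.
move=> Uy; apply/funext => s.
have [dt _] := st 1%N; have [_ dDt] := st 2%N.
have db' : diffF (fun z => b (tau z)) y.
  move=> r; apply: (@differentiable_comp _ _ _ _ tau (fun z => b z r : R)); first exact: dt.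
  exact: (smoothF_diff sb (tU Uy)).
have ab' z : U z -> altform k (b (tau z)) by move=> Uz; exact/ab/tU.
have D v r := (derive_args v r oU Uy ab' db' (W := fun t => 'D_t tau) (fun t => (dDt t).1 y Uy)).2.
(* Symmetry of second derivatives is known for real functions, so it is applied to each coordinate
   of tau. *)
have Q0 : insQ (b (tau y)) (fun t => 'D_t tau y) (fun u v => 'D_u ('D_v tau) y) s = 0.
  apply: insQ_eq0 (ab (tU Uy)) _ => u v; apply/rowP => j.
  have h w z : 'D_z ('D_w tau) y ord0 j = 'D_z ('D_w (fun x => tau x ord0 j : R)) y.
    rewrite -(derive_coord _ _ ((dDt w).1 y Uy)); apply: near_eq_derive.
    apply: filterS (near_open oU Uy) => x Ux.
    by rewrite (derive_coord _ _ (dt x Ux)).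
  exact: (etrans (h v u) (etrans (derive_sym u v oU Uy (Cn_coord j oU (st 2%N))) (esym (h u v)))).
transitivity (\sum_(i < size s) ((-1) ^+ i *
   'D_(s`_i) (fun z => b (tau z) [seq 'D_t tau y | t <- take i s ++ drop i.+1 s] : R) y +
   (-1) ^+ i * ins (b (tau y)) [seq ('D_t tau y, 'D_(s`_i) ('D_t tau) y) | t <- take i s ++ drop i.+1 s])).
  by apply: eq_bigr => i _; rewrite /pull D mulrDr.
rewrite big_split /= -[X in _ + X]/(insQ _ (fun t => 'D_t tau y) (fun u v => 'D_u ('D_v tau) y) s) Q0 addr0.
rewrite /pull /dE size_map; apply: eq_bigr => i _.
rewrite (nth_map 0) // -map_take -map_drop -map_cat.
have dby := smoothF_diff sb (tU Uy) [seq 'D_t tau y | t <- take i s ++ drop i.+1 s].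
exact: (congr1 (fun w : R => (-1) ^+ i * w) (derive_comp s`_i (dt y Uy) dby)).
Qed.
End Pullback.

Lemma derive_slot U (k : nat) b x v (X : 'rV[R]_m -> 'rV[R]_m) s :
  open U -> U x -> (forall z, U z -> altform k (b z)) -> diffF b x ->
  differentiable X x ->
  'D_v (fun z => b z (X z :: s) : R) x =
    'D_v (fun z => b z (X x :: s) : R) x + b x ('D_v X x :: s).
Proof.
move=> oU Ux ab db dX.
have nE := icov_row_near X (fun=> s) oU Ux ab.
have nE' := icov_row_near (fun=> X x) (fun=> s) oU Ux ab.
have dXj j : differentiable (fun z => X z ord0 j : R) x.
  by apply: (@differentiable_comp _ _ _ _ X (coordf j)) => //; exact/linear_differentiable/coordf_continuous.
have dcst j : differentiable (fun z => icov (delta_mx 0 j) (b z) s : R) x by exact: db.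
rewrite -(near_eq_derive v nE) (derive_real_sum _ _ (fun j => differentiableM (dXj j) (dcst j))).
rewrite -(near_eq_derive v nE').
rewrite (derive_real_sum _ _ (fun j => differentiableZ (X x ord0 j) (dcst j))).
rewrite (icov_row _ _ (ab x Ux)) -big_split /=; apply: eq_bigr => j _.
apply: (etrans (derive_real_mul v (dXj j) (dcst j))).
rewrite (derive_coord _ _ dX) [X in _ = X + _](derive_real_scale v (X x ord0 j) (dcst j)).
by rewrite addrC.
Qed.

(** The formula L_X = d i_X + i_X d for a variable field: differentiating the slot filled by X gives
    the terms in D X, and [ins_front] reorders those of the Lie derivative to match. *)
Lemma cartan U (k : nat) b y (X : 'rV[R]_m -> 'rV[R]_m) s :
  open U -> U y -> (forall z, U z -> altform k (b z)) -> diffF b y ->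
  differentiable X y ->
  derivF (X y) b y s + \sum_(i < size s) b y (set_nth 0 s i ('D_(s`_i) X y)) =
  dE (fun z => icov (X z) (b z)) y s + dE b y (X y :: s).
Proof.
move=> oU Uy ab db dX; rewrite dE_cons addrCA; congr (_ + _).
rewrite -(ins_set_nth (fun t => 'D_t X y) s (ab y Uy)).
rewrite (ins_front (fun t => t) (fun t => 'D_t X y) s (ab y Uy)) /dE -sumrB.
apply: eq_bigr => i _; rewrite map_id /icov (derive_slot _ _ oU Uy ab db dX); ring.
Qed.

Lemma derivF_altform U (k : nat) b y v : open U -> U y ->
  (forall z, U z -> altform k (b z)) -> diffF b y -> altform k (derivF v b y).
Proof.
move=> oU Uy ab db; split=> [s sk|s t c u w|s t r u]; rewrite /derivF.
- have e : \forall z \near y, (fun=> 0 : R) z = b z s.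
    by apply: filterS (near_open oU Uy) => z /ab[->].
  by rewrite -(near_eq_derive v e); exact: derive_cst.
- have e : \forall z \near y, c * b z (s ++ u :: t) + b z (s ++ w :: t) =
      b z (s ++ (c *: u + w) :: t).
    by apply: filterS (near_open oU Uy) => z /ab[_ -> _].
  by rewrite -(near_eq_derive v e) (derive_real_lin _ _ (db _) (db _)).
- have e : \forall z \near y, (fun=> 0 : R) z = b z (s ++ u :: t ++ u :: r).
    by apply: filterS (near_open oU Uy) => z /ab[_ _ ->].
  by rewrite -(near_eq_derive v e); exact: derive_cst.
Qed.

Lemma dE_zero y : dE (fun=> 0) y = 0.
Proof.
apply/funext => s; rewrite /dE big1 // => i _.
by rewrite [X in _ * X]derive_cst mulr0.
Qed.

Lemma dE_altform U (k : nat) b y : open U -> U y ->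
  (forall z, U z -> altform k (b z)) -> diffF b y -> altform k.+1 (dE b y).
Proof.
move=> oU Uy; elim: k b => [|k IHk] b ab db; apply/altformS.
  have e v : \forall z \near y, (fun=> 0) z = icov v (b z).
    by apply: filterS (near_open oU Uy) => z Uz; rewrite (icov_altform0 _ (ab z Uz)).
  have e0 v : dE (fun z => icov v (b z)) y = 0.
    by rewrite -(near_eq_dE (e v)) dE_zero.
  split=> [|v|r u v|u]; first exact: dE_nil.
  - by rewrite icov_dE e0 subr0; exact: (derivF_altform v oU Uy ab db).
  - rewrite !icov_dE !e0 !subr0; apply/funext => s.
    by rewrite /derivF derive_linear.
  - rewrite icov_dE e0 subr0 (icov_altform0 _ (derivF_altform u oU Uy ab db)) //.
have abv v z : U z -> altform k (icov v (b z)) by move=> Uz; exact/icov_altform/ab.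
split=> [|v|r u v|u]; first exact: dE_nil.
- rewrite icov_dE -scaleN1r addrC; apply: altform_lin; last exact: (derivF_altform v oU Uy ab db).
  exact: (IHk (fun z => icov v (b z)) (abv v) (diffF_icov v db)).
- have e : \forall z \near y, r *: icov u (b z) + icov v (b z) = icov (r *: u + v) (b z).
    by apply: filterS (near_open oU Uy) => z Uz; rewrite (icov_lin _ _ _ (ab z Uz)).
  rewrite !icov_dE -(near_eq_dE e).
  have e1 : derivF (r *: u + v) b y = r *: derivF u b y + derivF v b y.
    by apply/funext => s; exact: (derive_linear (db s) r u v).
  have e2 : dE (fun z => r *: icov u (b z) + icov v (b z)) y =
    r *: dE (fun z => icov u (b z)) y + dE (fun z => icov v (b z)) y.
    by apply/funext => s; exact: (dE_lin r s (diffF_icov u db) (diffF_icov v db)).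
  rewrite e1.
  apply: (etrans (congr1 (fun w => _ - w) e2)).
  move: (dE _ _) (dE _ _) (derivF _ _ _) (derivF _ _ _) => A B C D.
  by rewrite scalerBr opprD addrACA.
- have e : \forall z \near y, (fun=> 0) z = icov u (icov u (b z)).
    by apply: filterS (near_open oU Uy) => z Uz; rewrite (icovv _ (ab z Uz)).
  rewrite icov_dE icovD icovN icov_dE -(near_eq_dE e) dE_zero subr0.
  by rewrite subrr.
Qed.

Lemma smoothF_sgcov U b : open U -> smoothF U b -> smoothF U (fun z => sgcov (b z)).
Proof. by move=> oU sb s k; exact: (CnZ ((-1) ^+ size s) oU (sb s k)). Qed.

Lemma smoothF_wedge U b b' : open U -> smoothF U b -> smoothF U b' ->
  smoothF U (fun z => wedge (b z) (b' z)).
Proof.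
move=> oU sb sb' s k; elim: s b b' sb sb' => [|v s IHs] b b' sb sb'.
  apply: (Cn_ext oU) (CnM oU (sb [::] k) (sb' [::] k)) => z _.
  by rewrite wedge_nil.
have h1 := IHs _ _ (smoothF_icov v sb) sb'.
have h2 := IHs _ _ (smoothF_sgcov oU sb) (smoothF_icov v sb').
by apply: (Cn_ext oU) (CnD oU h1 h2) => z _; rewrite wedge_cons.
Qed.

Lemma wedge_map a c (f : 'rV[R]_m -> 'rV[R]_m) s :
  wedge a c (map f s) = wedge (a \o map f) (c \o map f) s.
Proof.
elim: s a c => [|v s IHs] a c; first by rewrite !wedge_nil.
rewrite /= !wedge_cons !IHs; congr (_ + wedge _ _ _).
by apply/funext => r; rewrite /sgcov /= size_map.
Qed.
End EuclideanForms.

(** * Charts and differential forms on a manifold *)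

Lemma linear_at0 (R : realType) (m : nat) (f : 'rV[R]_m -> 'rV[R]_m) : linear f -> f 0 = 0.
Proof. by move=> /(_ (-1) 0 0); rewrite scaler0 addr0 scaleN1r addNr. Qed.

Section Charts.
Variables (R : realType) (m : nat) (M : manifold R m).
Implicit Types (c : chart R m M) (q p : M) (y u v : 'rV[R]_m).

Definition overlap c c' : set 'rV[R]_m := c @` (cdom c `&` cdom c').
Definition trans c c' : 'rV[R]_m -> 'rV[R]_m := c' \o cinv c.

Lemma chart_at_admissible p : admissible (chart_at p).
Proof. by move=> q; split; exact: chart_at_smooth. Qed.

Lemma cimgP c y : cimg c y -> cdom c (cinv c y) /\ c (cinv c y) = y.
Proof. by case=> q qc <-; rewrite cfunK. Qed.

Lemma open_cimg c : open (cimg c). Proof. exact: cimg_open. Qed.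

Lemma cimg_cfun c q : cdom c q -> cimg c (c q). Proof. by move=> qc; exists q. Qed.

Lemma overlapP c c' y : overlap c c' y <-> cimg c y /\ cdom c' (cinv c y).
Proof.
split=> [[q [qc qc'] <-]|[/cimgP[yc yE] yc']].
  by rewrite cfunK //; split=> //; exact: cimg_cfun.
by exists (cinv c y).
Qed.

Lemma overlap_cimg c c' y : overlap c c' y -> cimg c y. Proof. by case/overlapP. Qed.

Lemma near_cinv c y (D : set M) : cimg c y -> open D -> D (cinv c y) ->
  \forall z \near y, D (cinv c z).
Proof.
move=> yc oD Dy; have := @cinv_continuous _ _ _ c y yc; apply.
exact: open_nbhs_nbhs.
Qed.

Lemma near_open_subset (U : set 'rV[R]_m) :
  (forall y, U y -> \forall z \near y, U z) -> open U.
Proof. by move=> h; rewrite openE => y /h. Qed.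

Lemma open_overlap c c' : open (overlap c c').
Proof.
apply: near_open_subset => y /overlapP[yc yc'].
have n1 := near_open (@open_cimg c) yc.
have n2 := near_cinv yc (@cdom_open _ _ _ c') yc'.
apply: filterS (@filterI _ _ (nbhs_filter y) _ _ n1 n2) => z [zc zc'].
exact/overlapP.
Qed.

Lemma trans_overlap c c' y : overlap c c' y -> overlap c' c (trans c c' y).
Proof.
by move=> /overlapP[/cimgP[yc yE] yc']; exists (cinv c y); split.
Qed.

Lemma trans_cimg c c' y : overlap c c' y -> cimg c' (trans c c' y).
Proof. by move=> /trans_overlap/overlap_cimg. Qed.

Lemma cinv_trans c c' y : overlap c c' y -> cinv c' (trans c c' y) = cinv c y.
Proof. by move=> /overlapP[_ yc']; rewrite /trans /= cfunK. Qed.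

Lemma trans_trans c c' c'' y : overlap c c' y ->
  trans c' c'' (trans c c' y) = trans c c'' y.
Proof. by move=> o; rewrite {1}/trans /= (cinv_trans o). Qed.

(** Admissible charts are compared only with preferred ones, so near each point the transition is
    factored through the preferred chart there. *)
Lemma trans_smooth c c' : admissible c -> admissible c' ->
  smooth_on (overlap c c') (trans c c').
Proof.
move=> ac ac' k; apply/CnP => y o.
have [yc yc'] := (overlapP c c' y).1 o.
set e := chart_at (cinv c y).
have ye : overlap c e y by apply/overlapP; split=> //; exact: chart_at_dom.
pose U := overlap c c' `&` overlap c e.
have oU : open U by apply: openI; exact: open_overlap.
have oe : forall z, U z -> overlap e c' (trans c e z).
  move=> z [/overlapP[zc zc'] zo]; apply/overlapP; rewrite (cinv_trans zo).
  by split=> //; exact: (trans_cimg zo).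
have h1 : Cn k U (trans c e).
  by apply: (@Cn_sub _ _ _ _ (overlap c e)) ((ac (cinv c y)).1 k) => z [].
have h2 := Cn_comp_row oU (@open_overlap e c') oe h1 ((ac' (cinv c y)).2 k).
have h3 : Cn k U (trans c c').
  by apply: (Cn_ext oU) h2 => z [_ zo]; exact: trans_trans.
by apply: Cn_sub h3 => z ->.
Qed.

Lemma trans_diff c c' y : admissible c -> admissible c' -> overlap c c' y ->
  differentiable (trans c c') y.
Proof. by move=> ac ac' o; exact: ((trans_smooth ac ac' 1%N).1 y o). Qed.

Lemma derive_trans c c' c'' y u : admissible c -> admissible c' -> admissible c'' ->
  overlap c c' y -> overlap c c'' y ->
  'D_('D_u (trans c c') y) (trans c' c'') (trans c c' y) = 'D_u (trans c c'') y.
Proof.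
move=> ac ac' ac'' o o'.
have o1 : overlap c' c'' (trans c c' y).
  by apply/overlapP; rewrite (cinv_trans o); split; [exact: trans_cimg|case/overlapP: o'].
rewrite -(derive_comp u (trans_diff ac ac' o) (trans_diff ac' ac'' o1)).
apply: near_eq_derive; apply: filterS (near_open (@open_overlap c c') o) => z zo.
exact: trans_trans.
Qed.

Lemma overlap_self c y : cimg c y -> overlap c c y.
Proof. by move=> yc; apply/overlapP; split=> //; have [] := cimgP yc. Qed.

Lemma derive_trans_self c y u : cimg c y -> 'D_u (trans c c) y = u.
Proof.
move=> yc; have e : \forall z \near y, (@idfun 'rV[R]_m) z = trans c c z.
  by apply: filterS (near_open (@open_cimg c) yc) => z /cimgP[].
by rewrite -(near_eq_derive u e) derive_id.
Qed.

Lemma dcinv_trans c c' y u : admissible c -> admissible c' -> overlap c c' y ->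
  dcinv c y u = dcinv c' (trans c c' y) ('D_u (trans c c') y).
Proof.
move=> ac ac' o; rewrite /dcinv (cinv_trans o); set e := chart_at _.
have oe : overlap c e y.
  by apply/overlapP; split; [exact: overlap_cimg o|exact: chart_at_dom].
exact: (esym (derive_trans u ac ac' (chart_at_admissible _) o oe)).
Qed.

Lemma chart_at_cimg q : cimg (chart_at q) (chart_at q q).
Proof. by apply: cimg_cfun; exact: chart_at_dom. Qed.

Lemma cinv_chart_at q : cinv (chart_at q) (chart_at q q) = q.
Proof. by rewrite cfunK //; exact: chart_at_dom. Qed.

Lemma dcinv_chart_at q u : dcinv (chart_at q) (chart_at q q) u = u.
Proof.
rewrite /dcinv (cinv_chart_at q).
exact: (derive_trans_self u (chart_at_cimg q)).
Qed.

Lemma overlap_chart_at c q : cdom c q -> overlap (chart_at q) c (chart_at q q).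
Proof.
by move=> qc; apply/overlapP; rewrite (cinv_chart_at q); split=> //; exact: chart_at_cimg.
Qed.

Lemma dcinvK c q v : admissible c -> cdom c q -> dcinv c (c q) (dchart c q v) = v.
Proof.
move=> ac qc; have := dcinv_trans v (chart_at_admissible q) ac (overlap_chart_at qc).
by rewrite dcinv_chart_at /trans /= (cinv_chart_at q) => <-.
Qed.

Lemma dchart_dcinv c c' y u : admissible c -> admissible c' -> overlap c c' y ->
  dchart c' (cinv c y) (dcinv c y u) = 'D_u (trans c c') y.
Proof.
move=> ac ac' o; set q := cinv c y; set e := chart_at q.
have oe : overlap c e y.
  by apply/overlapP; split; [exact: overlap_cimg o|exact: chart_at_dom].
exact: (derive_trans u ac (chart_at_admissible _) ac' oe o).
Qed.

Lemma dchartK c y u : admissible c -> cimg c y -> dchart c (cinv c y) (dcinv c y u) = u.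
Proof.
by move=> ac yc; rewrite (dchart_dcinv u ac ac (overlap_self yc)) derive_trans_self.
Qed.

Lemma dchart_linear c q : admissible c -> cdom c q -> linear (dchart c q).
Proof.
move=> ac qc r u v; apply: derive_linear.
exact: (trans_diff (chart_at_admissible q) ac (overlap_chart_at qc)).
Qed.

Lemma dcinv_linear c y : admissible c -> cimg c y -> linear (dcinv c y).
Proof.
move=> ac yc r u v; apply: derive_linear.
apply: (trans_diff ac (chart_at_admissible (cinv c y))).
by apply/overlapP; split=> //; exact: chart_at_dom.
Qed.

Lemma vloc_chart_at X q : vloc (chart_at q) X (chart_at q q) = X q.
Proof.
by rewrite /vloc (cinv_chart_at q) /dchart; exact: (derive_trans_self _ (chart_at_cimg q)).
Qed.
End Charts.
Arguments open_cimg {R m M} c [t] _.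
Arguments open_overlap {R m M} c c' [t] _.

(** * Differential forms in charts *)

Section Forms.
Variables (R : realType) (m : nat) (M : manifold R m).
Implicit Types (c : chart R m M) (q p : M) (y u v : 'rV[R]_m) (a b : dform M).

Lemma altform_map k (e : covec R m) (f : 'rV[R]_m -> 'rV[R]_m) : linear f ->
  altform k e -> altform k (e \o map f).
Proof.
move=> lf [e0 el ea]; split=> [s sk|s t c u v|s t r u] /=.
- by rewrite e0 // size_map.
- by rewrite !map_cat /= lf el.
- by rewrite !(map_cat, map_cons) ea.
Qed.

Lemma floc_altform k a c y : admissible c -> cimg c y -> (forall p, altform k (a p)) ->
  altform k (floc c a y).
Proof. by move=> ac yc ha; exact: (altform_map (dcinv_linear ac yc) (ha _)). Qed.

Lemma floc_trans c c' a y : admissible c -> admissible c' -> overlap c c' y ->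
  pull (trans c c') (floc c' a) y = floc c a y.
Proof.
move=> ac ac' o; apply/funext => s; rewrite /pull /floc (cinv_trans o) -map_comp.
by congr (a _ _); apply: eq_map => u /=; rewrite -(dcinv_trans u ac ac' o).
Qed.

Lemma floc_chart_at a p : floc (chart_at p) a (chart_at p p) = a p.
Proof.
apply/funext => s; rewrite /floc (cinv_chart_at p).
by rewrite (eq_map (@dcinv_chart_at _ _ _ p)) map_id.
Qed.

Lemma floc_dchart c a q : admissible c -> cdom c q ->
  a q = floc c a (c q) \o map (dchart c q).
Proof.
move=> ac qc; apply/funext => s; rewrite /floc /= cfunK // -map_comp.
by congr (a _ _); rewrite -[LHS]map_id; apply: eq_map => v /=; rewrite dcinvK.
Qed.

Lemma floc_smooth k a c : admissible c -> Omega k a -> smoothF (cimg c) (floc c a).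
Proof.
move=> ac [ha sa] s l; apply/CnP => y yc.
have ae := chart_at_admissible (cinv c y); set e := chart_at _ in ae.
have o : overlap c e y by apply/overlapP; split=> //; exact: chart_at_dom.
have h := pull_smooth (open_overlap c e) (@trans_cimg _ _ _ c e)
  (trans_smooth ac ae) (fun z zc => floc_altform ae zc ha) (sa (cinv c y)).
have h' : Cn l (overlap c e) (fun z => floc c a z s : R).
  apply: (Cn_ext (open_overlap c e)) (h s l) => z zo.
  by rewrite floc_trans.
by apply: Cn_sub h' => z ->.
Qed.

(** Smoothness may be tested in one admissible chart around each point, in particular in a foliated
    one. *)
Lemma OmegaP k a : (forall p, altform k (a p)) ->
  (forall p, exists c, [/\ admissible c, cdom c p & smoothF (cimg c) (floc c a)]) ->
  Omega k a.
Proof.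
move=> ha h; split=> // p s l; apply/CnP => y yc.
have [c [ac qc sa]] := h (cinv (chart_at p) y).
have ae := chart_at_admissible p; set e := chart_at p in ae yc qc *.
have o : overlap e c y by apply/overlapP.
have k1 := pull_smooth (open_overlap e c) (@trans_cimg _ _ _ e c)
  (trans_smooth ae ac) (fun z zc => floc_altform ac zc ha) sa.
have k2 : Cn l (overlap e c) (fun z => floc e a z s : R).
  apply: (Cn_ext (open_overlap e c)) (k1 s l) => z zo.
  by rewrite floc_trans.
by apply: Cn_sub k2 => z ->.
Qed.

Lemma extd_dE a p : extd a p = dE (floc (chart_at p) a) (chart_at p p).
Proof. by []. Qed.

(** The definition of [extd] changes chart with the point; invariance of d under transition maps
    lets one fixed chart compute it on its whole image. *)
Lemma floc_extd k a c y : admissible c -> Omega k a -> cimg c y ->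
  floc c (extd a) y = dE (floc c a) y.
Proof.
move=> ac Oa yc.
have ae := chart_at_admissible (cinv c y); set e := chart_at _ in ae.
have o : overlap c e y by apply/overlapP; split=> //; exact: chart_at_dom.
have h := dE_pull (open_overlap c e) (@trans_cimg _ _ _ c e)
  (trans_smooth ac ae) (fun z zc => floc_altform ae zc Oa.1) (floc_smooth ae Oa) o.
have n1 : \forall z \near y, pull (trans c e) (floc e a) z = floc c a z.
  by apply: filterS (near_open (open_overlap c e) o) => z zo; exact: floc_trans.
by rewrite -(near_eq_dE n1) h.
Qed.

Lemma floc_diff k a c y : admissible c -> Omega k a -> cimg c y -> diffF (floc c a) y.
Proof. by move=> ac Oa yc; exact: (smoothF_diff (floc_smooth ac Oa) yc). Qed.

Lemma Omega_extd k a : Omega k a -> Omega k.+1 (extd a).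
Proof.
move=> Oa; apply: OmegaP => p.
  have ap := chart_at_admissible p.
  rewrite extd_dE.
  exact: (dE_altform (open_cimg (chart_at p)) (chart_at_cimg p)
    (fun z zc => floc_altform ap zc Oa.1) (floc_diff ap Oa (chart_at_cimg p))).
exists (chart_at p); have ap := chart_at_admissible p; split=> //; first exact: chart_at_dom.
move=> s l; apply: (Cn_ext (open_cimg (chart_at p)))
  (smoothF_dE (open_cimg (chart_at p)) (floc_smooth ap Oa) s l) => y yc.
by rewrite (floc_extd ap Oa yc).
Qed.

Lemma extd_extd k a : Omega k a -> extd (extd a) = 0.
Proof.
move=> Oa; apply/funext => p; rewrite extd_dE; have ap := chart_at_admissible p.
have oc := open_cimg (chart_at p).
have n1 : \forall z \near (chart_at p p), floc (chart_at p) (extd a) z =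
    dE (floc (chart_at p) a) z.
  apply: filterS (near_open oc (chart_at_cimg p)) => z zc.
  exact: (floc_extd ap Oa zc).
rewrite (near_eq_dE n1).
exact: (dEdE oc (chart_at_cimg p) (floc_smooth ap Oa)).
Qed.

Lemma extd_lin k l a b (r : R) : Omega k a -> Omega l b ->
  extd (r *: a + b) = r *: extd a + extd b.
Proof.
move=> Oa Ob; apply/funext => p; apply/funext => s.
have ap := chart_at_admissible p; have pc := chart_at_cimg p.
exact: (dE_lin r s (floc_diff ap Oa pc) (floc_diff ap Ob pc)).
Qed.

Lemma Omega_lin k a b (r : R) : Omega k a -> Omega k b -> Omega k (r *: a + b).
Proof.
move=> Oa Ob; apply: OmegaP => p; first exact: (altform_lin r (Oa.1 p) (Ob.1 p)).
exists (chart_at p); have ap := chart_at_admissible p; split=> //; first exact: chart_at_dom.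
by move=> s l; exact: (Cn_lin r (open_cimg (chart_at p)) (floc_smooth ap Oa s l)
  (floc_smooth ap Ob s l)).
Qed.

Lemma Omega0 k : Omega k (0 : dform M).
Proof.
by split=> [p|p s l]; [exact: altform_zero|exact: (@Cn_cst _ _ _ l _ (0 : R))].
Qed.

Lemma floc_wedge a b c y : floc c (wedge_form a b) y = wedge (floc c a y) (floc c b y).
Proof. by apply/funext => s; rewrite /floc /wedge_form wedge_map. Qed.

Lemma Omega_wedge k l a b : Omega k a -> Omega l b -> Omega (k + l) (wedge_form a b).
Proof.
move=> Oa Ob; apply: OmegaP => p; first exact: (altform_wedge (Oa.1 p) (Ob.1 p)).
exists (chart_at p); have ap := chart_at_admissible p; split=> //; first exact: chart_at_dom.
move=> s i; have oc := open_cimg (chart_at p).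
apply: (Cn_ext oc) (smoothF_wedge oc (floc_smooth ap Oa) (floc_smooth ap Ob) s i) => y yc.
by rewrite floc_wedge.
Qed.

Lemma extd_wedge k l a b : Omega k a -> Omega l b ->
  extd (wedge_form a b) =
  wedge_form (extd a) b + wedge_form (fun p => sgcov (a p)) (extd b).
Proof.
move=> Oa Ob; apply/funext => p; apply/funext => s.
have ap := chart_at_admissible p; have pc := chart_at_cimg p.
rewrite extd_dE (_ : floc _ _ = fun y => wedge (floc (chart_at p) a y) (floc (chart_at p) b y)).
  rewrite (dE_wedge s (floc_diff ap Oa pc) (floc_diff ap Ob pc)).
  by rewrite !floc_chart_at.
by apply/funext => y; exact: floc_wedge.
Qed.
End Forms.

(** * Basic forms *)

Section BasicForms.
Variables (R : realType) (m c : nat) (M : manifold R m) (F : foliation M c).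
Implicit Types (q p : M) (y u v : 'rV[R]_m) (a b : dform M).

Definition foliated (x : chart R m M) := admissible x /\
  forall q, cdom x q -> forall v, v \in F q <->
    (forall j : 'I_m, (j < c)%N -> dchart x q v ord0 j = 0).

Lemma foliated_at p : exists2 x, foliated x & cdom x p.
Proof. by have [x [? ? ?]] := foliated_chart F p; exists x. Qed.

Lemma Cn_mulv k (U : set 'rV[R]_m) (f : 'rV[R]_m -> R) (g : 'rV[R]_m -> 'rV[R]_m) :
  open U -> Cn k U f -> Cn k U g -> Cn k U (fun y => f y *: g y).
Proof.
move=> oU hf hg; apply: (Cn_row oU) => j.
apply: (Cn_ext oU) (CnM oU hf (Cn_coord j oU hg)) => y _.
by rewrite mxE.
Qed.

Section Bump.
Variables (x : chart R m M) (y0 u : 'rV[R]_m) (r : R).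
Hypotheses (ax : admissible x) (r0 : 0 < r).
Hypothesis (Br : forall y, `|y0 - y| <= r -> cimg x y).

(** A constant-coefficient field of the chart x, cut off by a bump function normalised to 1 at
    y0. *)
Definition bump_field : vector_field M := fun q =>
  if `[< cdom x q >] then (bump_fun y0 r (x q) / bump_fun y0 r y0) *: dcinv x (x q) u else 0.

Let K : set M := cinv x @` [set y | `|y0 - y| <= r].

(** K is the image of a compact ball, hence closed as M is Hausdorff. Around a point outside the
    chart the field thus vanishes on an open set. *)
Lemma closed_bump_support : closed K.
Proof.
apply: compact_closed; first exact: points_hausdorff.
apply: continuous_compact.
  apply: continuous_in_subspaceT => y; rewrite inE => hy.
  exact: cinv_continuous (Br hy).
apply: bounded_closed_compact.
  exists (`|y0| + r); split; first exact: num_real.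
  move=> t ht y /= hy; apply: le_trans (ltW ht).
  by rewrite -[y](subKr y0) (le_trans (ler_normB _ _)) // lerD2l.
have -> : [set y | `|y0 - y| <= r] = (fun y => `|y0 - y|) @^-1` [set t | t <= r] by [].
apply: preimage_closed; last exact: closed_le.
move=> y _; apply: (@continuous_comp _ _ _ (fun y => y0 - y) (fun z => `|z|)).
  by apply: continuousB; [exact: cst_continuous|exact: cvg_id].
exact: norm_continuous.
Qed.

Lemma bump_field_supp q : ~ K q -> bump_field q = 0.
Proof.
rewrite /bump_field; case: asboolP => // xq nK.
have [->|/eqP nz] := eqVneq (bump_fun y0 r (x q)) 0; first by rewrite mul0r scale0r.
case: nK; exists (x q); last exact: cfunK.
by apply: bump_support => //; exact/eqP.
Qed.

Lemma bump_field_smooth : smooth_vector_field bump_field.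
Proof.
move=> p k; set e := chart_at p; have ae := chart_at_admissible p; rewrite -/e in ae.
apply/CnP => y yc; have [ye yE] := cimgP yc.
have [xq|nxq] := pselect (cdom x (cinv e y)).
  have o : overlap e x y by apply/overlapP.
  have oo := open_overlap e x; have oo' := open_overlap x e.
  have h1 : Cn k (overlap x e)
      (fun z => (bump_fun y0 r z * (bump_fun y0 r y0)^-1) *: 'D_u (trans x e) z).
    apply: (Cn_mulv oo'); last exact: ((trans_smooth ax ae k.+1).2 u).
    apply: (CnM oo'); last exact: Cn_cst.
    exact: bump_smooth.
  have h2 := Cn_comp_row oo oo' (@trans_overlap _ _ _ e x) (trans_smooth ae ax k) h1.
  have h3 : Cn k (overlap e x) (vloc e bump_field).
    apply: (Cn_ext oo) h2 => z zo.
    have [zc zx] := (overlapP _ _ _).1 zo.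
    have [zd zE] := cimgP zc.
    rewrite /vloc /bump_field; case: asboolP => // _.
    have lin := dchart_linear ae zd.
    have zo' := trans_overlap zo.
    have := dchart_dcinv u ax ae zo'; rewrite (cinv_trans zo) => <-.
    have := lin ((bump_fun y0 r (trans e x z) / bump_fun y0 r y0)) (dcinv x (trans e x z) u) 0.
    by rewrite (linear_at0 lin) !addr0 => <-.
  by apply: Cn_sub h3 => z ->.
have nK : ~ K (cinv e y).
  by move=> [z hz zE']; apply: nxq; rewrite -zE'; have [] := cimgP (Br hz).
pose U := [set z | cimg e z /\ ~ K (cinv e z)].
have oU : open U.
  apply: near_open_subset => z [zc zK].
  have n1 := near_open (open_cimg e) zc.
  have n2 := near_cinv zc (closed_openC closed_bump_support) zK.
  by apply: filterS (@filterI _ _ (nbhs_filter z) _ _ n1 n2) => w [].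
have h : Cn k U (vloc e bump_field).
  apply: (Cn_ext oU) (@Cn_cst _ _ _ k U (0 : 'rV[R]_m)) => z [zc zK].
  rewrite /vloc (bump_field_supp zK).
  have [zd zE] := cimgP zc.
  by rewrite (linear_at0 (dchart_linear ae zd)).
by apply: Cn_sub h => z ->.
Qed.
End Bump.

(** Basic forms are defined through global sections of P; this extension turns the conditions into
    conditions on vectors at each point. *)
Lemma section_through p v : v \in F p -> exists2 X, sections F X & X p = v.
Proof.
move=> vF; have [x [ax fx] xp] := foliated_at p.
have [r r0 Br] : exists2 r : R, 0 < r & forall y, `|x p - y| <= r -> cimg x y.
  have := near_open (open_cimg x) (cimg_cfun xp).
  move=> /nbhs_ballP[r /= r0 hr]; exists (r / 2); first exact: divr_gt0.
  move=> y hy; apply: hr; rewrite -ball_normE /=; apply: le_lt_trans hy _.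
  by rewrite ltr_pdivrMr // mulr_natr mulr2n ltrDl.
have b0 := bump_center (x p) r0.
exists (bump_field x (x p) (dchart x p v) r); last first.
  by rewrite /bump_field; case: asboolP => // _; rewrite divff // scale1r dcinvK.
split=> [|q]; first exact: bump_field_smooth.
(* In a foliated chart P has constant linear equations, so the constant-coefficient field stays
   tangent to P. *)
rewrite /bump_field; case: asboolP => xq; last exact: mem0v.
apply: memvZ; apply/(fx q xq) => j jc.
have := dchartK (dchart x p v) ax (cimg_cfun xq); rewrite cfunK // => ->.
exact: ((fx p xp v).1 vF j jc).
Qed.

Lemma lie_form_cartan k a X p s : Omega k a -> smooth_vector_field X ->
  lie_form X a p s =
  extd (iota_form X a) p s + extd a p (X p :: s).
Proof.
move=> Oa sX; set e := chart_at p; have ae := chart_at_admissible p; rewrite -/e in ae.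
have pc := chart_at_cimg p; rewrite -/e in pc.
have oe := open_cimg e.
have dX : differentiable (vloc e X) (e p) := (sX p 1%N).1 (e p) pc.
have h := cartan s oe pc (fun z zc => floc_altform ae zc Oa.1) (floc_diff ae Oa pc) dX.
have n1 : \forall z \near e p, icov (vloc e X z) (floc e a z) = floc e (iota_form X a) z.
  apply: filterS (near_open oe pc) => z zc; apply/funext => t.
  rewrite /icov /floc /iota_form /= /vloc.
  have [zd zE] := cimgP zc.
  by rewrite -[z in dcinv e z (dchart _ _ _)]zE dcinvK.
rewrite (near_eq_dE n1) vloc_chart_at in h.
apply: etrans h.
by rewrite floc_chart_at.
Qed.

(** By Cartan's formula, once i_X a = 0 the condition L_X a = 0 means i_X d a = 0. Lie derivatives
    disappear from here on. *)
Lemma basicP k a : Omega_bas F k a <-> Omega k a /\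
  forall p v, v \in F p -> icov v (a p) = 0 /\ icov v (extd a p) = 0.
Proof.
split=> [[Oa h]|[Oa h]]; split=> //.
  move=> p v /section_through[X sX <-].
  have [i0 l0] := h X sX.
  split; first exact: (congr1 (fun w : dform M => w p) i0).
  apply/funext => s; have := lie_form_cartan p s Oa sX.1.
  rewrite l0 i0 extd_dE.
  have -> : floc (chart_at p) (0 : dform M) = fun=> 0 by [].
  by rewrite dE_zero add0r => l1; exact: (esym l1).
move=> X [sX XF].
have i0 : iota_form X a = 0 by apply/funext => p; exact: (h p _ (XF p)).1.
split=> //; apply/funext => p; apply/funext => s.
rewrite (lie_form_cartan p s Oa sX) i0 extd_dE.
have -> : floc (chart_at p) (0 : dform M) = fun=> 0 by [].
rewrite dE_zero add0r; exact: (congr1 (fun w => w s) (h p _ (XF p)).2).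
Qed.
End BasicForms.

(** * Contraction with the dual bivector *)

Section FrameOfBasis.
Variables (R : realType) (m n : nat) (P : {vspace 'rV[R]_m}) (sg : covec R m).
Variable E : 'I_n -> 'rV[R]_m.
Hypothesis hsg : presymplectic P sg.
Hypothesis Egen : forall w, exists t : 'I_n -> R, w - \sum_i t i *: E i \in P.
Hypothesis Efree : forall t : 'I_n -> R, \sum_i t i *: E i \in P -> forall i, t i = 0.

Definition gram : 'M[R]_n := \matrix_(i, j) sg [:: E i; E j].
(** Rational in the entries of the Gram matrix, so smooth in the point; an abstract choice of dual
    basis would not give this. *)
Definition dual_basis (i : 'I_n) : 'rV[R]_m := \sum_j invmx gram i j *: E j.

Lemma gram_unit : gram \in unitmx.
Proof.
rewrite -row_free_unit; apply: inj_row_free => v vG; apply/rowP => j; rewrite mxE.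
move: j; apply: (Efree (t := v ord0)); apply/(hsg.2 _) => w.
have [t wP] := Egen w.
rewrite (sgC hsg) (sg_mod hsg _ wP) (sg_suml hsg) big1 ?oppr0 // => j _.
rewrite (sgC hsg) (sg_suml hsg) -[X in _ * - X](_ : (v *m gram) ord0 j = _).
  by rewrite vG mxE oppr0 mulr0.
by rewrite mxE; apply: eq_bigr => i _; rewrite mxE.
Qed.

Lemma gram_frame : frame P sg E dual_basis.
Proof.
have d i j : sg [:: dual_basis i; E j] = (i == j)%:R.
  rewrite (sg_suml hsg); transitivity ((invmx gram *m gram) i j).
    by rewrite mxE; apply: eq_bigr => k _; rewrite mxE.
  by rewrite mulVmx ?gram_unit // mxE.
split=> // w; have [t wP] := Egen w.
suff -> : \sum_i sg [:: dual_basis i; w] *: E i = \sum_i t i *: E i by [].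
apply: eq_bigr => i _; congr (_ *: _).
rewrite (sgC hsg) (sg_mod hsg _ wP) (sg_suml hsg) -sumrN (bigD1 i) //= big1 ?addr0.
  by rewrite (sgC hsg) d eqxx mulrN opprK mulr1.
by move=> j ji; rewrite (sgC hsg) d eq_sym (negbTE ji) oppr0 mulr0 oppr0.
Qed.
End FrameOfBasis.

Section SmoothMatrices.
Variables (R : realType) (m : nat) (U : set 'rV[R]_m).
Hypothesis oU : open U.

Lemma Cn_det k n (A : 'rV[R]_m -> 'M[R]_n) :
  (forall i j, Cn k U (fun y => A y i j : R)) -> Cn k U (fun y => \det (A y) : R).
Proof.
move=> hA; rewrite /determinant; apply: (@Cn_sum _ _ _ k U _ _ _ (fun s y => (-1) ^+ odd_perm s * \prod_i A y i (s i) : R) oU) => s _.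
by apply: (CnM oU); [exact: Cn_cst|exact: Cn_prod].
Qed.

Lemma Cn_invmx k n (A : 'rV[R]_m -> 'M[R]_n) :
  (forall i j, Cn k U (fun y => A y i j : R)) ->
  (forall y, U y -> A y \in unitmx) ->
  forall i j, Cn k U (fun y => invmx (A y) i j : R).
Proof.
move=> hA uA i j.
have h : Cn k U (fun y => (\det (A y))^-1 * ((-1) ^+ (j + i) * \det (row' j (col' i (A y)))) : R).
  apply: (CnM oU); first apply: (Cn_inv oU).
  - by move=> y /uA; rewrite unitmxE unitfE.
  - exact: Cn_det.
  apply: (CnM oU); first exact: Cn_cst.
  apply: Cn_det => i' j'; apply: (Cn_ext oU) (hA (lift j i') (lift i j')) => y _.
  by rewrite !mxE.
apply: (Cn_ext oU) h => y /uA uy.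
by rewrite /invmx uy !mxE.
Qed.

(** Differentiating A^(-1) A = 1 gives D(A^(-1)) A = 0, and A is invertible. *)
Lemma derive_invmx_eq0 n (A : 'rV[R]_m -> 'M[R]_n) y v : U y ->
  (forall i j, Cn 1 U (fun y => A y i j : R)) ->
  (forall y, U y -> A y \in unitmx) ->
  (forall i j, 'D_v (fun y => A y i j : R) y = 0) ->
  forall i j, 'D_v (fun y => invmx (A y) i j : R) y = 0.
Proof.
move=> Uy hA uA DA i j.
have hB := Cn_invmx hA uA.
pose D := \matrix_(i, j) 'D_v (fun y => invmx (A y) i j : R) y.
suff D0 : D = 0 by have := congr1 (fun X : 'M[R]_n => X i j) D0; rewrite !mxE.
have uy := uA y Uy.
suff DA0 : D *m A y = 0 by rewrite -[D](mulmxK uy) DA0 mul0mx.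
apply/matrixP => a b; rewrite !mxE.
transitivity ('D_v (fun z => \sum_k invmx (A z) a k * A z k b : R) y); last first.
  have e : \forall z \near y, (fun=> (a == b)%:R : R) z = \sum_k invmx (A z) a k * A z k b.
    apply: filterS (near_open oU Uy) => z Uz.
    by have := mulVmx (uA z Uz) => /(congr1 (fun X : 'M[R]_n => X a b)); rewrite !mxE.
  by rewrite -(near_eq_derive v e); exact: derive_cst.
have dB k : differentiable (fun z => invmx (A z) a k : R) y := (hB a k).1 y Uy.
have dA k : differentiable (fun z => A z k b : R) y := (hA k b).1 y Uy.
rewrite derive_real_sum; last by move=> k; exact: differentiableM.
apply: eq_bigr => k _; rewrite mxE.
by rewrite (derive_real_mul v (dB k) (dA k)) DA mulr0 addr0.
Qed.
End SmoothMatrices.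

Lemma linear_subsum (R : realType) (m n : nat) (f : 'rV[R]_m -> 'rV[R]_m) (w : 'rV[R]_m)
    (t : 'I_n -> R) (G : 'I_n -> 'rV[R]_m) : linear f ->
  f (w - \sum_i t i *: G i) = f w - \sum_i t i *: f (G i).
Proof.
move=> lf; have f0 := linear_at0 lf.
have fD u v : f (u + v) = f u + f v by have := lf 1 u v; rewrite !scale1r.
have fZ r u : f (r *: u) = r *: f u by have := lf r u 0; rewrite f0 !addr0.
rewrite fD -scaleN1r fZ scaleN1r; congr (_ - _).
elim: (index_enum _) => [|i l IHl]; first by rewrite !big_nil f0.
by rewrite !big_cons fD fZ IHl.
Qed.

(** * Basic forms in foliated charts *)

Section BasicLocal.
Variables (R : realType) (m c : nat) (M : manifold R m) (F : foliation M c).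
Implicit Types (x : chart R m M) (y u v : 'rV[R]_m) (a b : dform M).

Definition leafwise u := forall j : 'I_m, (j < c)%N -> u ord0 j = 0.

Lemma leafwiseP x y u : foliated F x -> cimg x y ->
  dcinv x y u \in F (cinv x y) <-> leafwise u.
Proof.
move=> [ax fx] yc; have [yd yE] := cimgP yc.
by rewrite (fx _ yd _) /leafwise (dchartK u ax yc).
Qed.

Lemma floc_leafwise x y u a : foliated F x -> cimg x y -> leafwise u ->
  (forall p v, v \in F p -> icov v (a p) = 0) -> icov u (floc x a y) = 0.
Proof.
move=> fx yc lu ha; apply/funext => s.
by have := ha _ _ ((leafwiseP u fx yc).2 lu) => /(congr1 (fun w => w (map (dcinv x y) s))).
Qed.

(** As a vanishes on leafwise vectors, Cartan's formula leaves only the derivative along u. Hence a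
    horizontal form is basic exactly when its coefficients in foliated charts have zero leafwise
    derivatives. *)
Lemma icov_floc_extd k x y u a : foliated F x -> cimg x y -> leafwise u -> Omega k a ->
  (forall p v, v \in F p -> icov v (a p) = 0) ->
  icov u (floc x (extd a) y) = derivF u (floc x a) y.
Proof.
move=> fx yc lu Oa ha; rewrite (floc_extd fx.1 Oa yc) icov_dE.
have e : \forall z \near y, (fun=> 0) z = icov u (floc x a z).
  apply: filterS (near_open (open_cimg x) yc) => z zc.
  by rewrite (floc_leafwise fx zc lu ha).
by rewrite -(near_eq_dE e) dE_zero subr0.
Qed.

Lemma basic_derivF k x y u a : foliated F x -> cimg x y -> leafwise u ->
  Omega_bas F k a -> derivF u (floc x a) y = 0.
Proof.
move=> fx yc lu /basicP[Oa ha].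
rewrite -(icov_floc_extd fx yc lu Oa) => [|p v vF]; last exact: (ha p v vF).1.
by apply: (floc_leafwise fx yc lu) => p v vF; exact: (ha p v vF).2.
Qed.

Lemma basic_local k a : Omega k a -> (forall p v, v \in F p -> icov v (a p) = 0) ->
  (forall x y u, foliated F x -> cimg x y -> leafwise u -> derivF u (floc x a) y = 0) ->
  Omega_bas F k a.
Proof.
move=> Oa ha hd; apply/basicP; split=> // p v vF; split; first exact: ha.
have [x fx xp] := foliated_at F p.
have lu : leafwise (dchart x p v) by exact/(fx.2 p xp v).1.
have := icov_floc_extd fx (cimg_cfun xp) lu Oa ha.
rewrite (hd x _ _ fx (cimg_cfun xp) lu) => h0.
rewrite (floc_dchart (extd a) fx.1 xp); apply/funext => s.
exact: (congr1 (fun w => w (map (dchart x p) s)) h0).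
Qed.
End BasicLocal.

(** * The operator Lam on basic forms *)

Section SymplecticFoliation.
Variables (R : realType) (m n : nat) (M : manifold R m) (F : foliation M n.*2).
Variable omega : dform M.
Hypothesis Fomega : transversely_symplectic F omega.
Implicit Types (x : chart R m M) (y u v : 'rV[R]_m) (a b : dform M).

Lemma omega_presymplectic p : presymplectic (F p) (omega p).
Proof. by have [[h _] _ k] := Fomega; split; [exact: h|exact: k]. Qed.

Lemma omega_basic : Omega_bas F 2 omega.
Proof.
have [om2 d0 _] := Fomega; apply/basicP; split=> // p v vF; rewrite d0; split=> //.
exact: hcovec_icovP (presymplectic_hcovec (omega_presymplectic p)) v vF.
Qed.

(** The first 2n coordinate vectors. In a foliated chart P is the vanishing locus of the first 2n
    coordinates, so these span a complement of P. *)
Definition transversal (i : 'I_n.*2) : 'rV[R]_m := delta_mx 0 (widen_ord (codim_le F) i).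

Lemma transversalE (t : 'I_n.*2 -> R) (j : 'I_n.*2) :
  (\sum_i t i *: transversal i) ord0 (widen_ord (codim_le F) j) = t j.
Proof.
rewrite summxE (bigD1 j) //= big1 ?addr0 => [|i ij]; rewrite !mxE ?eqxx ?mulr1 //=.
by rewrite -val_eqE /= eq_sym val_eqE (negbTE ij) mulr0.
Qed.

Lemma transversal_gen x y : foliated F x -> cimg x y -> forall w,
  exists t : 'I_n.*2 -> R, w - \sum_i t i *: dcinv x y (transversal i) \in F (cinv x y).
Proof.
move=> [ax fx] yc w; have [yd yE] := cimgP yc.
exists (fun i => dchart x (cinv x y) w ord0 (widen_ord (codim_le F) i)).
apply/(fx _ yd _) => j jn; rewrite (linear_subsum _ _ _ (dchart_linear ax yd)).
under eq_bigr do rewrite (dchartK _ ax yc).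
have -> : j = widen_ord (codim_le F) (Ordinal jn) by exact: val_inj.
by rewrite mxE [X in _ + X]mxE transversalE subrr.
Qed.

Lemma transversal_free x y (t : 'I_n.*2 -> R) : foliated F x -> cimg x y ->
  \sum_i t i *: dcinv x y (transversal i) \in F (cinv x y) -> forall i, t i = 0.
Proof.
move=> [ax fx] yc + i; have [yd yE] := cimgP yc.
rewrite -memvN -[- _]add0r => /(fx _ yd _)/(_ (widen_ord (codim_le F) i) (ltn_ord i)).
rewrite (linear_subsum _ _ _ (dchart_linear ax yd)).
under eq_bigr do rewrite (dchartK _ ax yc).
rewrite mxE [X in _ + X]mxE transversalE.
by rewrite (linear_at0 (dchart_linear ax yd)) mxE add0r => /eqP; rewrite oppr_eq0 => /eqP.
Qed.

Definition lgram x y := gram (floc x omega y) transversal.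
Definition ldual x y := dual_basis (floc x omega y) transversal.

Lemma lgramE x y :
  gram (omega (cinv x y)) (fun i => dcinv x y (transversal i)) = lgram x y.
Proof. by apply/matrixP => i j; rewrite !mxE. Qed.

Lemma lgram_unit x y : foliated F x -> cimg x y -> lgram x y \in unitmx.
Proof.
move=> fx yc; rewrite -lgramE; apply: (gram_unit (omega_presymplectic _)).
- exact: transversal_gen.
- by move=> t; exact: transversal_free.
Qed.

Lemma ldual_frame x y : foliated F x -> cimg x y ->
  frame (F (cinv x y)) (omega (cinv x y)) (fun i => dcinv x y (transversal i))
    (fun i => dcinv x y (ldual x y i)).
Proof.
move=> fx yc.
have h := gram_frame (omega_presymplectic (cinv x y)) (transversal_gen fx yc)
  (fun t => @transversal_free x y t fx yc).
suff -> : (fun i => dcinv x y (ldual x y i)) =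
    dual_basis (omega (cinv x y)) (fun i => dcinv x y (transversal i)) by [].
apply/funext => i; rewrite /ldual /dual_basis lgramE.
have := linear_subsum 0 (fun j => - invmx (lgram x y) i j) transversal (dcinv_linear fx.1 yc).
rewrite (linear_at0 (dcinv_linear fx.1 yc)) !sub0r -!sumrN; under eq_bigr do rewrite scaleNr opprK.
by move=> ->; apply: eq_bigr => j _; rewrite scaleNr opprK.
Qed.

Lemma frame_exists p : exists XY : ('I_n.*2 -> 'rV[R]_m) * ('I_n.*2 -> 'rV[R]_m),
  frame (F p) (omega p) XY.1 XY.2.
Proof.
have [x fx xp] := foliated_at F p.
have := ldual_frame fx (cimg_cfun xp); rewrite cfunK // => h.
by eexists (_, _); exact: h.
Qed.

(** A frame chosen at each point without any continuity. By [lam_frame_indep] this does not affect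
    [Lamf] on horizontal forms, which charts compute with the smooth frame [ldual]. *)
Definition frame_at p := sval (cid (frame_exists p)).

Lemma frame_atP p : frame (F p) (omega p) (frame_at p).1 (frame_at p).2.
Proof. exact: svalP (cid (frame_exists p)). Qed.

Definition Lamf a : dform M := fun p => lam (frame_at p).1 (frame_at p).2 (a p).
Definition Lf a : dform M := wedge_form omega a.

Lemma floc_Lamf k x y a : foliated F x -> cimg x y ->
  (forall p, hcovec (F p) k (a p)) ->
  floc x (Lamf a) y = lam transversal (ldual x y) (floc x a y).
Proof.
move=> fx yc ha; apply/funext => s; rewrite /floc /Lamf.
rewrite (lam_frame_indep (omega_presymplectic _) (frame_atP _) (ldual_frame fx yc) (ha _)).
rewrite /lam !fctE; congr (_ *: _).
by rewrite !fct_sumE; apply: eq_bigr.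
Qed.

Lemma lam_ldual k x y (b : covec R m) s : altform k b ->
  lam transversal (ldual x y) b s =
  2^-1 * \sum_i \sum_j invmx (lgram x y) i j * b [:: transversal j, transversal i & s].
Proof.
move=> ab; rewrite /lam !fctE; congr (_ * _); rewrite fct_sumE; apply: eq_bigr => i _.
rewrite /icov -/(icov (ldual x y i) b _) /ldual /dual_basis (icov_sumv _ _ _ ab) fct_sumE.
by apply: eq_bigr => j _; rewrite (icovZv _ _ ab).
Qed.

Lemma basic_hcovec k a p : Omega_bas F k a -> hcovec (F p) k (a p).
Proof. by move=> /basicP[Oa h]; apply: (hcovecI (Oa.1 p)) => v /h[]. Qed.

Lemma floc_LamfE k x y a s : foliated F x -> cimg x y -> Omega_bas F k a ->
  floc x (Lamf a) y s = 2^-1 * \sum_i \sum_j invmx (lgram x y) i j *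
    floc x a y [:: transversal j, transversal i & s].
Proof.
move=> fx yc ba; have /basicP[Oa _] := ba.
rewrite (floc_Lamf fx yc (fun p => basic_hcovec p ba)).
exact: (lam_ldual x y s (floc_altform fx.1 yc Oa.1)).
Qed.

Lemma Cn_lgram l x i j : foliated F x -> Cn l (cimg x) (fun y => lgram x y i j : R).
Proof.
move=> fx; have [om2 _ _] := Fomega; have oc := open_cimg x.
apply: (Cn_ext oc) (floc_smooth fx.1 om2 [:: transversal i; transversal j] l) => y _.
by rewrite mxE.
Qed.

Lemma floc_Lamf_smooth k x a : foliated F x -> Omega_bas F k a ->
  smoothF (cimg x) (floc x (Lamf a)).
Proof.
move=> fx ba s l; have oc := open_cimg x; have /basicP[Oa _] := ba.
have hI := Cn_invmx oc (fun i j => Cn_lgram l i j fx) (fun y yc => lgram_unit fx yc).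
have h : Cn l (cimg x) (fun y => 2^-1 * \sum_i \sum_j invmx (lgram x y) i j *
    floc x a y [:: transversal j, transversal i & s] : R).
  apply: (CnM oc); first exact: Cn_cst.
  apply: (@Cn_sum _ _ _ l (cimg x) _ _ _ (fun i y => \sum_j invmx (lgram x y) i j *
    floc x a y [:: transversal j, transversal i & s] : R) oc) => i _.
  apply: (@Cn_sum _ _ _ l (cimg x) _ _ _ (fun j y => invmx (lgram x y) i j *
    floc x a y [:: transversal j, transversal i & s] : R) oc) => j _.
  exact: (CnM oc (hI i j) (floc_smooth fx.1 Oa _ l)).
by apply: (Cn_ext oc) h => y yc; rewrite (floc_LamfE s fx yc ba).
Qed.

(** As omega and a are basic, their coefficients have zero leafwise derivatives, and so have those
    of the inverse Gram matrix. *)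
Lemma derivF_Lamf k x y u a : foliated F x -> cimg x y -> leafwise n.*2 u ->
  Omega_bas F k a -> derivF u (floc x (Lamf a)) y = 0.
Proof.
move=> fx yc lu ba; have oc := open_cimg x; have /basicP[Oa _] := ba.
apply/funext => s.
have e : \forall z \near y, 2^-1 * (\sum_i \sum_j invmx (lgram x z) i j *
    floc x a z [:: transversal j, transversal i & s] : R) = floc x (Lamf a) z s.
  by apply: filterS (near_open oc yc) => z zc; rewrite (floc_LamfE s fx zc ba).
rewrite /derivF -(near_eq_derive u e).
have hI := Cn_invmx oc (fun i j => Cn_lgram 1 i j fx) (fun y yc => lgram_unit fx yc).
have dI i j : differentiable (fun z => invmx (lgram x z) i j : R) y := (hI i j).1 y yc.
have da r : differentiable (fun z => floc x a z r : R) y := floc_diff fx.1 Oa yc r.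
have D0 i j : 'D_u (fun z => invmx (lgram x z) i j : R) y = 0.
  apply: (derive_invmx_eq0 oc yc (fun i j => Cn_lgram 1 i j fx)
    (fun y yc => lgram_unit fx yc)) => {}i {}j.
  have h := basic_derivF fx yc lu omega_basic.
  have e1 : \forall z \near y, floc x omega z [:: transversal i; transversal j] = lgram x z i j :> R.
    by apply: filterS (near_open oc yc) => z _; rewrite mxE.
  rewrite -(near_eq_derive u e1).
  exact: (congr1 (fun w : covec R m => w [:: transversal i; transversal j]) h).
have Da r : 'D_u (fun z => floc x a z r : R) y = 0.
  exact: (congr1 (fun w : covec R m => w r) (basic_derivF fx yc lu ba)).
have dM i j : differentiable (fun z => invmx (lgram x z) i j *
    floc x a z [:: transversal j, transversal i & s] : R) y.
  exact: differentiableM.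
have dS i : differentiable (fun z => \sum_j invmx (lgram x z) i j *
    floc x a z [:: transversal j, transversal i & s] : R) y.
  exact: (diff_real_sum _ (dM i)).
apply: (etrans (derive_real_scale _ _ (diff_real_sum _ dS))).
rewrite (derive_real_sum _ _ dS) big1 ?mulr0 // => i _.
rewrite (derive_real_sum _ _ (dM i)) big1 // => j _.
by rewrite (derive_real_mul u (dI i j) (da _)) D0 Da mul0r mulr0 addr0.
Qed.

Lemma Lamf_basic k a : Omega_bas F k.+2 a -> Omega_bas F k (Lamf a).
Proof.
move=> ba.
have hL p : hcovec (F p) k (Lamf a p).
  have := hgr_lam (frame_atP p) (basic_hcovec p ba : hgr (F p) k.+2%:Z (a p)).
  by have -> : (k.+2%:Z - 2 = k%:Z)%R by lia.
apply: basic_local.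
- apply: OmegaP => p; first exact: (hL p).1.
  have [x fx xp] := foliated_at F p; exists x; split=> //; first exact: fx.1.
  exact: (floc_Lamf_smooth fx ba).
- by move=> p v vF; exact: hcovec_icovP (hL p) v vF.
- by move=> x y u fx yc lu; exact: (derivF_Lamf fx yc lu ba).
Qed.

Lemma Lamf_basic_low k a : (k < 2)%N -> Omega_bas F k a -> Lamf a = 0.
Proof.
move=> k2 ba; apply/funext => p.
have := hgr_lam (frame_atP p) (basic_hcovec p ba : hgr (F p) k%:Z (a p)).
by have -> : (k%:Z - 2 = Negz (1 - k))%R by lia.
Qed.
End SymplecticFoliation.

(** * The sl2-module of basic forms *)

Section BasicModule.
Variables (R : realType) (m n : nat) (M : manifold R m) (F : foliation M n.*2).
Variable omega : dform M.
Hypothesis Fomega : transversely_symplectic F omega.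
Implicit Types (a b : dform M).
Let X p := (frame_at Fomega p).1.
Let Y p := (frame_at Fomega p).2.
Let ps := omega_presymplectic Fomega.
Let fr := frame_atP Fomega.

Lemma Lf_is_linear : linear (Lf omega).
Proof. by move=> r a b; apply/funext => p; exact: (wedge_is_linear (omega p) r (a p) (b p)). Qed.

Lemma Lamf_is_linear : linear (Lamf Fomega).
Proof. by move=> r a b; apply/funext => p; exact: (lam_is_linear (X p) (Y p) r (a p) (b p)). Qed.

HB.instance Definition _ :=
  GRing.isLinear.Build R (dform M) (dform M) *:%R (Lf omega) Lf_is_linear.
HB.instance Definition _ :=
  GRing.isLinear.Build R (dform M) (dform M) *:%R (Lamf Fomega) Lamf_is_linear.

Definition basg (z : int) a := if z is Posz k then Omega_bas F k a else a = 0.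

Lemma basg_hgr z a p : basg z a -> hgr (F p) z (a p).
Proof. by case: z => k /= => [/basic_hcovec|->]. Qed.

Lemma Omega_bas_lin k (r : R) a b :
  Omega_bas F k a -> Omega_bas F k b -> Omega_bas F k (r *: a + b).
Proof.
move=> /basicP[Oa ha] /basicP[Ob hb]; apply/basicP; split; first exact: Omega_lin.
move=> p v vF; have [a0 da0] := ha p v vF; have [b0 db0] := hb p v vF.
rewrite (extd_lin r Oa Ob); split.
  by rewrite [(_ + _) p]/(r *: a p + b p) icovD icovZ a0 b0 scaler0 addr0.
by rewrite [(_ + _) p]/(r *: extd a p + extd b p) icovD icovZ da0 db0 scaler0 addr0.
Qed.

Lemma extd0 : extd (0 : dform M) = 0.
Proof.
apply/funext => p; rewrite extd_dE.
have -> : floc (chart_at p) (0 : dform M) = fun=> 0 by [].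
exact: dE_zero.
Qed.

Lemma Omega_bas0 k : Omega_bas F k (0 : dform M).
Proof.
by apply/basicP; split; [exact: Omega0|move=> p v _; rewrite extd0].
Qed.

Lemma basg_graded : graded n basg.
Proof.
split=> [[k|k] r a b|[k|k]|[k|k] a ba] //=.
- exact: Omega_bas_lin.
- by move=> -> ->; rewrite scaler0 addr0.
- exact: Omega_bas0.
- move=> kn; apply/funext => p; apply: (hcovec_bound (fr p) _ (basic_hcovec p ba)).
  by move: kn; lia.
Qed.

Lemma Omega_bas_extd k a : Omega_bas F k a -> Omega_bas F k.+1 (extd a).
Proof.
move=> /basicP[Oa ha]; apply/basicP; split; first exact: Omega_extd.
move=> p v vF; rewrite (extd_extd Oa); split=> //; exact: (ha p v vF).2.
Qed.

Lemma extd_Lf k a : Omega k a -> extd (Lf omega a) = Lf omega (extd a).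
Proof.
move=> Oa; have [om2 d0 _] := Fomega; rewrite /Lf (extd_wedge om2 Oa) d0.
apply/funext => p; rewrite /wedge_form.
rewrite [(_ + _) p]/(wedge 0 (a p) + wedge (sgcov (omega p)) (extd a p)).
have e : sgcov (omega p) = omega p by rewrite (sgcov_altform (om2.1 p)) sqrrN expr1n scale1r.
rewrite wedge0l e; exact: add0r.
Qed.

Lemma Omega_bas_Lf k a : Omega_bas F k a -> Omega_bas F k.+2 (Lf omega a).
Proof.
move=> ba; have /basicP[Oa _] := ba; have [om2 _ _] := Fomega.
apply/basicP; split; first exact: (Omega_wedge om2 Oa).
have h2 p := presymplectic_hcovec (ps p).
move=> p v vF; rewrite (extd_Lf Oa); split.
  have h := hcovec_wedge (h2 p) (basic_hcovec p ba).
  exact: (hcovec_icovP h vF).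
have h := hcovec_wedge (h2 p) (basic_hcovec p (Omega_bas_extd ba)).
exact: (hcovec_icovP h vF).
Qed.

Lemma basg_stable : stable n (Lf omega) (Lamf Fomega) basg.
Proof.
split; first exact: basg_graded.
- move=> [k|k] a ba.
    have -> : (Posz k + 2 = k.+2%:Z)%R by lia.
    exact: Omega_bas_Lf.
  rewrite (ba : a = 0) linear0; exact: (gr_zero basg_graded).
- move=> [[|[|k]]|k] a ba.
  + exact: (Lamf_basic_low Fomega (isT : (0 < 2)%N) ba).
  + exact: (Lamf_basic_low Fomega (isT : (1 < 2)%N) ba).
  + have -> : (Posz k.+2 - 2 = k%:Z)%R by lia.
    exact: Lamf_basic.
  + by rewrite (ba : a = 0) linear0; exact: (gr_zero basg_graded).
Qed.

Lemma iter_Lf p j a : iter j (Lf omega) a p = iter j (wedge (omega p)) (a p).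
Proof. by elim: j => //= j <-. Qed.

Lemma iter_Lamf p j a : iter j (Lamf Fomega) a p = iter j (lam (X p) (Y p)) (a p).
Proof. by elim: j => //= j <-. Qed.

Lemma Lpow_Lf p z a : Lpow (Lf omega) z a p = Lpow (wedge (omega p)) z (a p).
Proof. by case: z => //= j; rewrite -iter_Lf. Qed.

Lemma weyl_form p c z a : weyl n (Lf omega) (Lamf Fomega) c z a p =
  weyl n (wedge (omega p)) (lam (X p) (Y p)) c z (a p).
Proof.
rewrite /weyl fct_sumE; apply: eq_bigr => j _.
rewrite -iter_Lamf -Lpow_Lf; reflexivity.
Qed.

(** The identities in L, Lam and S alone hold at each point by linear algebra; those on d come from
    the calculus of smooth forms and from d omega = 0. *)
Lemma basic_ddelta_module : ddelta_module n (Lf omega) (Lamf Fomega) basg (@extd R m M).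
Proof.
split.
- exact: basg_stable.
- move=> z a ba; apply/funext => p.
  exact: (hgr_comm (ps p) (fr p) (basg_hgr p ba)).
- move=> [k|k] r a b /= => [/basicP[Oa _] /basicP[Ob _]|-> ->].
    exact: (extd_lin r Oa Ob).
  by rewrite scaler0 addr0 extd0 scaler0 addr0.
- move=> [k|k] a ba.
    have -> : (Posz k + 1 = k.+1%:Z)%R by lia.
    exact: Omega_bas_extd.
  rewrite (ba : a = 0) extd0; exact: (gr_zero basg_graded).
- by move=> [k|k] a /= => [/basicP[Oa _]|->]; [exact: (extd_extd Oa)|rewrite !extd0].
- move=> [k|k] a /= => [/basicP[Oa _]|->]; first exact: (extd_Lf Oa).
  by rewrite extd0 linear0 extd0.
- exists (fun z => (-1) ^+ (n + `|z|)%N) => [z|z a ba]; first by rewrite signr_eq0.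
  apply/funext => p; rewrite !weyl_form.
  exact: (weyl_weyl (ps p) (fr p) (basg_hgr p ba)).
- move=> z a ba; apply/funext => p.
  rewrite weyl_form.
  rewrite [RHS](_ : _ = - lam (X p) (Y p) (weyl n (Lf omega) (Lamf Fomega) n z a p)) // weyl_form.
  exact: (weyl_wedge_sg (ps p) (fr p) (basg_hgr p ba)).
Qed.
End BasicModule.

(** * Star, codifferential and Lefschetz map on basic forms *)

Section Translation.
Variables (R : realType) (m n : nat) (M : manifold R m) (F : foliation M n.*2).
Variable omega : dform M.
Hypothesis Fomega : transversely_symplectic F omega.
Implicit Types (a b c : dform M).

Let dm := basic_ddelta_module Fomega.
Let gA := basg_graded Fomega.
Local Notation d := (@extd R m M).
Local Notation cod := (codiff (Lamf Fomega) d).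
Local Notation S := (weyl n (Lf omega) (Lamf Fomega) n).

Lemma star_weyl k a : Omega_bas F k a -> star F omega k a = star_sign R k *: S k a.
Proof.
move=> ba; apply/funext => p; rewrite /star.
rewrite (star_atE (omega_presymplectic Fomega p) (frame_atP Fomega p) (basic_hcovec p ba)).
by rewrite -weyl_form.
Qed.

(** The scalar collects the sign in delta, the signs relating S to the star in degrees k and 2n-k+1,
    and S^2. It depends on k alone, so kernels and images are unaffected. *)
Lemma delta_codiff k : exists2 r : R, r != 0 &
  forall a, Omega_bas F k a -> delta F omega k a = r *: cod a.
Proof.
have [r r0 hr] := dm_SS dm.
(* Above degree 2n the subtraction is truncated, but 0 is the only basic form and any non-zero
   scalar will do. *)
have [kn|nk] := leqP k n.*2; last first.
  exists 1; rewrite ?oner_neq0 // => a ba.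
  have -> : a = 0 by apply: (gr_bound gA (ba : basg F k a)); lia.
  rewrite /delta (star_weyl (Omega_bas0 F k)) weyl0 scaler0 extd0.
  rewrite (star_weyl (Omega_bas0 F _)) weyl0 !scaler0 scale1r.
  by rewrite (additive_on0 gA (codiff_lin dm)).
exists ((-1) ^+ k.+1 * (star_sign R (n.*2 - k).+1 * (star_sign R k * r k%:Z))).
  by rewrite !mulf_neq0 ?signr_eq0 ?star_sign_neq0.
move=> a ba; rewrite /delta (star_weyl ba).
have bS : basg F (n.*2 - k)%:Z (S k a).
  by have := weyl_deg dm (ba : basg F k a); have -> : 2 * n%:Z - k%:Z = (n.*2 - k)%:Z by lia.
have /basicP[OS _] := (bS : Omega_bas F (n.*2 - k) (S k a)).
have eS : d (star_sign R k *: S k a) = star_sign R k *: d (S k a).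
  by have := extd_lin (star_sign R k) OS (Omega0 M 0); rewrite extd0 !addr0.
have bd : Omega_bas F (n.*2 - k).+1 (d (S k a)) by exact: Omega_bas_extd.
rewrite eS (star_weyl (gr_scale (k := (n.*2 - k).+1) _ gA bd)) weylZ.
have e1 := weyl_d dm bS.
have -> : Posz (n.*2 - k).+1 = (n.*2 - k)%:Z + 1 by lia.
rewrite e1.
have -> : (n.*2 - k)%:Z = 2 * n%:Z - k%:Z by lia.
rewrite (hr _ _ (ba : basg F k a)).
rewrite (additive_onZ _ gA (codiff_lin dm) (ba : basg F k a)).
have scal (V : lmodType R) (t1 t2 t3 t4 : R) (v : V) :
  t1 *: (t2 *: (t3 *: (t4 *: v))) = (t1 * (t2 * (t3 * t4))) *: v by rewrite !scalerA !mulrA.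
exact: scal.
Qed.

(** Images are defined as unions over all source degrees; since a form of two distinct degrees is 0,
    only the expected source degree matters. *)
Lemma basg_eq0 (k l : int) a : basg F k a -> basg F l a -> k <> l -> a = 0.
Proof.
move=> ba ba' kl; apply/funext => p; apply/funext => s.
have := basg_hgr p ba; have := basg_hgr p ba'.
case: k l kl {ba ba'} => k [l|l] kl /=; try by move=> *; congruence.
- move=> [h1 _] [h2 _]; have [sl|sl] := eqVneq (size s) l.
    by apply: (altform_size h2); rewrite sl; apply/eqP => lk; apply: kl; rewrite lk.
  exact: (altform_size h1).
- by move=> ->.
- by move=> _ ->.
- by move=> ->.
Qed.

Lemma exactE k a : im_d F k a <-> exact (basg F) d k a.
Proof.
split=> [[ba [j _ [b bb ba']]]|ea].
  have bd : basg F (j%:Z + 1) a by rewrite -ba'; exact: (dm_d_deg dm (bb : basg F j b)).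
  have [jk|jk] := eqVneq (j%:Z + 1) k.
    by exists b => //; rewrite -jk addrK.
  by rewrite (basg_eq0 bd (ba : basg F k a) (elimN eqP jk)); exact: (exact0 dm).
split; first exact: (exact_A dm ea).
have [b bb <-] := ea.
(* In degree 0 the potential has degree -1, hence is 0, and the zero form of degree 0 serves
   instead. *)
case: k bb {ea} => [|k] bb.
  by exists 0%N => //; exists 0; [exact: Omega_bas0|rewrite (bb : b = 0)].
by exists k => //; exists b => //; move: bb; have -> : k.+1%:Z - 1 = k by lia.
Qed.

Lemma coexactE k a : im_delta F omega k a <-> coexact (Lamf Fomega) (basg F) d k a.
Proof.
split=> [[ba [j _ [b bb ba']]]|ea].
  have [r r0 hr] := delta_codiff j.
  have ea : cod (r *: b) = a.
    by rewrite (additive_onZ _ gA (codiff_lin dm) (bb : basg F j b)) -hr.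
  have bb' : basg F j (r *: b) by exact: (gr_scale _ gA).
  have bd : basg F (j%:Z - 1) a by rewrite -ea; exact: (codiff_deg dm bb').
  have [jk|jk] := eqVneq (j%:Z - 1) k.
    by exists (r *: b) => //; rewrite -jk subrK.
  rewrite (basg_eq0 bd (ba : basg F k a) (elimN eqP jk)); exists 0.
    exact: (gr_zero gA).
  exact: (additive_on0 gA (codiff_lin dm)).
have [b bb eb] := ea.
split.
  rewrite -eb; have := codiff_deg dm bb.
  by rewrite addrK.
have [r r0 hr] := delta_codiff k.+1.
have bb1 : Omega_bas F k.+1 b by move: bb; have -> : k%:Z + 1 = k.+1 by lia.
have bb' : Omega_bas F k.+1 (r^-1 *: b) by exact: (gr_scale (k := k.+1) _ gA bb1).
exists k.+1 => //; exists (r^-1 *: b) => //.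
rewrite hr // (additive_onZ _ gA (codiff_lin dm) (bb1 : basg F k.+1 b)).
by rewrite scalerA divff // scale1r.
Qed.

Lemma dcodiffE k a : im_ddelta F omega k a <-> dcodiff (Lamf Fomega) (basg F) d k a.
Proof.
split=> [[ba [j _ [b bb ba']]]|ea].
  have [r r0 hr] := delta_codiff j.
  have bb' : basg F j (r *: b) by exact: (gr_scale _ gA).
  have ea : d (cod (r *: b)) = a.
    by rewrite (additive_onZ _ gA (codiff_lin dm) (bb : basg F j b)) -hr.
  have bd : basg F j a.
    by rewrite -ea; have := dm_d_deg dm (codiff_deg dm bb'); rewrite subrK.
  have [jk|jk] := eqVneq (j%:Z) k; first by exists (r *: b) => //; rewrite -jk.
  by rewrite (basg_eq0 bd (ba : basg F k a) (elimN eqP jk)); exact: (dcodiff0 dm).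
have [e1 _] := dcodiff_exact dm ea.
split; first exact: (exact_A dm e1).
have [b bb eb] := ea.
have [r r0 hr] := delta_codiff k.
have bb' : Omega_bas F k (r^-1 *: b) by exact: (gr_scale (k := k) _ gA bb).
exists k => //; exists (r^-1 *: b) => //.
rewrite hr // (additive_onZ _ gA (codiff_lin dm) (bb : basg F k b)).
by rewrite scalerA divff // scale1r.
Qed.

Lemma ker_deltaE k a : ker_delta F omega k a <-> Omega_bas F k a /\ cod a = 0.
Proof.
have [r r0 hr] := delta_codiff k.
split=> [[ba h]|[ba h]]; split=> //.
  apply/eqP; have := h; rewrite /= hr // => /eqP.
  by rewrite scaler_eq0 (negbTE r0).
by rewrite /= hr // h scaler0.
Qed.

Lemma exact_ddeltaE k : im_d F k `&` ker_delta F omega k = im_ddelta F omega k <->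
  exact_ddelta (Lamf Fomega) (basg F) d k.
Proof.
split=> [h a ba ea ca|h].
  apply/dcodiffE; rewrite -h; split; first exact/exactE.
  exact/ker_deltaE.
apply/seteqP; split=> a.
  by move=> [/exactE ea /ker_deltaE[ba ca]]; apply/dcodiffE; exact: h.
move=> /dcodiffE da; have [ea ca] := dcodiff_exact dm da.
by split; [exact/exactE|apply/ker_deltaE; split=> //; exact: (exact_A dm ea)].
Qed.

Lemma coexact_ddeltaE k : im_ddelta F omega k = im_delta F omega k `&` ker_d F k <->
  coexact_ddelta (Lamf Fomega) (basg F) d k.
Proof.
split=> [h a ba ea ca|h].
  by apply/dcodiffE; rewrite h; split; [exact/coexactE|split].
apply/seteqP; split=> a.
  move=> /dcodiffE da; have [ea _] := dcodiff_exact dm da.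
  have [ca ca'] := dcodiff_coexact dm da.
  by split; [exact/coexactE|split=> //; exact: (exact_A dm ea)].
by move=> [/coexactE ea [ba ca]]; apply/dcodiffE; exact: h.
Qed.

Lemma lefschetzE j a : lefschetz omega j a = iter j (Lf omega) a.
Proof.
apply/funext => p; rewrite iter_Lf /lefschetz /wedge_form.
elim: j => [|j IHj]; first exact: wedge1l.
by rewrite /wpow !iterS -/(wpow _ _) -wedgeA IHj.
Qed.

Lemma basic_class_eq k a b : ker_d F k a -> ker_d F k b ->
  basic_class F k a = basic_class F k b <-> exact (basg F) d k (a - b).
Proof.
move=> ka kb; split=> [h|h].
  have : basic_class F k a a.
    by split=> //; apply/exactE; rewrite subrr; exact: (exact0 dm).
  by rewrite h => -[_ /exactE].
apply/seteqP; split=> c [kc /exactE ec]; split=> //; apply/exactE.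
  by have := exactD dm ec h; rewrite addrA subrK.
by have := exactB dm ec h; rewrite opprB addrA subrK.
Qed.

Lemma ker_d_lin k (r : R) a b : ker_d F k a -> ker_d F k b -> ker_d F k (r *: a + b).
Proof.
move=> [ba da] [bb db]; split; first exact: (Omega_bas_lin r ba bb).
have /basicP[Oa _] := ba; have /basicP[Ob _] := bb.
by rewrite /= (extd_lin r Oa Ob) (da : d a = 0) (db : d b = 0) scaler0 addr0.
Qed.

Lemma ker_dB k a b : ker_d F k a -> ker_d F k b -> ker_d F k (a - b).
Proof. by move=> ka kb; have := ker_d_lin (-1) kb ka; rewrite scaleN1r addrC. Qed.

Lemma ker_d_lefschetz k a : (k <= n)%N -> ker_d F k a ->
  ker_d F (n.*2 - k) (iter (n - k) (Lf omega) a).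
Proof.
move=> kn [ba da]; split.
  have := st_iterL (basg_stable Fomega) (n - k) (ba : basg F k a).
  by have -> : k%:Z + (n - k).*2%:Z = (n.*2 - k)%:Z by lia.
by rewrite /= (d_iterL dm (n - k) (ba : basg F k a)) (da : d a = 0) iter_lin0.
Qed.

Lemma lefschetz_classE k a : (k <= n)%N -> ker_d F k a ->
  lefschetz_class F omega k (basic_class F k a) =
  basic_class F (n.*2 - k) (iter (n - k) (Lf omega) a).
Proof.
move=> kn ka; rewrite /lefschetz_class.
have h c : ker_d F k c -> exact (basg F) d k (c - a) ->
    basic_class F (n.*2 - k) (lefschetz omega (n - k) c) =
    basic_class F (n.*2 - k) (iter (n - k) (Lf omega) a).
  move=> kc ec; rewrite lefschetzE.
  apply/basic_class_eq; try exact: ker_d_lefschetz.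
  by rewrite -iter_linB; apply: (exact_iterL dm _ ec); lia.
apply/seteqP; split=> b.
  by move=> [c [kc /exactE ec] bc]; rewrite -(h c kc ec).
move=> hb; exists a; last by rewrite lefschetzE.
by split=> //; apply/exactE; rewrite subrr; exact: (exact0 dm).
Qed.

Lemma ker_d0 k : ker_d F k (0 : dform M).
Proof. by split; [exact: Omega_bas0|exact: extd0]. Qed.

Lemma transverse_lefschetzE s : (s < n)%N -> transverse_lefschetz F omega s <->
  lefschetz_upto n (Lf omega) (basg F) d s.
Proof.
move=> sn; split=> h k ks; have kn : (k <= n)%N by lia.
  have ek : n.*2%:Z - k%:Z = (n.*2 - k)%:Z by lia.
  rewrite !ek; have [_ hi hs] := h k ks; split=> [a ba da ea|c bc dc].
    have ka : ker_d F k a by [].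
    (* Injectivity on cosets is used against the zero class. *)
    have := hi (basic_class F k a) (basic_class F k 0).
    rewrite !inE => /(_ (ex_intro2 _ _ a ka erefl) (ex_intro2 _ _ 0 (ker_d0 k) erefl)).
    rewrite (lefschetz_classE kn ka) (lefschetz_classE kn (ker_d0 k)) iter_lin0 => hk.
    have : basic_class F k a = basic_class F k 0.
      apply: hk; apply/(basic_class_eq (ker_d_lefschetz kn ka) (ker_d0 _)).
      by rewrite subr0.
    by move/(basic_class_eq ka (ker_d0 k)); rewrite subr0.
  have kc : ker_d F (n.*2 - k) c by [].
  have [_ [a ka <-]] := hs _ (ex_intro2 _ _ c kc erefl).
  rewrite (lefschetz_classE kn ka) => e.
  exists a; first by case: ka.
  exact/(basic_class_eq kc (ker_d_lefschetz kn ka)).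
have ek : n.*2%:Z - k%:Z = (n.*2 - k)%:Z by lia.
have [hi hs] := h k ks; rewrite !ek in hi hs; split.
- move=> _ [a ka <-]; rewrite (lefschetz_classE kn ka).
  by exists (iter (n - k) (Lf omega) a) => //; exact: ker_d_lefschetz.
- move=> C C'; rewrite !inE => -[a ka <-] [a' ka' <-].
  rewrite !lefschetz_classE // => /basic_class_eq ee.
  apply/basic_class_eq => //; have [ba da] := ker_dB ka ka'.
  apply: hi => //; rewrite iter_linB; apply: ee; exact: ker_d_lefschetz.
- move=> _ [c [bc dc] <-]; have [a [ba da] ea] := hs c bc dc.
  have ka : ker_d F k a by [].
  exists (basic_class F k a); first by exists a.
  rewrite lefschetz_classE //; apply/esym/basic_class_eq => //.
  exact: ker_d_lefschetz.
Qed.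
End Translation.

Theorem theorem4p8 (R : realType) (m n s : nat) (M : manifold R m)
    (F : foliation M n.*2) (omega : dform M)
    (Fomega : transversely_symplectic F omega)
    (Mconn : connected [set: M])
    (sn : (s < n)%N) :
  let lefschetz_s := transverse_lefschetz F omega s in
  let ddelta_lemma_s :=
    (forall k, (k <= s)%N ->
       im_d F k `&` ker_delta F omega k = im_ddelta F omega k /\
       im_ddelta F omega k = im_delta F omega k `&` ker_d F k) /\
    im_d F s.+1 `&` ker_delta F omega s.+1 = im_ddelta F omega s.+1 in
  let dual_ddelta_lemma_s :=
    (forall k, (n.*2 - s <= k)%N ->
       im_d F k `&` ker_delta F omega k = im_ddelta F omega k /\
       im_ddelta F omega k = im_delta F omega k `&` ker_d F k) /\
    im_delta F omega (n.*2 - s - 1) `&` ker_d F (n.*2 - s - 1) =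
      im_ddelta F omega (n.*2 - s - 1) in
  (lefschetz_s <-> ddelta_lemma_s) /\
  (ddelta_lemma_s <-> dual_ddelta_lemma_s).
Proof.
have dE k := exact_ddeltaE Fomega k; have cE k := coexact_ddeltaE Fomega k.
have [h1 h2] := lefschetz_iff_ddelta (basic_ddelta_module Fomega) sn.
set A := ddelta_upto _ _ _ _ in h1 h2; set B := dual_ddelta_upto _ _ _ _ _ in h2.
have e1 := transverse_lefschetzE Fomega sn.
move=> P1 P2 P3.
have e2 : P2 <-> A.
  split=> -[h h']; split; try exact/dE.
  - by move=> k ks; have [hd hc] := h k ks; split; [exact/dE|exact/cE].
  - by move=> k ks; have [hd hc] := h k ks; split; [exact/dE|exact/cE].
have e3 : P3 <-> B.
  split=> -[h h']; split.
  - by move=> k ks; have [hd hc] := h k ks; split; [exact/dE|exact/cE].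
  - exact/cE/esym.
  - by move=> k ks; have [hd hc] := h k ks; split; [exact/dE|exact/cE].
  - exact/esym/cE.
by split; tauto.
Qed.
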